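(* Let $v$ be the solution of $$\begin{cases} {}^{C}_0\mathbb{D}^{\alpha,\lambda}_{\tau} v(x,\tau)=\frac12\sigma^2\frac{\partial^2 v}{\partial x^2}(x,\tau)-q\,v(x,\tau)+g(x,\tau), & (x,\tau)\in\Omega\times(0,T],\\ v(x,0)=\varsigma(x), & x\in\Omega,\\ v(x,\tau)=0, & (x,\tau)\in\partial\Omega\times(0,T]. \end{cases}$$ Let $\epsilon>0$ be arbitrary. Assume that $\varsigma,\ g(\cdot,\tau)\in H\big(\mathcal{L}^{\frac{5+\epsilon}{2}}\big)$, and that $g_\tau(\cdot,\tau)$ and $g_{\tau\tau}(\cdot,\tau)$ are in $H\big(\mathcal{L}^{\frac{5+\epsilon}{2}}\big)$, for each $\tau\in(0,T]$, with $$\|g(\cdot,\tau)\|_{\mathcal{L}^{\frac{5+\epsilon}{2}}}+\|g_\tau(\cdot,\tau)\|_{\mathcal{L}^{\frac{1+\epsilon}{2}}}+\tau^\rho\|g_{\tau\tau}(\cdot,\tau)\|_{\mathcal{L}^{\frac{1+\epsilon}{2}}}\le C_1$$ for all $\tau\in(0,T]$ and some constant $\rho<1$, where $C_1$ is a constant independent of $\tau$. Then there exists a constant $C$ such that $$\Big|\frac{\partial^p v(x,\tau)}{\partial x^p}\Big|\le C\ \ \text{for } p=0,1,2,3,4,\qquad \Big|\frac{\partial^\ell v(x,\tau)}{\partial\tau^\ell}\Big|\le C\big(1+\tau^{\alpha-\ell}\big)\ \ \text{for }\ell=0,1,2,$$ for all $(x,\tau)\in\bar\Omega\times(0,T]$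.
   Context: Parameters: $\alpha\in(0,1)$, $\lambda\ge0$, $T>0$, $\sigma>0$, $r>0$, $c\in\mathbb{R}$, $q=\frac{c^2}{2\sigma^2}+r>0$. $\Omega=(x_l,x_r)$, $\bar\Omega=[x_l,x_r]$, $\partial\Omega=\{x_l,x_r\}$. The functions $\varsigma$ and $g$ are given data. Tempered Caputo derivative: ${}^{C}_0\mathbb{D}^{\alpha,\lambda}_{\tau}v(x,\tau)=\frac{e^{-\lambda\tau}}{\Gamma(1-\alpha)}\int_0^\tau\frac{1}{(\tau-\eta)^\alpha}\frac{\partial[e^{\lambda\eta}v(x,\eta)]}{\partial\eta}\,d\eta$. $\{(\mu_i,\psi_i)\}_{i\ge1}$ are the eigenvalues and eigenfunctions of the Sturm–Liouville problem $\mathcal{L}\psi_i:=-\frac{\sigma^2}{2}\psi_i''+q\psi_i=\mu_i\psi_i$ on $(x_l,x_r)$, $\psi_i(x_l)=\psi_i(x_r)=0$, normalised by $\|\psi_i\|_{L_2(\Omega)}=1$ (all $\mu_i>0$). For $\nu\in\mathbb{R}$, with $\langle\cdot,\cdot\rangle$ the $L_2(\Omega)$ inner product, $$H(\mathcal{L}^\nu)=\Big\{w\in L_2(\Omega):\ \sum_{i=1}^\infty\mu_i^{2\nu}|\langle w,\psi_i\rangle|^2<\infty\Big\},\qquad \|w\|_{\mathcal{L}^\nu}=\Big(\sum_{i=1}^\infty\mu_i^{2\nu}|\langle w,\psi_i\rangle|^2\Big)^{1/2}.$$ *)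

(* Defs.v *)
From mathcomp Require Export all_boot all_order all_algebra.
From mathcomp Require Export all_classical all_reals all_analysis.
Export Order.TTheory GRing.Theory Num.Theory.
Export numFieldNormedType.Exports.

Set Implicit Arguments.
Unset Strict Implicit.
Unset Printing Implicit Defensive.

Local Open Scope classical_set_scope.
Local Open Scope ring_scope.

(** Derivatives relative to an interval [D]: only the values of [f] on [D]
    matter, and at an endpoint belonging to [D] the derivative is one-sided.
    At an interior point of [D] they agree with the library's [derive1].
    They are meant for intervals [D] with more than one point. *)
Section derivative_in.
Context {R : realType}.
Implicit Types (D : interval R) (f : R -> R).

Definition diff_quotient f (x y : R) : R := (f y - f x) / (y - x).

Definition derivable_in D f (x : R) : Prop :=
  cvg (diff_quotient f x y @[y --> within [set` D] x^']).

Definition derive_in D f (x : R) : R :=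
  lim (diff_quotient f x y @[y --> within [set` D] x^']).

Definition derive_in_n D (n : nat) f : R -> R := iter n (derive_in D) f.

(* all derivatives up to order [n] exist at every point of [D] *)
Definition derivable_in_n D (n : nat) f : Prop :=
  forall k x, (k < n)%N -> x \in D -> derivable_in D (derive_in_n D k f) x.

End derivative_in.

Section L2.
Context {R : realType}.
Implicit Types (xl xr : R) (w u : R -> R).

(* functions are total on [R]; only their restriction to ]xl, xr[ is used *)
Definition in_L2 xl xr w : Prop :=
  (w \_ [set` `]xl, xr[]) \in Lfun (@lebesgue_measure R) 2%:E.

Definition inner_L2 xl xr w u : R :=
  \int[lebesgue_measure]_(x in [set` `]xl, xr[]) (w x * u x).

Definition norm_L2 xl xr w : R := Num.sqrt (inner_L2 xl xr w w).

End L2.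

Section sturm_liouville.
Context {R : realType}.
Variables (sigma q xl xr : R).

(** [phi] is a (possibly zero) solution of
    [- sigma^2/2 phi'' + q phi = m phi], [phi xl = phi xr = 0]. *)
Definition SL_solution (m : R) (phi : R -> R) : Prop :=
  [/\ {within [set` `[xl, xr]], continuous phi},
      forall x : R, x \in `]xl, xr[ -> derivable phi x 1 /\ derivable (derive1 phi) x 1,
      forall x : R, x \in `]xl, xr[ ->
        - (sigma ^+ 2 / 2) * derive1n 2 phi x + q * phi x = m * phi x
    & phi xl = 0 /\ phi xr = 0].

(** [(mu i, psi i)] lists the eigenvalues, each exactly once (they are all
    simple), with normalised eigenfunctions.  Indices start at 0. *)
Definition SL_eigensystem (mu : nat -> R) (psi : nat -> R -> R) : Prop :=
  [/\ injective mu,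
      forall i, SL_solution (mu i) (psi i),
      forall i, norm_L2 xl xr (psi i) = 1
    & forall m phi, SL_solution m phi ->
        (exists2 x, x \in `]xl, xr[ & phi x != 0) -> exists i, m = mu i].

End sturm_liouville.

Section HL.
Context {R : realType}.
Variables (xl xr : R) (mu : nat -> R) (psi : nat -> R -> R).

Definition HL_series (nu : R) (w : R -> R) : R ^nat :=
  series (fun i => mu i `^ (2 * nu) * `|inner_L2 xl xr w (psi i)| ^+ 2).

Definition in_HL (nu : R) (w : R -> R) : Prop :=
  in_L2 xl xr w /\ cvgn (HL_series nu w).

Definition norm_HL (nu : R) (w : R -> R) : R :=
  Num.sqrt (limn (HL_series nu w)).

End HL.

Section tempered_caputo.
Context {R : realType}.

Definition Gamma (s : R) : R :=
  \int[lebesgue_measure]_(t in [set` `]0, +oo[]) (t `^ (s - 1) * expR (- t)).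

Definition tempered_caputo (alpha lambda : R) (f : R -> R) (tau : R) : R :=
  expR (- lambda * tau) / Gamma (1 - alpha) *
  \int[lebesgue_measure]_(eta in [set` `]0, tau[])
    ((tau - eta) `^ (- alpha) * derive1 (fun s : R => expR (lambda * s) * f s) eta).

End tempered_caputo.

(** Classical solutions, in the sense customary for time-fractional diffusion
    equations (Luchko): [v] is continuous on the closed domain, [v (., tau)] is
    C^2 on the open interval, and [v (x, .)] is C^1 on ]0, T] with a derivative
    integrable on ]0, T[.  The last condition makes the integral in the Caputo
    derivative absolutely convergent, and continuity at [tau = 0] is what ties
    the initial value to the equation. *)
Section problem.
Context {R : realType}.

Definition classical_regularity (T xl xr : R) (v : R -> R -> R) : Prop :=
  [/\ {within [set` `[xl, xr]] `*` [set` `[0, T]],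
        continuous (fun z : R * R => v z.1 z.2)},
      forall tau : R, tau \in `]0, T] ->
        (forall x : R, x \in `]xl, xr[ ->
           derivable (v^~ tau) x 1 /\ derivable (derive1 (v^~ tau)) x 1) /\
        {within [set` `]xl, xr[], continuous (derive1n 2 (v^~ tau))}
    & forall x : R, x \in `]xl, xr[ ->
        [/\ derivable_in_n `]0, T] 1 (v x),
            {within [set` `]0, T]], continuous (derive_in `]0, T] (v x))}
          & lebesgue_measure.-integrable [set` `]0, T[]
              (fun tau => (derive_in `]0, T] (v x) tau)%:E)]].

Definition is_solution (alpha lambda T sigma q xl xr : R)
    (varsigma : R -> R) (g v : R -> R -> R) : Prop :=
  [/\ classical_regularity T xl xr v,
      forall x tau : R, x \in `]xl, xr[ -> tau \in `]0, T] ->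
        tempered_caputo alpha lambda (v x) tau =
          1 / 2 * sigma ^+ 2 * derive1n 2 (v^~ tau) x - q * v x tau + g x tau,
      forall x : R, x \in `]xl, xr[ -> v x 0 = varsigma x
    & forall tau : R, tau \in `]0, T] -> v xl tau = 0 /\ v xr tau = 0].

End problem.

(* Main.v *)
Require Import Defs.
From mathcomp Require Import all_boot all_order all_algebra.
From mathcomp Require Import all_classical all_reals all_analysis.
From mathcomp Require Import measurable_realfun.
From mathcomp Require Import ring lra.
Import Order.TTheory GRing.Theory Num.Theory Num.Def.
Import numFieldNormedType.Exports.

Set Implicit Arguments.
Unset Strict Implicit.
Unset Printing Implicit Defensive.

Local Open Scope classical_set_scope.
Local Open Scope ring_scope.

(** The function [w = e^(lambda t) v] satisfies a diffusion equation with the ordinary Caputo derivative,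
    homogeneous boundary values and source [e^(lambda t) g]. Separation of variables proposes
    [w (x, t) = \sum_n U n t * eigfun n x], with [eigfun n] the normalised sines, which are up to sign the
    eigenfunctions ([eigen_index]), and [U n] the solution of a scalar fractional equation with the
    eigenvalue [eigval n]. The theorem holds because this series and enough of its differentiated series
    converge uniformly, and because a classical solution has to be equal to it.

    Convergence. The assumptions say that the coefficients [c n] of [varsigma] and [g (., t)] satisfy
    [|c n| eigval n ^ 2 <= C a n], and those of the time derivatives of [g] satisfy [|c n| <= C a n], up to
    a factor [t^(- rho)] for the second one, where [a n = eigval n ^ (- (1 + eps) / 2)] is summable because
    [eigval n] grows like [n^2]. A mode inherits these bounds, uniformly in [n]. First,
    [|U n| eigval n ^ 2 <= C a n]: a scalar maximum principle bounds a mode by its initial value and by its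
    source divided by the eigenvalue ([mode_bound]). Four derivatives in [x] cost a factor [eigval n ^ 2],
    so this is exactly what the bounds on the derivatives in [x] require. Secondly, [U n'] is a
    combination of the kernel [relax] and of its convolution with the derivative of the source, where
    [relax] solves the Volterra equation with right-hand side a multiple [k] of [t^(al - 1)] and kernel
    [eigval n] times [k] ([relax_volterra]). This kernel is positive, hence at most [k] whatever the
    eigenvalue, and [t relax'] obeys a similar bound ([relax_gt0], [drelax_le]). This gives
    [|U n'| <= C t^(al - 1) a n] and [|U n''| <= C t^(al - 2) a n]. That [rho < 1] enters through
    [t^(1 - rho)] being bounded: differentiating the convolution is done by scaling, so that it only
    involves [t b'] for the derivative [b] of the source ([conv_derive], [modes_exist]).

    Coefficients of the data. The function [g] is differentiable in time only point by point, while its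
    derivatives are controlled slice by slice, so that differentiating a coefficient of [g] under the
    integral sign needs a domination that holds for almost every [x] simultaneously at almost all times.
    A slice with summable coefficients is bounded almost everywhere. For [g_t] the exceptional sets are
    united over rational times ([ae_all_times]); [g_tt] need not be continuous in time, and Tonelli's
    theorem is used instead ([ae_swap]), the measurability coming from a representation of [|g_tt|] as
    an upper limit of second differences of the sine series of [g]. A derivative that exists everywhere
    and is bounded off a null set still gives a Lipschitz bound ([lipschitz_ae]), and this is the
    required domination ([coef_derive], [coef_derive2]).

    Uniqueness. The sine series of [g] represents [g] only for [x] off a null set [E], so the difference [W]
    of the two solutions satisfies the homogeneous equation only there. The maximum principle survives
    ([max_principle]): to [W] is added a small multiple of a function of [x] whose second derivative is
    infinite on [E], the primitive of a function that is infinitely steep there ([steep_function],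
    [barrier]). A maximum of the sum cannot lie over [E], and elsewhere the Caputo derivative is
    nonnegative at a maximum ([caputo_ge0_at_max]), while the right-hand side of the equation is negative where [W]
    is positive. *)

(** * Absolutely convergent series *)

Section sums.
Context {R : realType}.
Implicit Types (u v M : nat -> R).

Definition sumr u : R := limn (series u).
Definition summable u : Prop := cvgn (series u).

Lemma summable_le u M : (forall n, `|u n| <= M n) -> summable M -> summable u.
Proof.
move=> uM sM; apply: normed_cvg; apply: (series_le_cvg _ _ _ sM) => n /=.
- exact: normr_ge0.
- exact: le_trans (normr_ge0 _) (uM n).
- exact: uM.
Qed.

Lemma summable_norm u M : (forall n, `|u n| <= M n) -> summable M ->
  summable (fun n => `|u n|).
Proof. by move=> uM; apply: summable_le => n; rewrite normr_id. Qed.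

Lemma summableD u v : summable u -> summable v -> summable (fun n => u n + v n).
Proof.
by move=> su sv; rewrite /summable (seriesD u v : series (fun n => u n + v n) = _); exact: is_cvgD.
Qed.

Lemma summableZ c u : summable u -> summable (fun n => c * u n).
Proof. exact: is_cvg_seriesZ. Qed.

Lemma sumrD u v : summable u -> summable v ->
  sumr (fun n => u n + v n) = sumr u + sumr v.
Proof. by move=> su sv; exact: lim_seriesD. Qed.

Lemma sumrZ c u : summable u -> sumr (fun n => c * u n) = c * sumr u.
Proof. by move=> su; exact: lim_seriesZ. Qed.

Lemma sumr_opp u : summable u -> sumr (fun n => - u n) = - sumr u.
Proof. by move=> su; rewrite -mulN1r -sumrZ//; congr sumr; apply/funext=> n; rewrite mulN1r. Qed.

Lemma sumr_sub u v : summable u -> summable v ->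
  sumr (fun n => u n - v n) = sumr u - sumr v.
Proof.
move=> su sv; rewrite sumrD ?sumr_opp//.
rewrite (_ : (fun n => - v n) = (fun n => -1 * v n)); first exact: summableZ.
by apply/funext=> n; rewrite mulN1r.
Qed.

Lemma series_le_sumr M n : (forall k, 0 <= M k) -> summable M -> series M n <= sumr M.
Proof.
move=> M0 sM; apply: nondecreasing_cvgn_le => // i j ij; rewrite /series/=.
by rewrite (big_cat_nat _ ij)//= lerDl sumr_ge0.
Qed.

Lemma sumr_le u v : summable u -> summable v -> (forall n, u n <= v n) -> sumr u <= sumr v.
Proof. by move=> su sv uv; apply: ler_lim => //; apply: nearW => n; rewrite ler_sum. Qed.

Lemma sumr_norm_le u M : (forall n, `|u n| <= M n) -> summable M -> `|sumr u| <= sumr M.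
Proof.
move=> uM sM; have sn := summable_norm uM sM.
apply: le_trans (lim_series_norm sn) _.
exact: sumr_le.
Qed.

Lemma sumr_tail u M n : (forall n, `|u n| <= M n) -> summable M ->
  `|sumr u - series u n| <= sumr M - series M n.
Proof.
move=> uM sM; have su := summable_le uM sM.
have H w : summable w -> (fun m => series w m - series w n) @ \oo --> sumr w - series w n.
  by move=> sw; apply: cvgB; [exact: sw|exact: cvg_cst].
apply: (@ler_cvg_to _ \oo _ _ (fun m => `|series u m - series u n|)
  (fun m => series M m - series M n)).
- by apply: cvg_norm; exact: H.
- exact: H.
- near=> m; have nm : (n <= m)%N by near: m; exact: nbhs_infty_ge.
  have dE w : series w m - series w n = \sum_(n <= k < m) w k.
    by rewrite /series/= (big_cat_nat _ nm)//= addrAC subrr add0r.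
  rewrite !dE.
  by apply: le_trans (ler_norm_sum _ _ _) _; apply: ler_sum.
Unshelve. all: end_near. Qed.

(** Dominated convergence for series; the filter is arbitrary so that the lemma serves for continuity on a
    subset of the plane as well as for difference quotients. *)
Lemma tannery (T : Type) (F : set_system T) {FF : ProperFilter F}
    (a : nat -> T -> R) l M : summable M ->
  (\forall t \near F, forall n, `|a n t| <= M n) ->
  (forall n, a n t @[t --> F] --> l n) ->
  sumr (a ^~ t) @[t --> F] --> sumr l.
Proof.
move=> sM aM al.
have lM n : `|l n| <= M n.
  apply: (cvgr_to_le (F := F) (f := fun t => `|a n t|)).
  - by apply: cvg_norm; exact: al.
  - by near=> t; near: t; move: aM; apply: filterS => t; apply.
apply/cvgrPdist_le => e e0.
have e3 : 0 < e / 3 by rewrite divr_gt0.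
have [N _ HN] : \forall n \near \oo, `|sumr M - series M n| <= e / 3.
  by have /cvgrPdist_le := sM; apply.
have {}HN := HN N (leqnn N).
have sl : series (a ^~ t) N @[t --> F] --> series l N.
  rewrite /series/=; elim: N {HN} => [|N IH].
    by under eq_fun do rewrite big_geq//; rewrite big_geq//; exact: cvg_cst.
  under eq_fun do rewrite big_nat_recr//=; rewrite big_nat_recr//=.
  by apply: cvgD => //; exact: al.
move/cvgrPdist_le : sl => /(_ _ e3) sl.
near=> t.
have aMt n : `|a n t| <= M n by move: n; near: t.
have h1 := sumr_tail N aMt sM.
have h2 := sumr_tail N lM sM.
have h3 : `|series l N - series (a ^~ t) N| <= e / 3 by near: t.
have h4 := ler_norm (sumr M - series M N).
rewrite (_ : sumr l - _ = (sumr l - series l N) + (series l N - series (a^~ t) N)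
   - (sumr (a ^~ t) - series (a^~ t) N)); last by ring.
apply: le_trans (ler_normB _ _) _.
have := ler_normD (sumr l - series l N) (series l N - series (a^~ t) N).
lra.
Unshelve. all: end_near. Qed.

(** The difference quotients are dominated by the mean value theorem, so only the differentiated series has
    to be majorised. *)
Lemma sumr_is_derive (f df : nat -> R -> R) M (a b x : R) : a < x < b -> summable M ->
  (forall n (y : R), a < y < b -> is_derive y 1 (f n) (df n y)) ->
  (forall n (y : R), a < y < b -> `|df n y| <= M n) ->
  (forall y : R, a < y < b -> summable (f ^~ y)) ->
  is_derive x 1 (fun y => sumr (f ^~ y)) (sumr (df ^~ x)).
Proof.
move=> axb sM fdf dfM sf.
have [ax xb] := andP axb.
have nI : \forall h \near (0:R)^', a < h + x < b /\ h != 0.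
  pose d := Num.min (x - a) (b - x).
  have d0 : 0 < d by rewrite lt_min !subr_gt0 ax xb.
  exists d => //= h /=; rewrite sub0r normrN lt_min => /andP[h1 h2] h0; split => //.
  by move: h1 h2; rewrite !ltr_norml => /andP[? ?] /andP[? ?]; lra.
have key : h^-1 *: (sumr (f ^~ (h + x)) - sumr (f ^~ x)) @[h --> (0:R)^'] --> sumr (df ^~ x).
  have := @tannery _ (0:R)^' _ (fun n h => h^-1 * (f n (h + x) - f n x)) (df ^~ x) M sM.
  have H1 : \forall t \near (0:R)^', forall n, `|t^-1 * (f n (t + x) - f n x)| <= M n.
    near=> h => n; have [hI h0] : a < h + x < b /\ h != 0 by near: h.
    have inI y : x < y < h + x \/ h + x < y < x -> a < y < b.
      by case=> /andP[? ?]; have [? ?] := andP hI; apply/andP; split; lra.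
    have [hp|hn] := ltP 0 h.
      have [|||c /[!in_itv]/= cI ->] := @MVT R (f n) (df n) x (h + x).
      - by rewrite ltrDr.
      - by move=> y /[!in_itv]/= yI; apply: fdf; apply: inI; left.
      - apply: continuous_in_subspaceT => y /[!inE]/= /[!in_itv]/= /andP[y1 y2].
        apply: differentiable_continuous; apply/derivable1_diffP.
        by have [] := @fdf n y _ => //; apply/andP; split; have [? ?] := andP hI; lra.
      by rewrite addrK mulrCA mulVf// mulr1; apply: dfM; apply: inI; left.
    have {}hn : h < 0 by rewrite lt_neqAle h0.
    have [|||c /[!in_itv]/= cI] := @MVT R (f n) (df n) (h + x) x.
    - by rewrite gtrDr.
    - by move=> y /[!in_itv]/= yI; apply: fdf; apply: inI; right.
    - apply: continuous_in_subspaceT => y /[!inE]/= /[!in_itv]/= /andP[y1 y2].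
      apply: differentiable_continuous; apply/derivable1_diffP.
      by have [] := @fdf n y _ => //; apply/andP; split; have [? ?] := andP hI; lra.
    rewrite -opprB => /eqP; rewrite eqr_oppLR => /eqP ->.
    rewrite (_ : x - (h + x) = - h); last by ring.
    by rewrite -mulrN opprK mulrCA mulVf// mulr1; apply: dfM; apply: inI; right.
  have H2 n : h^-1 * (f n (h + x) - f n x) @[h --> (0:R)^'] --> df n x.
    have [fx <-] := @fdf n x axb.
    rewrite /derive; move: fx; rewrite /derivable.
    rewrite (_ : (fun h : R => h^-1 *: ((f n \o shift x) (h *: 1) - f n x))
       = (fun h => h^-1 * (f n (h + x) - f n x)))//.
    by apply/funext => h/=; rewrite /GRing.scale/= mulr1.
  move=> /(_ _ H1 H2); apply: cvg_trans; apply: near_eq_cvg.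
  near=> h; have [hI h0] : a < h + x < b /\ h != 0 by near: h.
  rewrite /GRing.scale/= -sumr_sub; [|exact: sf|exact: sf].
  rewrite sumrZ//.
  have -> : (fun n => f n (h + x) - f n x) = (fun n => f n (h + x) + (-1) * f n x).
    by apply/funext=> n; rewrite mulN1r.
  by apply: summableD; [exact: sf|apply: summableZ; exact: sf].
have e1 : (fun h : R => h^-1 *: (((fun y => sumr (f ^~ y)) \o shift x) (h *: 1) - sumr (f ^~ x)))
   = (fun h => h^-1 *: (sumr (f ^~ (h + x)) - sumr (f ^~ x))).
  by apply/funext => h/=; rewrite /GRing.scale/= mulr1.
apply: DeriveDef; first by rewrite /derivable e1; apply/cvg_ex; eexists; exact: key.
by rewrite /derive e1; apply/cvg_lim.
Unshelve. all: end_near. Qed.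

(** The majorant is a product [M n * h s] so that [h] may be singular. *)
Lemma sumr_integral (D : set R) (f : nat -> R -> R) (h : R -> R) M :
  measurable D -> (forall n, measurable_fun D (f n)) ->
  (forall n s, D s -> `|f n s| <= M n * h s) -> summable M ->
  lebesgue_measure.-integrable D (EFin \o h) ->
  lebesgue_measure.-integrable D (EFin \o (fun s => sumr (f ^~ s))) /\
  \int[lebesgue_measure]_(s in D) sumr (f ^~ s) =
  sumr (fun n => \int[lebesgue_measure]_(s in D) f n s).
Proof.
move=> mD mf fM sM ih.
have sMh s : D s -> summable (fun n => M n * h s).
  move=> Ds; rewrite (_ : (fun n => _) = (fun n => h s * M n)); last first.
    by apply/funext => n; rewrite mulrC.
  exact: summableZ.
have M0 n s : D s -> 0 <= M n * h s by move=> Ds; apply: le_trans (fM n s Ds).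
have sf s : D s -> summable (f ^~ s).
  by move=> Ds; apply: summable_le (sMh s Ds) => n; exact: fM.
have mser n : measurable_fun D (fun s => series (f ^~ s) n).
  by rewrite /series/=; apply: measurable_sum => k; exact: mf.
have ps s n : D s -> `|series (f ^~ s) n| <= sumr M * h s.
  move=> Ds; apply: (@le_trans _ _ (series (fun n => M n * h s) n)).
    rewrite /series/=; apply: le_trans (ler_norm_sum _ _ _) _.
    by apply: ler_sum => i _; exact: fM.
  have -> : sumr M * h s = sumr (fun n => M n * h s).
    by rewrite mulrC -sumrZ//; congr sumr; apply/funext => k; rewrite mulrC.
  by apply: series_le_sumr; [move=> k; exact: M0|exact: sMh].
have fint n : lebesgue_measure.-integrable D (EFin \o f n).
  apply: (@le_integrable _ _ _ lebesgue_measure D mD _ (EFin \o (fun s => M n * h s))).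
  - by apply/measurable_EFinP; exact: mf.
  - move=> s Ds /=; rewrite lee_fin (ger0_norm (M0 n s Ds)); exact: fM.
  - by rewrite (_ : EFin \o _ = (fun s => (M n)%:E * (EFin \o h) s)%E)//; apply: integrableZl.
have [|||||i1 _ i2] := @dominated_convergence _ _ _ lebesgue_measure D mD
   (fun n s => (series (f ^~ s) n)%:E) (EFin \o (fun s => sumr (f ^~ s)))
   (fun s => (sumr M * h s)%:E).
- by move=> n; apply/measurable_EFinP; exact: mser.
- apply/measurable_EFinP; apply: (@measurable_fun_cvg _ _ _ D (fun n s => series (f^~ s) n)) => //.
- by apply: aeW => s Ds; apply: cvg_EFin; [exact: nearW|exact: sf].
- by rewrite (_ : (fun s => _) = (fun s => (sumr M)%:E * (EFin \o h) s)%E)//; apply: integrableZl.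
- by apply: aeW => s n Ds; rewrite lee_fin; exact: ps.
have serint n : lebesgue_measure.-integrable D (EFin \o (fun s => series (f ^~ s) n)).
  rewrite (_ : EFin \o _ = (fun x => \sum_(0 <= k < n) (f k x)%:E)%E); last first.
    by apply/funext => x; rewrite /series/= sumEFin.
  by apply: integrable_sum => // k _; exact: fint.
have serR n : \int[lebesgue_measure]_(s in D) series (f ^~ s) n =
    series (fun k => \int[lebesgue_measure]_(s in D) f k s) n.
  elim: n => [|n IH].
    rewrite {2}/series/= big_geq//; under eq_Rintegral do rewrite /series/= big_geq//.
    by rewrite Rintegral_cst// mul0r.
  rewrite seriesSr -IH -(@RintegralD _ _ _ lebesgue_measure D _ _ mD (serint n) (fint n)).
  by apply: eq_Rintegral => s _; rewrite seriesSr.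
split=> //.
rewrite /sumr -(funext serR : _ = series _).
symmetry; apply/cvg_lim => //; rewrite /Rintegral; apply: fine_cvg; rewrite fineK//.
by apply: integrable_fin_num.
Qed.

End sums.

(** * Real-valued Lebesgue integrals *)

Notation leb := (@lebesgue_measure _).
Notation intg D f := (lebesgue_measure.-integrable D (EFin \o f)).
Notation RI D f := (Rintegral lebesgue_measure D f).

Section integrals.
Context {R : realType}.
Implicit Types (D : set R) (f g h : R -> R).

Lemma intg_le D f h : measurable D -> measurable_fun D f ->
  (forall s, D s -> `|f s| <= h s) -> intg D h -> intg D f.
Proof.
move=> mD mf fh ih; apply: (@le_integrable _ _ _ lebesgue_measure D mD _ (EFin \o h)) => //.
  exact/measurable_EFinP.
by move=> s Ds /=; rewrite lee_fin (le_trans (fh _ Ds))// ler_norm.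
Qed.

Lemma intg_meas D f : measurable D -> intg D f -> measurable_fun D f.
Proof. by move=> mD /(measurable_int leb) /measurable_EFinP. Qed.

Lemma intgD D f g : measurable D -> intg D f -> intg D g -> intg D (fun x => f x + g x).
Proof. by move=> mD i1 i2; exact: (@integrableD _ _ _ lebesgue_measure D mD _ _ i1 i2). Qed.

Lemma intgZ D f c : measurable D -> intg D f -> intg D (fun x => c * f x).
Proof.
move=> mD i1; rewrite (_ : EFin \o _ = (fun s => c%:E * (EFin \o f) s)%E)//.
exact: integrableZl.
Qed.

Lemma intgN D f : measurable D -> intg D f -> intg D (fun x => - f x).
Proof.
move=> mD i1; rewrite (_ : (fun x => - f x) = (fun x => -1 * f x)); first exact: intgZ.
by apply/funext => x; rewrite mulN1r.
Qed.

Lemma intgB D f g : measurable D -> intg D f -> intg D g -> intg D (fun x => f x - g x).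
Proof. by move=> mD i1 i2; apply: intgD => //; exact: intgN. Qed.

Lemma intgS D E f : measurable D -> measurable E -> E `<=` D -> intg D f -> intg E f.
Proof. by move=> mD mE ED; apply: integrableS. Qed.

Lemma intg_norm D f : measurable D -> intg D f -> intg D (fun x => `|f x|).
Proof.
move=> mD i1.
apply: (@le_integrable _ _ _ lebesgue_measure D mD _ (EFin \o f)) => //.
  by apply/measurable_EFinP; apply: measurableT_comp => //; exact: intg_meas.
by move=> s Ds /=; rewrite lee_fin normr_id.
Qed.

Lemma intg_restrict D f : measurable D -> intg D f <-> intg setT (f \_ D).
Proof.
move=> mD; rewrite (integrable_mkcond (mu := lebesgue_measure) _ mD).
by rewrite (_ : (EFin \o f) \_ D = EFin \o (f \_ D)) // -restrict_EFin.
Qed.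

Lemma intg_cst D c : measurable D -> (leb D < +oo)%E -> intg D (fun=> c).
Proof.
move=> mD Dy; apply/integrableP; split; first exact/measurable_EFinP.
by rewrite /= integral_cst// lte_mul_pinfty.
Qed.

Lemma RI_D D f g : measurable D -> intg D f -> intg D g ->
  RI D (fun x => f x + g x) = RI D f + RI D g.
Proof. by move=> mD i1 i2; exact: (@RintegralD _ _ _ lebesgue_measure D _ _ mD i1 i2). Qed.

Lemma RI_B D f g : measurable D -> intg D f -> intg D g ->
  RI D (fun x => f x - g x) = RI D f - RI D g.
Proof. by move=> mD i1 i2; exact: (@RintegralB _ _ _ lebesgue_measure D _ _ mD i1 i2). Qed.

Lemma RI_Z D f c : measurable D -> intg D f -> RI D (fun x => c * f x) = c * RI D f.
Proof. by move=> mD i1; exact: (@RintegralZl _ _ _ lebesgue_measure D _ _ mD i1). Qed.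

Lemma RI_le D f g : measurable D -> intg D f -> intg D g -> (forall x, D x -> f x <= g x) ->
  RI D f <= RI D g.
Proof. by move=> mD i1 i2; exact: (@le_Rintegral _ _ _ lebesgue_measure D _ _ mD i1 i2). Qed.

Lemma RI_norm_le D f h : measurable D -> measurable_fun D f -> intg D h ->
  (forall x, D x -> `|f x| <= h x) -> `|RI D f| <= RI D h.
Proof.
move=> mD mf ih fh; have i1 := intg_le mD mf fh ih.
apply: le_trans (@le_normr_Rintegral _ _ _ lebesgue_measure D _ mD i1) _.
by apply: RI_le => //; exact: intg_norm.
Qed.

Lemma RI_ext D f g : (forall x, D x -> f x = g x) -> RI D f = RI D g.
Proof. by move=> fg; apply: eq_Rintegral => x /set_mem; exact: fg. Qed.

Lemma intg_ext D f g : measurable D -> (forall x, D x -> f x = g x) -> intg D f -> intg D g.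
Proof. by move=> mD fg; apply: eq_integrable => // x /set_mem Dx /=; rewrite fg. Qed.

Lemma RI_restrict D f : RI D f = RI setT (f \_ D).
Proof. exact: Rintegral_mkcond. Qed.

Let phi (a b : R) : measurableTypeR R -> measurableTypeR R := fun x => a * x + b.

Let mphi a b : measurable_fun setT (phi a b).
Proof. by apply: measurable_funD => //; apply: measurable_funM. Qed.

(** By uniqueness of Lebesgue measure: the pushforward agrees with it on half-open intervals. *)
Lemma lebesgue_affine (a b : R) (A : set R) : a != 0 -> measurable A ->
  leb A = (`|a|%:E * leb ((fun x => (a * x + b)%R) @^-1` A))%E.
Proof.
move=> a0 mA.
have an0 : 0 <= `|a| by [].
have H : leb A = mscale (NngNum an0) (@pushforward _ _ _ _ _ leb (phi a b)) A.
  move=> m; apply: (lebesgue_measure_unique (mu := mscale (NngNum an0) (@pushforward _ _ _ _ _ leb (phi a b)))) => //= _ [[c d]] _ <-.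
  rewrite /mscale /= lebesgue_measure_itv/= /pushforward.
  have [ap|an] := ltP 0 a.
    rewrite (_ : phi a b @^-1` _ = `](c - b) / a, (d - b) / a]%classic); last first.
      apply/seteqP; split => x /=; rewrite !in_itv/= /phi ltr_pdivrMr// ler_pdivlMr// => /andP[? ?]; apply/andP; split; lra.
    rewrite lebesgue_measure_itv/= !lte_fin ltr_pM2r ?invr_gt0// ltrD2r.
    case: ifPn => cd; rewrite ?mule0//.
    rewrite -EFinB -EFinM gtr0_norm//; by congr EFin; field.
  have {}an : a < 0 by rewrite lt_neqAle a0.
  rewrite (_ : phi a b @^-1` _ = `[(d - b) / a, (c - b) / a[%classic); last first.
    apply/seteqP; split => x /=; rewrite !in_itv/= /phi ltr_ndivlMr// ler_ndivrMr// => /andP[? ?]; apply/andP; split; lra.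
  rewrite lebesgue_measure_itv/= !lte_fin ltr_nM2r ?invr_lt0// ltrD2r.
  case: ifPn => cd; rewrite ?mule0//.
  rewrite -EFinB -EFinM ltr0_norm//; by congr EFin; field.
exact: (H (mphi a b)).
Qed.

Lemma ge0_integral_affine (a b : R) (f : R -> \bar R) : a != 0 -> measurable_fun setT f ->
  (forall x, 0 <= f x)%E ->
  (\int[leb]_x f x = `|a|%:E * \int[leb]_x f (a * x + b)%R)%E.
Proof.
move=> a0 mf f0.
have an0 : 0 <= `|a|^-1 by rewrite invr_ge0.
have -> : (\int[leb]_x f (a * x + b)%R = \int[pushforward leb (phi a b)]_x f x)%E.
  by rewrite ge0_integral_pushforward.
rewrite [X in (_ * X)%E](eq_measure_integral (mscale (NngNum an0) leb)).
  rewrite ge0_integral_mscale// muleA -EFinM mulfV ?mul1e//.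
  by rewrite normr_eq0.
move=> /= A mA _; rewrite /mscale/= (lebesgue_affine b a0 mA) muleA -EFinM mulVf ?mul1e//.
by rewrite normr_eq0.
Qed.

Lemma intg_affine (a b : R) f : a != 0 ->
  intg setT f -> intg setT (fun x => f (a * x + b)).
Proof.
move=> a0 i1.
have mf : measurable_fun setT f by exact: intg_meas.
apply/integrableP; split.
  by apply/measurable_EFinP; exact: (measurableT_comp mf (mphi a b)).
have := @ge0_integral_affine a b (fun x => `|f x|%:E) a0.
have /integrableP[_ fy] := i1.
rewrite /= => H; have {}H := H _ _; move: fy; rewrite /= H//.
  case: (\int[_]__ _)%E => [r| |]//=.
    by move=> _; rewrite ltry.
  by rewrite gt0_muley ?lte_fin ?normr_gt0.
by apply/measurable_EFinP; apply: measurableT_comp.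
Qed.

Lemma RI_affine (a b : R) f : a != 0 -> intg setT f ->
  RI setT f = `|a| * RI setT (fun x => f (a * x + b)).
Proof.
move=> a0 i1; have i2 := intg_affine b a0 i1.
have mf : measurable_fun setT f by exact: intg_meas.
have mE : measurable_fun setT (EFin \o f) by exact/measurable_EFinP.
have HP := ge0_integral_affine b a0 (measurable_funepos mE) (fun x => funepos_ge0 (EFin \o f) x).
have HN := ge0_integral_affine b a0 (measurable_funeneg mE) (fun x => funeneg_ge0 (EFin \o f) x).
have fP := integrable_pos_fin_num measurableT i2.
have fN := integrable_neg_fin_num measurableT i2.
have E : (\int[leb]_x (f x)%:E = `|a|%:E * \int[leb]_x (f (a * x + b))%:E)%E.
  rewrite integralE [in RHS]integralE muleBr//; last exact: fin_num_adde_defr fP.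
  congr (_ - _)%E; [apply: (etrans HP)|apply: (etrans HN)];
    by congr (_ * _)%E; apply: eq_integral => x _; rewrite ?funeposE ?funenegE.
rewrite /Rintegral E fineM//.
by apply: integrable_fin_num.
Qed.

End integrals.

(** * Derivatives and the fundamental theorem of calculus *)

Section calculus.
Context {R : realType}.
Implicit Types (f g F df : R -> R) (a b c x y t : R).

Lemma dv_eq f x a b : is_derive x 1 f a -> a = b -> is_derive x 1 f b.
Proof. by move=> h <-. Qed.

Lemma dv_cst c x : is_derive x 1 (fun=> c : R) 0.
Proof. exact: is_derive_cst. Qed.

Lemma dv_id x : is_derive x 1 (fun y : R => y) 1.
Proof. exact: is_derive_id. Qed.

Lemma dvD f g x a b : is_derive x 1 f a -> is_derive x 1 g b ->
  is_derive x 1 (fun y => f y + g y) (a + b).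
Proof. by move=> fa gb; exact: (is_deriveD fa gb). Qed.

Lemma dvN f x a : is_derive x 1 f a -> is_derive x 1 (fun y => - f y) (- a).
Proof. by move=> fa; exact: (is_deriveN fa). Qed.

Lemma dvB f g x a b : is_derive x 1 f a -> is_derive x 1 g b ->
  is_derive x 1 (fun y => f y - g y) (a - b).
Proof. by move=> fa gb; exact: (is_deriveB fa gb). Qed.

Lemma dvM f g x a b : is_derive x 1 f a -> is_derive x 1 g b ->
  is_derive x 1 (fun y => f y * g y) (a * g x + f x * b).
Proof.
move=> fa gb; apply: dv_eq (is_deriveM fa gb) _.
by rewrite /GRing.scale/= mulrC addrC [g x * a]mulrC mulrC [b * _]mulrC.
Qed.

Lemma dvZ c f x a : is_derive x 1 f a -> is_derive x 1 (fun y => c * f y) (c * a).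
Proof. by move=> fa; exact: (is_deriveZ c fa). Qed.

Lemma dv_comp f g x a b : is_derive (g x) 1 f a -> is_derive x 1 g b ->
  is_derive x 1 (fun y => f (g y)) (a * b).
Proof.
move=> fa gb; apply: dv_eq (@is_derive1_comp R f g x a b fa gb) _.
by rewrite /GRing.scale/= mulrC.
Qed.

Lemma dv_cont f x a : is_derive x 1 f a -> {for x, continuous f}.
Proof.
by move=> [d _]; apply: differentiable_continuous; apply/derivable1_diffP.
Qed.

Lemma dv_near f g x a : (\forall y \near x, f y = g y) -> is_derive x 1 f a ->
  is_derive x 1 g a.
Proof.
exact: near_eq_is_derive.
Qed.

Lemma dv_ext f g x a : (forall y, f y = g y) -> is_derive x 1 f a -> is_derive x 1 g a.
Proof. by move=> /funext ->. Qed.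

Lemma dv1 f x a : is_derive x 1 f a -> derive1 f x = a.
Proof. by move=> [_ <-]; rewrite derive1E. Qed.

Lemma dv_derivable f x : derivable f x 1 -> is_derive x 1 f (derive1 f x).
Proof. by move=> df; apply: DeriveDef => //; rewrite derive1E. Qed.

Lemma dv_cvg f x a : is_derive x 1 f a -> (f (x + h) - f x) / h @[h --> (0:R)^'] --> a.
Proof.
move=> [fx <-]; move: fx; rewrite /derivable /derive.
suff -> : (fun h : R => h^-1 *: ((f \o shift x) (h *: 1) - f x)) = (fun h => (f (x + h) - f x) / h) by [].
by apply/funext => h /=; rewrite /GRing.scale/= mulr1 mulrC [h + x]addrC.
Qed.

Lemma cvg_dv f x a : (f (x + h) - f x) / h @[h --> (0:R)^'] --> a -> is_derive x 1 f a.
Proof.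
move=> H.
have e : (fun h : R => h^-1 *: ((f \o shift x) (h *: 1) - f x)) = (fun h => (f (x + h) - f x) / h).
  by apply/funext => h /=; rewrite /GRing.scale/= mulr1 mulrC [h + x]addrC.
apply: DeriveDef; first by rewrite /derivable e; apply/cvg_ex; exists a.
by rewrite /derive e; apply/cvg_lim.
Qed.

Lemma mean_value f df a b : a < b -> (forall x, a <= x <= b -> is_derive x 1 f (df x)) ->
  exists2 c, a < c < b & f b - f a = df c * (b - a).
Proof.
move=> ab fd.
have [||] := @MVT R f df a b ab.
- by move=> x; rewrite in_itv/= => /andP[h1 h2]; apply: fd; rewrite !ltW.
- apply: continuous_in_subspaceT => y; rewrite inE/= in_itv/= => yab.
  exact: dv_cont (fd _ yab).
by move=> c; rewrite in_itv/= => cab E; exists c.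
Qed.

Lemma near_gt a x : a < x -> \forall y \near x, a < y.
Proof. by move=> ax; apply: open_nbhs_nbhs; split => //; exact: open_gt. Qed.

Lemma near_lt x b : x < b -> \forall y \near x, y < b.
Proof. by move=> xb; apply: open_nbhs_nbhs; split => //; exact: open_lt. Qed.

Lemma continuous_FTC2R f F a b : a < b -> (forall x, a <= x <= b -> {for x, continuous f}) ->
  (forall x, a <= x <= b -> is_derive x 1 F (f x)) ->
  intg `[a, b] f /\ RI `[a, b] f = F b - F a.
Proof.
move=> ab cf dF.
have cw : {within `[a, b], continuous f}.
  by apply: continuous_in_subspaceT => y; rewrite inE/= in_itv/= => /cf.
split; first by apply: continuous_compact_integrable => //; exact: segment_compact.
rewrite /Rintegral (@continuous_FTC2 R f F a b ab cw)//.
- split.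
  + by move=> x; rewrite in_itv/= => /andP[h1 h2]; have [] := dF x; rewrite ?(ltW h1) ?(ltW h2).
  + by apply: cvg_at_right_filter; apply: (dv_cont (dF a _)); rewrite lexx ltW.
  + by apply: cvg_at_left_filter; apply: (dv_cont (dF b _)); rewrite lexx ltW.
- by move=> x; rewrite in_itv/= => /andP[h1 h2]; apply: (dv1 (dF x _)); rewrite !ltW.
Qed.

Lemma meas_oo f a b : (forall x, a < x < b -> {for x, continuous f}) -> measurable_fun `]a, b[ f.
Proof.
move=> cf; apply: open_continuous_measurable_fun; first exact: interval_open.
by move=> x /set_mem /=; rewrite in_itv/= => /cf.
Qed.

(** Monotone limit of the regular case: [F] need only have a limit at the left end, where [f] may be singular. *)
Lemma improper_FTC2 f F a b (l : R) : a < b -> (forall x, a < x <= b -> {for x, continuous f}) ->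
  (forall x, a < x <= b -> 0 <= f x) ->
  (forall x, a < x <= b -> is_derive x 1 F (f x)) -> F x @[x --> a^'+] --> l ->
  intg `]a, b[ f /\ RI `]a, b[ f = F b - l.
Proof.
move=> ab cf f0 dF Fl.
have d n : a < a + (b - a) / n.+2%:R < b.
  have ba : 0 < b - a by rewrite subr_gt0.
  have n1 : (1 : R) < n.+2%:R by rewrite ltr1n.
  rewrite ltrDl divr_gt0//= -ltrBrDl ltr_pdivrMr; last by lra.
  by rewrite ltr_pMr.
pose D n : set R := [set` `[a + (b - a) / n.+2%:R, b]].
have I n : intg (D n) f /\ RI (D n) f = F b - F (a + (b - a) / n.+2%:R).
  have /andP[d1 d2] := d n.
  by apply: continuous_FTC2R => // x /andP[h1 h2]; [apply: cf|apply: dF]; rewrite h2 (lt_le_trans d1).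
have DU : \bigcup_n D n = `]a, b]%classic.
  apply/seteqP; split => x /=.
    by case=> n _; rewrite /D/= !in_itv/= => /andP[h ->]; have /andP[h1 _] := d n; rewrite (lt_le_trans h1).
  rewrite in_itv/= => /andP[ax xb].
  have xa : 0 < x - a by rewrite subr_gt0.
  exists (truncn ((b - a) / (x - a))) => //; rewrite /D/= in_itv/= xb andbT.
  rewrite -lerBrDl ler_pdivrMr//.
  have := truncnS_gt ((b - a) / (x - a)); rewrite ltr_pdivrMr// => /ltW h.
  rewrite mulrC; apply: le_trans h _; rewrite ler_pM2r// ler_nat//.
have ndD : nondecreasing_seq D.
  move=> n m nm; rewrite subsetEset => x; rewrite /D/= !in_itv/= => /andP[h ->]; rewrite andbT.
  apply: le_trans h; rewrite lerD2l ler_pM2l ?subr_gt0// lef_pV2 ?posrE//.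
  by rewrite ler_nat !ltnS.
have mf : measurable_fun `]a, b] f.
  rewrite -DU; apply/measurable_fun_bigcup => [n|n]; first exact: measurable_itv.
  by apply: intg_meas; [exact: measurable_itv|exact: (I n).1].
have Il : (\int[leb]_(x in D n) (f x)%:E @[n --> \oo] --> (F b - l)%:E)%E.
  have -> : (fun n => (\int[leb]_(x in D n) (f x)%:E)%E) = (fun n => (F b - F (a + (b - a) / n.+2%:R))%:E).
    apply/funext => n; rewrite -(I n).2 /Rintegral fineK//; apply: integrable_fin_num; [exact: measurable_itv|exact: (I n).1].
  apply: cvg_EFin; first exact: nearW.
  apply: cvgB; first exact: cvg_cst.
  have /cvg_at_rightP := Fl; apply; split => [n|]; first by have /andP[] := d n.
  rewrite -[X in _ --> X]addr0; apply: cvgD; first exact: cvg_cst.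
  rewrite -[X in _ --> X](mulr0 (b - a)); apply: cvgM; first exact: cvg_cst.
  by have := @cvg_harmonic R; rewrite -(cvg_shiftS (harmonic : nat -> R)); apply: cvg_trans.
have Il2 : (\int[leb]_(x in `]a, b]) (f x)%:E = (F b - l)%:E)%E.
  rewrite -DU; apply: (cvg_unique _ _ Il) => //.
  apply: ge0_nondecreasing_set_cvg_integral => //.
  - by move=> n; exact: measurable_itv.
  - by move=> n; apply/measurable_EFinP; apply: intg_meas; [exact: measurable_itv|exact: (I n).1].
  - move=> n x Dx; rewrite lee_fin f0//; have : (\bigcup_n D n) x by exists n.
    by rewrite DU /= in_itv.
have i1 : intg `]a, b] f.
  apply/integrableP; split; first exact/measurable_EFinP.
  rewrite (_ : (\int[_]_(x in _) _)%E = (F b - l)%:E) ?ltry// -Il2.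
  by apply: eq_integral => x /set_mem /=; rewrite in_itv/= => xab; rewrite ger0_norm// f0.
have i2 : intg `]a, b[ f by apply: (intgS _ _ _ i1) => // x /=; rewrite !in_itv/= => /andP[-> /ltW].
split=> //.
by rewrite Rintegral_itv_bndo_bndc// /Rintegral Il2.
Qed.

End calculus.

(** * Convolution of causal functions *)

Section powers.
Context {R : realType}.
Implicit Types (p q s t : R).

Lemma dv_powR p t : 0 < t -> is_derive t 1 (fun s => s `^ p) (p * t `^ (p - 1)).
Proof. exact: is_derive1_powR. Qed.

Lemma cont_powR p t : 0 < t -> {for t, continuous (fun s => s `^ p)}.
Proof. by move=> t0; exact: dv_cont (dv_powR p t0). Qed.

Lemma powR_bound p a b s : 0 < a -> a <= s -> s <= b -> s `^ p <= a `^ p + b `^ p.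
Proof.
move=> a0 as_ sb; have s0 := lt_le_trans a0 as_.
have [p0|p0] := leP 0 p.
  have h : s `^ p <= b `^ p by apply: ge0_ler_powR => //; rewrite nnegrE ltW// (lt_le_trans s0).
  by apply: le_trans h _; rewrite lerDr powR_ge0.
suff : s `^ p <= a `^ p by move=> h; apply: le_trans h _; rewrite lerDl powR_ge0.
rewrite -[p]opprK !(powRN _ (- p)) lef_pV2 ?posrE ?powR_gt0//.
by apply: ge0_ler_powR => //; rewrite ?oppr_ge0 ?nnegrE ltW.
Qed.

Lemma intg_powR p t : 0 < p -> 0 < t ->
  intg `]0, t[ (fun s => s `^ (p - 1)) /\ RI `]0, t[ (fun s => s `^ (p - 1)) = t `^ p / p.
Proof.
move=> p0 t0.
have [||||i1 i2] := @improper_FTC2 R (fun s => s `^ (p - 1)) (fun s => p^-1 * s `^ p) 0 t 0 t0.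
- by move=> x /andP[x0 _]; exact: cont_powR.
- by move=> x _; exact: powR_ge0.
- move=> x /andP[x0 _]; apply: dv_eq (dvZ p^-1 (dv_powR p x0)) _.
  by rewrite mulrA mulVf ?mul1r// gt_eqF.
- rewrite -[X in _ --> X](mulr0 p^-1); apply: cvgM; first exact: cvg_cst.
  exact: powR_cvg0.
by split=> //; rewrite i2 subr0 mulrC.
Qed.

(** Extended by zero to [t <= 0], so that convolutions of causal functions are integrals over the whole
    line, and translations and reflections need no change of domain. *)
Definition kp p t : R := if 0 < t then t `^ (p - 1) else 0.

Lemma kp_ge0 p t : 0 <= kp p t.
Proof. by rewrite /kp; case: ifP => // _; exact: powR_ge0. Qed.

Lemma kpE p t : 0 < t -> kp p t = t `^ (p - 1).
Proof. by rewrite /kp => ->. Qed.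

Lemma kp_gt0 p t : 0 < t -> 0 < kp p t.
Proof. by move=> t0; rewrite kpE// powR_gt0. Qed.

Lemma kp_neg p t : t <= 0 -> kp p t = 0.
Proof. by move=> t0; rewrite /kp ltNge t0. Qed.

Lemma kpM p s t : 0 < s -> kp p (s * t) = s `^ (p - 1) * kp p t.
Proof.
move=> s0; rewrite /kp pmulr_rgt0//; case: ifPn => t0; last by rewrite mulr0.
by rewrite powRM// ltW.
Qed.

End powers.

Section convolution.
Context {R : realType}.
Implicit Types (a b c : R -> R) (p q s t : R).

(** Causal functions with a singularity at [0] no worse than [t^(p-1)]. *)
Definition causal p a : Prop :=
  [/\ forall t, t <= 0 -> a t = 0, measurable_fun setT a &
      forall S, 0 < S -> exists2 A : R, 0 <= A & forall t, t <= S -> `|a t| <= A * kp p t].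

Definition cont_pos a : Prop := forall t, 0 < t -> {for t, continuous a}.

Definition conv a b t : R := RI setT (fun s => a (t - s) * b s).

Lemma meas_causal a : (forall t, t <= 0 -> a t = 0) -> cont_pos a -> measurable_fun setT a.
Proof.
move=> a0 ca.
have -> : a = a \_ `]0, +oo[.
  apply/funext => t; rewrite patchE; case: ifPn => // /negP tn; apply: a0.
  by rewrite leNgt; apply/negP => t0; apply: tn; rewrite inE/= in_itv/= t0.
apply/(measurable_restrictT _ _).1; first exact: measurable_itv.
apply: open_continuous_measurable_fun; first exact: interval_open.
by move=> x /set_mem /=; rewrite in_itv/= andbT => /ca.
Qed.

Lemma cont_near a b t : (\forall s \near t, a s = b s) -> {for t, continuous a} ->
  {for t, continuous b}.
Proof.
move=> ab ca; have ca' : a y @[y --> t] --> a t := ca.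
suff : b y @[y --> t] --> b t by [].
by rewrite -(nbhs_singleton ab); apply: cvg_trans ca'; exact: near_eq_cvg.
Qed.

Lemma kp_cont p : cont_pos (kp p).
Proof.
move=> t t0; apply: (@cont_near (fun s => s `^ (p - 1))); last exact: cont_powR.
by near=> s; rewrite kpE//; near: s; exact: near_gt.
Unshelve. all: end_near. Qed.

Lemma causal_kp p : causal p (kp p).
Proof.
split; first exact: kp_neg.
  by apply: meas_causal; [exact: kp_neg|exact: kp_cont].
by move=> S S0; exists 1 => // t _; rewrite mul1r ger0_norm// kp_ge0.
Qed.

Lemma intg_kpt p t : 0 < p -> intg setT (fun s => kp p s * \1_(`]0, t[) s).
Proof.
move=> p0; have [t0|t0] := ltP 0 t; last first.
  rewrite (_ : (fun s => _) = cst 0); last first.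
    apply/funext => s; rewrite indicE memNset ?mulr0//= in_itv/= => /andP[h1 h2].
    by have := lt_le_trans (lt_trans h1 h2) t0; rewrite ltxx.
  by apply: (intg_ext (f := cst 0)) => //; exact: integrable0.
have [i1 _] := intg_powR p0 t0.
have := (intg_restrict _ (measurable_itv _)).1 i1.
apply: intg_ext => // x _; rewrite patchE indicE; case: ifPn => h; last by rewrite mulr0.
by move: h; rewrite inE/= in_itv/= => /andP[h _]; rewrite mulr1 kpE.
Qed.

Lemma intg_kpt_refl p t : 0 < p -> intg setT (fun s => kp p (t - s) * \1_(`]0, t[) s).
Proof.
move=> p0; have := @intg_affine R (-1) t _ _ (intg_kpt t p0).
rewrite oppr_eq0 oner_eq0 => /(_ isT); apply: intg_ext => // x _.
rewrite mulN1r [- x + t]addrC; congr (_ * _); rewrite !indicE; congr (nat_of_bool _)%:R.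
by apply/idP/idP; rewrite !inE/= !in_itv/= => /andP[? ?]; apply/andP; split; lra.
Qed.

(** At distance at least [t / 2] from its singularity each factor is bounded, which separates the two
    singularities. *)
Lemma conv_kp_le p q t s : 0 < t ->
  kp p (t - s) * kp q s <=
    ((t / 2) `^ (q - 1) + t `^ (q - 1)) * (kp p (t - s) * \1_(`]0, t[) s)
  + ((t / 2) `^ (p - 1) + t `^ (p - 1)) * (kp q s * \1_(`]0, t[) s).
Proof.
move=> t0; have Q0 : 0 <= (t / 2) `^ (q - 1) + t `^ (q - 1) by rewrite addr_ge0// powR_ge0.
have P0 : 0 <= (t / 2) `^ (p - 1) + t `^ (p - 1) by rewrite addr_ge0// powR_ge0.
have [s0|s0] := leP s 0.
  by rewrite (kp_neg _ s0) !mulr0 mul0r addr_ge0 ?mulr_ge0// ?kp_ge0.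
have [st|st] := leP t s.
  by rewrite (@kp_neg _ p (t - s)) ?subr_le0// !mul0r addr_ge0 ?mulr_ge0// ?kp_ge0.
have -> : \1_(`]0, t[) s = 1 :> R by rewrite indicE mem_set//= in_itv/= s0 st.
rewrite !mulr1; have [h|h] := leP s (t / 2).
  apply: (@le_trans _ _ (((t / 2) `^ (p - 1) + t `^ (p - 1)) * kp q s)).
    apply: ler_wpM2r; first exact: kp_ge0.
    rewrite kpE ?subr_gt0//; apply: powR_bound; lra.
  by rewrite lerDr mulr_ge0// kp_ge0.
apply: (@le_trans _ _ (((t / 2) `^ (q - 1) + t `^ (q - 1)) * kp p (t - s))).
  rewrite mulrC; apply: ler_wpM2r; first exact: kp_ge0.
  rewrite kpE//; apply: powR_bound; lra.
by rewrite lerDl mulr_ge0// kp_ge0.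
Qed.

Lemma meas_refl a t : measurable_fun setT a -> measurable_fun setT (fun s => a (t - s)).
Proof. by move=> ma; apply: measurableT_comp => //; exact: measurable_funB. Qed.

Lemma intg_conv_kp p q t : 0 < p -> 0 < q -> intg setT (fun s => kp p (t - s) * kp q s).
Proof.
move=> p0 q0; have mk r := (let: And3 _ m _ := @causal_kp r in m).
have [t0|t0] := ltP 0 t; last first.
  apply: (intg_ext (f := cst 0)) => //; last exact: integrable0.
  move=> s _; have [s0|s0] := leP s 0; first by rewrite (kp_neg _ s0) mulr0.
  by rewrite (@kp_neg _ p (t - s)) ?mul0r//; lra.
apply: (intg_le _ _ (fun s _ => _)); last first.
- exact: (intgD _ (intgZ ((t / 2) `^ (q - 1) + t `^ (q - 1)) _ (intg_kpt_refl t p0))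
    (intgZ ((t / 2) `^ (p - 1) + t `^ (p - 1)) _ (intg_kpt t q0))).
- move=> s _; rewrite ger0_norm; last by rewrite mulr_ge0// kp_ge0.
  exact: conv_kp_le.
- by apply: measurable_funM => //; exact: meas_refl.
- by [].
Qed.

Lemma causal_le p a t : causal p a -> exists2 A : R, 0 <= A & forall s, s <= t -> `|a s| <= A * kp p s.
Proof.
move=> [a0 _ /(_ (`|t| + 1))[]]; first by rewrite ltr_wpDl.
move=> A A0 HA; exists A => // s st; apply: HA.
by have := ler_norm t; lra.
Qed.

Lemma intg_conv p q a b t : 0 < p -> 0 < q -> causal p a -> causal q b ->
  intg setT (fun s => a (t - s) * b s).
Proof.
move=> p0 q0 ca cb; have [A A0 HA] := causal_le t ca; have [B B0 HB] := causal_le t cb.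
case: ca cb => [na ma _] [nb mb _].
apply: (intg_le _ _ _ (intgZ (A * B) _ (intg_conv_kp t p0 q0))) => //.
  by apply: measurable_funM => //; exact: meas_refl.
move=> s _; have [s0|s0] := leP s 0.
  by rewrite nb// mulr0 normr0 !mulr_ge0// kp_ge0.
have [st|st] := leP s t; last first.
  rewrite na; last by lra.
  by rewrite mul0r normr0 !mulr_ge0// kp_ge0.
rewrite normrM mulrACA; apply: ler_pM => //; [apply: HA; lra|exact: HB].
Qed.

Lemma conv_norm_le p q a b A B t : 0 < p -> 0 < q -> causal p a -> causal q b ->
  0 <= A -> 0 <= B -> (forall s, s <= t -> `|a s| <= A * kp p s) ->
  (forall s, s <= t -> `|b s| <= B * kp q s) ->
  `|conv a b t| <= A * B * conv (kp p) (kp q) t.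
Proof.
move=> p0 q0 [na ma _] [nb mb _] A0 B0 HA HB.
rewrite -RI_Z//; last exact: intg_conv_kp.
apply: RI_norm_le => //.
- by apply: measurable_funM => //; exact: meas_refl.
- by apply: intgZ => //; exact: intg_conv_kp.
move=> s _; have [s0|s0] := leP s 0.
  by rewrite nb// mulr0 normr0 !mulr_ge0// kp_ge0.
have [st|st] := leP s t; last first.
  rewrite na; last by lra.
  by rewrite mul0r normr0 !mulr_ge0// kp_ge0.
rewrite normrM mulrACA; apply: ler_pM => //; [apply: HA; lra|exact: HB].
Qed.

Lemma conv_neg a b t : (forall s, s <= 0 -> a s = 0) -> (forall s, s <= 0 -> b s = 0) ->
  t <= 0 -> conv a b t = 0.
Proof.
move=> na nb t0; rewrite /conv (RI_ext (g := cst 0)) ?Rintegral_cst ?mul0r// => s _.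
have [s0|s0] := leP s 0; first by rewrite nb// mulr0.
by rewrite na ?mul0r//; lra.
Qed.

Lemma convC p q a b t : 0 < p -> 0 < q -> causal p a -> causal q b -> conv a b t = conv b a t.
Proof.
move=> p0 q0 ca cb; rewrite /conv (@RI_affine R (-1) t) ?oppr_eq0 ?oner_eq0//; last exact: (intg_conv t p0 q0 ca cb).
rewrite normrN normr1 mul1r; apply: RI_ext => s _.
by rewrite mulrC mulN1r opprD opprK addrA [t + s]addrC [- s + t]addrC addrK.
Qed.

(** The fixed interval of integration prepares differentiation in [t]. *)
Lemma conv_scale p q a b t : 0 < p -> 0 < q -> causal p a -> causal q b -> 0 < t ->
  conv a b t = t * RI `]0, 1[ (fun r => a (t * (1 - r)) * b (t * r)).
Proof.
move=> p0 q0 ca cb t0.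
rewrite /conv (@RI_affine R t 0) ?gt_eqF//; last exact: (intg_conv t p0 q0 ca cb).
rewrite gtr0_norm//; congr (_ * _).
rewrite [RHS]RI_restrict; apply: RI_ext => r _; rewrite patchE addr0.
case: ifPn => [_|]; first by rewrite mulrBr mulr1.
move: ca cb => [na _ _] [nb _ _].
move=> /negP h; have [r0|r0] := leP r 0; first by rewrite (nb (t * r)) ?mulr0// pmulr_rle0.
rewrite na ?mul0r// subr_le0 -[leLHS]mulr1 ler_pM2l// leNgt; apply/negP => r1; apply: h.
by rewrite inE/= in_itv/= r0 r1.
Qed.

Lemma intg_beta p q : 0 < p -> 0 < q -> intg `]0, 1[ (fun r : R => kp p (1 - r) * kp q r).
Proof.
by move=> p0 q0; apply: (intgS _ _ _ (intg_conv_kp 1 p0 q0)) => //.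
Qed.

Lemma conv_kpE p q t : 0 < p -> 0 < q -> 0 < t ->
  conv (kp p) (kp q) t = t `^ (p + q - 1) * conv (kp p) (kp q) 1.
Proof.
move=> p0 q0 t0; have ck := @causal_kp.
rewrite (conv_scale p0 q0 (ck p) (ck q) t0) (conv_scale p0 q0 (ck p) (ck q) ltr01) mul1r.
rewrite (RI_ext (g := fun r => t `^ (p - 1 + (q - 1)) * (kp p (1 - r) * kp q r))); last first.
  move=> r _; rewrite !kpM// (@powRD R t (p - 1) (q - 1)); last by rewrite (gt_eqF t0) implybT.
  by ring.
rewrite RI_Z//; last exact: intg_beta.
rewrite mulrA (_ : p + q - 1 = 1 + (p - 1 + (q - 1))); last by ring.
rewrite (@powRD R t 1 (p - 1 + (q - 1))); last by rewrite (gt_eqF t0) implybT.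
rewrite powRr1; last exact: ltW.
have -> : RI `]0, 1[ (fun r : R => kp p (1 * (1 - r)) * kp q (1 * r)) = RI `]0, 1[ (fun r : R => kp p (1 - r) * kp q r).
  by apply: RI_ext => r _; rewrite !mul1r.
by [].
Qed.

End convolution.

Section convolution_theory.
Context {R : realType}.
Implicit Types (a b c : R -> R) (p q r s t : R).

Lemma scale_bound p q a b t0 : causal p a -> causal q b -> 0 < t0 ->
  exists2 G : R, 0 <= G & forall t r : R, t0 / 2 < t < 2 * t0 -> 0 < r < 1 ->
    `|a (t * (1 - r)) * b (t * r)| <= G * (kp p (1 - r) * kp q r).
Proof.
move=> ca cb t00.
have [A A0 HA] := causal_le (2 * t0) ca; have [B B0 HB] := causal_le (2 * t0) cb.
exists (A * ((t0 / 2) `^ (p - 1) + (2 * t0) `^ (p - 1)) *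
        (B * ((t0 / 2) `^ (q - 1) + (2 * t0) `^ (q - 1)))).
  by rewrite !mulr_ge0// addr_ge0// powR_ge0.
move=> t r /andP[t1 t2] /andP[r0 r1].
have tp : 0 < t by lra.
have tb e : t `^ e <= (t0 / 2) `^ e + (2 * t0) `^ e by apply: powR_bound; lra.
have trle x : 0 < x -> x < 1 -> t * x <= 2 * t0.
  by move=> x0 x1; apply: ltW; rewrite (lt_trans _ t2)// gtr_pMr.
rewrite normrM mulrACA; apply: ler_pM => //.
  apply: (le_trans (HA _ _)); first by apply: trle; lra.
  rewrite kpM// mulrA; apply: ler_wpM2r; first exact: kp_ge0.
  by apply: ler_wpM2l.
apply: (le_trans (HB _ _)); first by apply: trle; lra.
rewrite kpM// mulrA; apply: ler_wpM2r; first exact: kp_ge0.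
by apply: ler_wpM2l.
Qed.

Lemma intg_scale p q a b t : 0 < p -> 0 < q -> causal p a -> causal q b -> 0 < t ->
  intg `]0, 1[ (fun r => a (t * (1 - r)) * b (t * r)).
Proof.
move=> p0 q0 ca cb t0.
have := @intg_affine R t 0 _ (lt0r_neq0 t0) (intg_conv t p0 q0 ca cb).
move=> /(intgS measurableT (measurable_itv `]0, 1[) (@subsetT _ _)).
by apply: intg_ext => //= r _; rewrite addr0 mulrBr mulr1.
Qed.

Lemma cont_comp (f g : R -> R) t : {for g t, continuous f} -> {for t, continuous g} ->
  {for t, continuous (fun s => f (g s))}.
Proof. by move=> cf cg; exact: (continuous_comp cg cf). Qed.

Lemma conv_cont p q a b : 0 < p -> 0 < q -> causal p a -> causal q b ->
  cont_pos a -> cont_pos b -> cont_pos (conv a b).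
Proof.
move=> p0 q0 ca cb ka kb t0 t00.
pose F t := t * RI `]0, 1[ (fun r => a (t * (1 - r)) * b (t * r)).
apply: (@cont_near _ F).
  near=> t; rewrite /F (conv_scale p0 q0 ca cb)//; near: t; exact: near_gt.
have [G G0 HG] := scale_bound ca cb t00.
have cs (x : R) : {for t0, continuous (fun t : R => t * x)}.
  by apply: cvgM; [exact: cvg_id|exact: cvg_cst].
apply: cvgM; first exact: cvg_id.
apply: (@continuity_under_integral R _ _ lebesgue_measure
  (fun t r => a (t * (1 - r)) * b (t * r)) [set` `]0, 1[] _ (t0 / 2) (2 * t0) _ _
  (fun r => G * (kp p (1 - r) * kp q r))) => //.
- move=> t; rewrite /= in_itv/= => /andP[h _].
  by apply: (intg_scale p0 q0 ca cb); lra.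
- apply: aeW => r /=; rewrite in_itv/= => /andP[r0 r1] t; rewrite inE/= in_itv/= => /andP[h _].
  have tp : 0 < t by lra.
  have cs' (x : R) : {for t, continuous (fun t : R => t * x)}.
    by apply: cvgM; [exact: cvg_id|exact: cvg_cst].
  have c1 : {for t, continuous (fun x : R => a (x * (1 - r)))}.
    by apply: (@cont_comp a); [apply: ka; apply: mulr_gt0 => //; lra|exact: cs'].
  have c2 : {for t, continuous (fun x : R => b (x * r))}.
    by apply: (@cont_comp b); [apply: kb; apply: mulr_gt0|exact: cs'].
  by apply: cvgM; [exact: c1|exact: c2].
- by apply: intgZ => //; exact: intg_beta.
- move=> t; rewrite /= in_itv/= => h; apply: aeW => r /=; rewrite in_itv/= => r01; exact: HG.
- rewrite inE/= in_itv/=; apply/andP; split; lra.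
Unshelve. all: end_near. Qed.

Lemma causal_conv p q a b : 0 < p -> 0 < q -> causal p a -> causal q b ->
  cont_pos a -> cont_pos b -> causal (p + q) (conv a b).
Proof.
move=> p0 q0 ca cb ka kb.
have na : forall t, t <= 0 -> conv a b t = 0.
  by move=> t; apply: conv_neg; [case: ca|case: cb].
split => //; first by apply: meas_causal => //; exact: (conv_cont p0 q0).
move=> S S0; have [A A0 HA] := causal_le S ca; have [B B0 HB] := causal_le S cb.
have C0 : 0 <= conv (kp p) (kp q) 1 by apply: Rintegral_ge0 => x _; rewrite mulr_ge0 ?kp_ge0.
exists (A * B * conv (kp p) (kp q) 1); first by rewrite !mulr_ge0.
move=> t tS; have [t0|t0] := leP t 0.
  by rewrite na// normr0 !mulr_ge0// kp_ge0.
apply: (@le_trans _ _ (A * B * conv (kp p) (kp q) t)).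
  by apply: (conv_norm_le p0 q0 ca cb) => // s st; [apply: HA|apply: HB]; lra.
by rewrite conv_kpE// kpE// [X in _ * X]mulrC mulrA.
Qed.

(** After rescaling to the unit interval the variable [t] occurs only in [a (t (1 - r)) * b (t r)], so
    that [a] and [b] are differentiated away from their singularities; [t a'] and [t b'] are again causal
    with the same exponents, which is why the derivatives are written [a1 s / s] and [b1 s / s]. *)
Lemma conv_derive p q a b a1 b1 t : 0 < p -> 0 < q ->
  causal p a -> causal q b -> causal p a1 -> causal q b1 ->
  (forall s, 0 < s -> is_derive s 1 a (a1 s / s)) ->
  (forall s, 0 < s -> is_derive s 1 b (b1 s / s)) -> 0 < t ->
  is_derive t 1 (conv a b) ((conv a b t + conv a1 b t + conv a b1 t) / t).
Proof.
move=> p0 q0 ca cb ca1 cb1 da db t0.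
pose f := fun t r : R => a (t * (1 - r)) * b (t * r).
have fd s (r : R) : 0 < s -> 0 < r < 1 -> is_derive s 1 (f^~ r)
   (s^-1 * (a1 (s * (1 - r)) * b (s * r) + a (s * (1 - r)) * b1 (s * r))).
  move=> s0 /andP[r0 r1]; have r10 : 0 < 1 - r by lra.
  have dl (x : R) : is_derive s 1 (fun s : R => s * x) x.
    by apply: dv_eq (dvM (dv_id s) (dv_cst x s)) _; rewrite mul1r mulr0 addr0.
  apply: dv_eq (dvM (dv_comp (da _ _) (dl (1 - r))) (dv_comp (db _ _) (dl r))) _; rewrite ?mulr_gt0//.
  by field; rewrite !gt_eqF//.
have [G G0 HG] := scale_bound ca1 cb t0; have [H H0 HH] := scale_bound ca cb1 t0.
pose K := (t / 2)^-1 * (G + H).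
have K0 : 0 <= K by rewrite mulr_ge0 ?invr_ge0 ?addr_ge0//; lra.
have tI : [set` `]t / 2, 2 * t[] t by rewrite /= in_itv/=; apply/andP; split; lra.
have If x : [set` `]t / 2, 2 * t[] x -> 0 < x by rewrite /= in_itv/= => /andP[? _]; lra.
have h1 x : [set` `]t / 2, 2 * t[] x -> intg `]0, 1[ (f x).
  by move=> /If x0; exact: (intg_scale p0 q0 ca cb).
have h2 (x y : R) : [set` `]t / 2, 2 * t[] x -> [set` `]0, 1[] y -> derivable (f ^~ y) x 1.
  by move=> /If x0; rewrite /= in_itv/= => y01; have [] := fd x y x0 y01.
have h3 (y : R) : 0 <= K * (kp p (1 - y) * kp q y) by rewrite mulr_ge0// mulr_ge0// kp_ge0.
have h4 : intg `]0, 1[ (fun r => K * (kp p (1 - r) * kp q r)).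
  by apply: intgZ => //; exact: intg_beta.
have h5 (x y : R) : [set` `]t / 2, 2 * t[] x -> [set` `]0, 1[] y ->
    `|partial1of2 f x y| <= K * (kp p (1 - y) * kp q y).
  move=> xI; have x0 := If x xI; move: xI; rewrite /= !in_itv/= => xI y01.
  rewrite /partial1of2 (dv1 (fd x y x0 y01)) normrM /K -mulrA.
  apply: ler_pM => //.
    rewrite gtr0_norm ?invr_gt0// lef_pV2 ?posrE//; last by lra.
    by case/andP: xI => /ltW.
  apply: (le_trans (ler_normD _ _)); rewrite mulrDl; apply: lerD; [exact: HG|exact: HH].
have D1 := @cvg_differentiation_under_integral R _ _ lebesgue_measure f _ (measurable_itv `]0, 1[)
  t (t / 2) (2 * t) tI h1 h2 _ h3 h4 h5.
have D2 : is_derive t 1 (fun t => RI `]0, 1[ (f t)) (RI `]0, 1[ (partial1of2 f t)).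
  apply: cvg_dv.
  suff <- : (fun h : R => h^-1 *: (RI `]0, 1[ (f (h + t)) - RI `]0, 1[ (f t))) =
    (fun h => (RI `]0, 1[ (f (t + h)) - RI `]0, 1[ (f t)) / h) by exact: D1.
  by apply/funext => h; rewrite /GRing.scale/= mulrC addrC [t + h]addrC addrC.
have -> : conv a b t = t * RI `]0, 1[ (f t) by rewrite (conv_scale p0 q0 ca cb).
have -> : conv a1 b t = t * RI `]0, 1[ (fun r => a1 (t * (1 - r)) * b (t * r)) by rewrite (conv_scale p0 q0 ca1 cb).
have -> : conv a b1 t = t * RI `]0, 1[ (fun r => a (t * (1 - r)) * b1 (t * r)) by rewrite (conv_scale p0 q0 ca cb1).
apply: (@dv_near _ (fun t => t * RI `]0, 1[ (f t))).
  by near=> s; rewrite (conv_scale p0 q0 ca cb)//; near: s; exact: near_gt.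
apply: dv_eq (dvM (dv_id t) D2) _.
rewrite [X in _ + _ * X = _](RI_ext (g := fun r => t^-1 * (a1 (t * (1 - r)) * b (t * r) + a (t * (1 - r)) * b1 (t * r)))); last first.
  by move=> r; rewrite /= in_itv/= => r01; rewrite /partial1of2 (dv1 (fd t r t0 r01)).
have i1 := intg_scale p0 q0 ca1 cb t0; have i2 := intg_scale p0 q0 ca cb1 t0.
rewrite RI_Z//; last exact: (intgD (measurable_itv _) i1 i2).
rewrite (RI_D (measurable_itv _) i1 i2).
by field; rewrite gt_eqF.
Unshelve. all: end_near. Qed.

(** [kp 1] is the indicator function of the positive half-line. *)
Lemma conv1E p b t : 0 < p -> causal p b -> 0 < t ->
  intg `]0, t] b /\ conv (kp 1) b t = RI `]0, t] b.
Proof.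
move=> p0 cb t0; have i1 := intg_conv t ltr01 p0 (@causal_kp R 1) cb.
have i2 : intg `]0, t[ b.
  apply: intg_ext (intgS measurableT (measurable_itv `]0, t[) (@subsetT _ _) i1) => //= s.
  rewrite in_itv/= => /andP[s0 st]; rewrite kpE ?subr_gt0// subrr powRr0 mul1r//.
have E : conv (kp 1) b t = RI `]0, t[ b.
  rewrite [RHS]RI_restrict; apply: RI_ext => s _; rewrite patchE; case: ifPn => [|/negP h].
    rewrite inE/= in_itv/= => /andP[s0 st]; rewrite kpE ?subr_gt0// subrr powRr0 mul1r//.
  have [s0|s0] := leP s 0; first by case: cb => ->//; rewrite mulr0.
  rewrite kp_neg ?mul0r// subr_le0 leNgt; apply/negP => st; apply: h.
  by rewrite inE/= in_itv/= s0 st.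
split; last by rewrite E Rintegral_itv_bndo_bndc.
have mb : measurable_fun `]0, t] b by case: cb => _ mb _; exact: measurable_funTS.
apply/integrableP; split; first exact/measurable_EFinP.
rewrite -integral_itv_bndo_bndc; first by case/integrableP: i2.
by apply/measurable_EFinP; apply: measurableT_comp => //; exact: intg_meas.
Qed.

Lemma conv1_derive p b t : 0 < p -> causal p b -> cont_pos b -> 0 < t ->
  is_derive t 1 (conv (kp 1) b) (b t).
Proof.
move=> p0 cb kb t0; have t1 : 0 < t + 1 by lra.
have [i1 _] := conv1E p0 cb t1.
have tt : t < t + 1 by lra.
have [d1 d2] := @continuous_FTC1 R b (BRight 0) t (t + 1) tt i1 t0 (kb _ t0).
apply: (@dv_near _ (fun x => RI `]0, x] b)).
  near=> s; rewrite (conv1E p0 cb _).2//; near: s; exact: near_gt.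
rewrite -d2; exact: dv_derivable.
Unshelve. all: end_near. Qed.

Lemma causal_norm p a : causal p a -> causal p (fun s => `|a s|).
Proof.
move=> [na ma ba]; split => [t t0||S S0]; first by rewrite na// normr0.
  exact: measurableT_comp.
by have [A A0 HA] := ba S S0; exists A => // t tS; rewrite normr_id; exact: HA.
Qed.

Lemma cont_norm a : cont_pos a -> cont_pos (fun s => `|a s|).
Proof. by move=> ka t t0; apply: cvg_norm; exact: ka. Qed.

(** Fubini's theorem; the integrability on the plane is the same computation for the absolute values. *)
Lemma convA p q r a b c t : 0 < p -> 0 < q -> 0 < r ->
  causal p a -> causal q b -> causal r c -> cont_pos a -> cont_pos b -> cont_pos c ->
  conv (conv a b) c t = conv a (conv b c) t.
Proof.
move=> p0 q0 r0 ca cb cc ka kb kc.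
have shift u w : causal p u -> causal q w -> forall s,
    intg setT (fun v => u (t - v) * w (v - s)) /\
    conv u w (t - s) = RI setT (fun v => u (t - v) * w (v - s)).
  move=> cu cw s; have i1 := intg_conv (t - s) p0 q0 cu cw.
  have e : (fun v => u (t - s - (1 * v + - s)) * w (1 * v - s)) = (fun v => u (t - v) * w (v - s)).
    by apply/funext => v; rewrite mul1r; congr (u _ * _); ring.
  split; first by rewrite -e; apply: (intg_affine (- s) _ i1); exact: oner_neq0.
  by rewrite /conv (@RI_affine R 1 (- s)) ?oner_neq0// normr1 mul1r e.
have pq0 : 0 < p + q by lra.
pose F (z : measurableTypeR R * measurableTypeR R) := a (t - z.2) * b (z.2 - z.1) * c z.1.
have [na ma _] := ca; have [nb mb _] := cb; have [nc mc _] := cc.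
have mF : measurable_fun setT F.
  apply: measurable_funM; first apply: measurable_funM.
  - apply: (measurableT_comp ma); apply: measurable_funB => //.
  - by apply: (measurableT_comp mb); apply: measurable_funB.
  - exact: (measurableT_comp mc).
have mFE : measurable_fun setT (EFin \o F) by exact/measurable_EFinP.
have iF : (lebesgue_measure \x lebesgue_measure)%E.-integrable setT (EFin \o F).
  apply/integrable12ltyP => //=.
  have E s : (\int[leb]_y `|F (s, y)|%:E = (conv (fun x => `|a x|) (fun x => `|b x|) (t - s) * `|c s|)%:E)%E.
    have [i1 E1] := shift _ _ (causal_norm ca) (causal_norm cb) s.
    rewrite E1 mulrC -RI_Z// /Rintegral fineK; last first.
      by apply: integrable_fin_num => //; exact: (intgZ `|c s| _ i1).
    by apply: eq_integral => y _; rewrite /F /= !normrM mulrC.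
  have i3 := intg_conv t pq0 r0 (causal_conv p0 q0 (causal_norm ca) (causal_norm cb)
    (cont_norm ka) (cont_norm kb)) (causal_norm cc).
  case/integrableP: i3 => _; rewrite (_ : (\int[_]_(x in _) _)%E = (\int[leb]_x \int[leb]_y `|F (x, y)|%:E)%E)//.
  apply: eq_integral => s _; rewrite E /= ger0_norm// mulr_ge0//.
  by apply: Rintegral_ge0 => x _; exact: mulr_ge0.
have := Fubini iF; rewrite /comp.
have E1 s : (\int[leb]_y (F (s, y))%:E = (conv a b (t - s) * c s)%:E)%E.
  have [i1 E1] := shift _ _ ca cb s.
  rewrite E1 mulrC -RI_Z// /Rintegral fineK; last first.
    by apply: integrable_fin_num => //; exact: (intgZ (c s) _ i1).
  by apply: eq_integral => y _; rewrite /F /= mulrC.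
have E2 y : (\int[leb]_s (F (s, y))%:E = (a (t - y) * conv b c y)%:E)%E.
  have i1 := intg_conv y q0 r0 cb cc.
  rewrite /conv -RI_Z// /Rintegral fineK; last first.
    by apply: integrable_fin_num => //; exact: (intgZ (a (t - y)) _ i1).
  by apply: eq_integral => s _; rewrite /F /= mulrA.
under eq_integral do rewrite E1; under [RHS]eq_integral do rewrite E2.
by move=> /(congr1 fine).
Qed.

End convolution_theory.

(** * Power series in a fractional power *)

Section more_sums.
Context {R : realType}.
Implicit Types (u v M : nat -> R).

Lemma summable_cst0 : summable (fun=> 0 : R).
Proof.
rewrite /summable (_ : series _ = cst 0); first exact: is_cvg_cst.
by apply/funext => n; rewrite /series/= big1.
Qed.

Lemma summableB u v : summable u -> summable v -> summable (fun n => u n - v n).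
Proof.
move=> su sv; apply: summableD => //.
rewrite (_ : (fun n => - v n) = (fun n => -1 * v n)); first exact: summableZ.
by apply/funext=> n; rewrite mulN1r.
Qed.

Lemma ratio_test u : (\forall n \near \oo, `|u n.+1| <= 2^-1 * `|u n|) -> summable u.
Proof.
move=> [N _ HN].
pose C := \sum_(0 <= k < N.+1) `|u k| * 2 ^+ k.
have H n : `|u n| <= C * 2^-1 ^+ n.
  have [nN|Nn] := leqP n N.
    rewrite exprVn ler_pdivlMr ?exprn_gt0// /C.
    have mn : n \in index_iota 0 N.+1 by rewrite mem_index_iota.
    rewrite (bigD1_seq _ mn (iota_uniq _ _))/=.
    by rewrite lerDl sumr_ge0// => k _; rewrite mulr_ge0.
  elim: n Nn => // n IH; rewrite ltnS leq_eqVlt => /orP[/eqP Nn|Nn].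
    rewrite -Nn; apply: (le_trans (HN N (leqnn _))).
    rewrite exprS mulrCA ler_pM2l// exprVn ler_pdivlMr ?exprn_gt0// /C big_nat_recr//=.
    by rewrite lerDr sumr_ge0// => k _; rewrite mulr_ge0.
  apply: (le_trans (HN n (ltnW Nn))); rewrite exprS mulrCA ler_pM2l//; exact: IH.
apply: (summable_le H); apply: is_cvg_geometric_series.
by rewrite ger0_norm ?invr_ge0// invf_lt1// ltr1n.
Qed.

Lemma sumr_shift u : summable u -> summable (fun n => u n.+1) /\ sumr u = u 0%N + sumr (fun n => u n.+1).
Proof.
move=> su.
have E n : series u n.+1 = u 0%N + series (fun n => u n.+1) n.
  by rewrite /series/= big_nat_recl.
have c : (fun n => series u n.+1) @ \oo --> sumr u.
  by have := su; rewrite /summable -(cvg_shiftS (series u)).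
have c2 : series (fun n => u n.+1) @ \oo --> sumr u - u 0%N.
  have -> : series (fun n => u n.+1) = (fun n => series u n.+1 - u 0%N).
    by apply/funext => n; rewrite E addrC addKr.
  by apply: cvgB; [exact: c|exact: cvg_cst].
split; first by apply/cvg_ex; eexists; exact: c2.
by rewrite {2}/sumr (cvg_lim _ c2)// addrC subrK.
Qed.

Lemma RI_dominated (D : set R) (f : nat -> R -> R) (g h : R -> R) : measurable D ->
  (forall n, measurable_fun D (f n)) -> (forall s, D s -> f n s @[n --> \oo] --> g s) ->
  (forall n s, D s -> `|f n s| <= h s) -> intg D h ->
  RI D (f n) @[n --> \oo] --> RI D g.
Proof.
move=> mD mf fg fh ih.
have mg : measurable_fun D g by exact: (measurable_fun_cvg mf fg).
have [|||||i1 _ i2] := @dominated_convergence _ _ _ lebesgue_measure D mD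
   (fun n s => (f n s)%:E) (EFin \o g) (EFin \o h).
- by move=> n; apply/measurable_EFinP; exact: mf.
- exact/measurable_EFinP.
- by apply: aeW => s Ds; apply: cvg_EFin; [exact: nearW|exact: fg].
- exact: ih.
- by apply: aeW => s n Ds; rewrite lee_fin; exact: fh.
by rewrite /Rintegral; apply: fine_cvg; rewrite fineK//; exact: integrable_fin_num.
Qed.

End more_sums.

Lemma powR_le {R : realType} (p a b : R) : 0 <= p -> 0 <= a -> a <= b -> a `^ p <= b `^ p.
Proof. by move=> p0 a0 ab; apply: ge0_ler_powR => //; rewrite nnegrE// (le_trans a0). Qed.

Section power_sums.
Context {R : realType}.
Variable al : R.
Hypothesis al0 : 0 < al.
Implicit Types (u v : nat -> R) (s t : R).

(** Coefficients of a power series with infinite radius of convergence. *)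
Definition entire u := forall K : R, 0 <= K -> summable (fun n => `|u n| * K ^+ n).

Let ex n : R := n.+1%:R * al.

Let ex0 n : 0 < ex n.
Proof. by rewrite mulr_gt0// ltr0n. Qed.

Lemma kp_ex n t : kp (ex n) t = kp al t * (t `^ al) ^+ n.
Proof.
have [t0|t0] := ltP 0 t; last by rewrite !kp_neg// mul0r.
rewrite !kpE// -powR_mulrn ?powR_ge0// -powRrM -powRD ?(gt_eqF t0) ?implybT//.
congr (_ `^ _); rewrite /ex -natr1; ring.
Qed.

(** [t^(al-1)] times the power series with coefficients [u] in the variable [t^al]. *)
Definition psum u t := sumr (fun n => u n * kp (ex n) t).

Lemma kp_ex_le n s t : s <= t -> kp (ex n) s <= kp al s * (t `^ al) ^+ n.
Proof.
move=> st; have [s0|s0] := leP s 0; first by rewrite !kp_neg// mul0r.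
rewrite kp_ex; apply: ler_wpM2l; first exact: kp_ge0.
rewrite lerXn2r ?nnegrE ?powR_ge0//; by apply: powR_le => //; exact: ltW.
Qed.

Lemma psum_term_le u n s t : s <= t -> `|u n * kp (ex n) s| <= kp al s * (`|u n| * (t `^ al) ^+ n).
Proof.
move=> st; rewrite normrM [`|kp _ _|]ger0_norm ?kp_ge0// mulrCA.
by apply: ler_wpM2l => //; exact: kp_ex_le.
Qed.

Lemma psum_summable u t : entire u -> summable (fun n => u n * kp (ex n) t).
Proof.
move=> eu; apply: (@summable_le _ _ (fun n => kp al t * (`|u n| * (t `^ al) ^+ n))).
  by move=> n; exact: psum_term_le.
by apply: summableZ; apply: eu; exact: powR_ge0.
Qed.

Lemma psum_neg u t : t <= 0 -> psum u t = 0.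
Proof.
move=> t0; rewrite /psum (_ : (fun n => _) = (fun n => 0 * 0)); last first.
  by apply/funext => n; rewrite kp_neg ?mulr0 ?mul0r.
by rewrite sumrZ ?mul0r//; exact: summable_cst0.
Qed.

Lemma psum_le u s t : entire u -> s <= t ->
  `|psum u s| <= sumr (fun n => `|u n| * (t `^ al) ^+ n) * kp al s.
Proof.
move=> eu st; rewrite mulrC -sumrZ; last by apply: eu; exact: powR_ge0.
apply: sumr_norm_le; first by move=> n; exact: psum_term_le.
by apply: summableZ; apply: eu; exact: powR_ge0.
Qed.

Lemma entire_linear u (a b : R) : entire u -> (forall K : R, 0 <= K -> summable (fun n => n%:R * `|u n| * K ^+ n)) ->
  entire (fun n => (n%:R * a + b) * u n).
Proof.
move=> eu e1 K K0; apply: (@summable_le _ _ (fun n => `|a| * (n%:R * `|u n| * K ^+ n) + `|b| * (`|u n| * K ^+ n))); last first.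
  by apply: summableD; apply: summableZ; [exact: e1|exact: eu].
move=> n; rewrite ger0_norm ?mulr_ge0 ?exprn_ge0//.
rewrite !mulrA -mulrDl ler_wpM2r ?exprn_ge0// normrM -mulrDl ler_wpM2r//.
by apply: (le_trans (ler_normD _ _)); rewrite normrM normr_nat mulrC.
Qed.

Lemma entire_n u : entire u -> forall K : R, 0 <= K -> summable (fun n => n%:R * `|u n| * K ^+ n).
Proof.
move=> eu K K0; apply: (@summable_le _ _ (fun n => `|u n| * (2 * K) ^+ n)); last first.
  by apply: eu; rewrite mulr_ge0.
move=> n; rewrite ger0_norm ?mulr_ge0 ?exprn_ge0// exprMn mulrA.
rewrite ler_wpM2r ?exprn_ge0// mulrC ler_wpM2l//.
by rewrite -natrX ler_nat ltnW// ltn_expl.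
Qed.

(** The coefficients of [t] times the derivative of [psum]. *)
Definition dcoef u n := (n.+1%:R * al - 1) * u n.

Lemma entire_dcoef u : entire u -> entire (dcoef u).
Proof.
move=> eu; have := @entire_linear u al (al - 1) eu (entire_n eu).
by congr entire; apply/funext => n; rewrite /dcoef -natr1; congr (_ * _); ring.
Qed.

Lemma psum_derive u t : entire u -> 0 < t -> is_derive t 1 (psum u) (psum (dcoef u) t / t).
Proof.
move=> eu t0; have ed := entire_dcoef eu.
have E : psum (dcoef u) t / t = sumr (fun n => u n * ((ex n - 1) * t `^ (ex n - 1 - 1))).
  rewrite mulrC -sumrZ; last exact: psum_summable.
  congr sumr; apply/funext => n; rewrite kpE// /dcoef -/(ex n).
  rewrite [in RHS]powRB ?(gt_eqF t0) ?implybT// powRr1 ?ltW//; ring.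
rewrite E.
apply: (@dv_near _ (fun s => sumr (fun n => u n * s `^ (ex n - 1)))).
  near=> s; rewrite /psum; congr sumr; apply/funext => n; rewrite kpE//.
  by near: s; exact: near_gt.
apply: (@sumr_is_derive _ (fun n s => u n * s `^ (ex n - 1)) (fun n s => u n * ((ex n - 1) * s `^ (ex n - 1 - 1)))
  (fun n => ((t / 2) `^ (al - 2) + (2 * t) `^ (al - 2)) * (`|dcoef u n| * ((2 * t) `^ al) ^+ n)) (t / 2) (2 * t)).
- by apply/andP; split; lra.
- by apply: summableZ; apply: ed; exact: powR_ge0.
- by move=> n y /andP[y1 y2]; apply: dvZ; apply: dv_powR; lra.
- move=> n y /andP[y1 y2]; have y0 : 0 < y by lra.
  rewrite mulrCA mulrA -/(dcoef u n) normrM [X in _ * X]ger0_norm ?powR_ge0//.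
  rewrite [leRHS]mulrCA; apply: ler_wpM2l => //.
  rewrite (_ : ex n - 1 - 1 = (al - 2) + n%:R * al); last by rewrite /ex -natr1; ring.
  rewrite powRD ?(gt_eqF y0) ?implybT//; apply: ler_pM; rewrite ?powR_ge0//.
    by apply: powR_bound; lra.
  rewrite mulrC powRrM powR_mulrn ?powR_ge0// lerXn2r ?nnegrE ?powR_ge0//.
  by apply: powR_le => //; apply: ltW.
- move=> y /andP[y1 y2]; have y0 : 0 < y by lra.
  have := @psum_summable u y eu; congr summable; apply/funext => n; by rewrite kpE.
Unshelve. all: end_near. Qed.

Lemma psum_cont u : entire u -> cont_pos (psum u).
Proof. by move=> eu t t0; exact: dv_cont (psum_derive eu t0). Qed.

Lemma causal_psum u : entire u -> causal al (psum u).
Proof.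
move=> eu; split; [exact: psum_neg|apply: meas_causal; [exact: psum_neg|exact: psum_cont]|].
move=> S S0; exists (sumr (fun n => `|u n| * (S `^ al) ^+ n)); last by move=> t tS; exact: psum_le.
apply: le_trans (sumr_norm_le (u := fun n => `|u n| * (S `^ al) ^+ n) _ (eu _ (powR_ge0 S al))); first exact: normr_ge0.
by move=> n; rewrite ger0_norm// mulr_ge0// exprn_ge0// powR_ge0.
Qed.

(** The Beta integral [B (al, (n + 1) al)]. *)
Definition bcoef n : R := conv (kp al) (kp (ex n)) 1.

Lemma bcoef_ge0 n : 0 <= bcoef n.
Proof. by apply: Rintegral_ge0 => x _; rewrite mulr_ge0// kp_ge0. Qed.

Lemma conv_kp_ex n t : conv (kp al) (kp (ex n)) t = bcoef n * kp (ex n.+1) t.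
Proof.
have [t0|t0] := ltP 0 t; last first.
  by rewrite conv_neg// ?kp_neg ?mulr0// => s s0; rewrite kp_neg.
rewrite conv_kpE// kpE// mulrC; congr (_ * _ `^ _).
by rewrite /ex -!natr1; ring.
Qed.

Lemma conv_psum u t : entire u ->
  conv (kp al) (psum u) t = sumr (fun n => bcoef n * u n * kp (ex n.+1) t).
Proof.
move=> eu.
have [| |_ ] := @sumr_integral R setT (fun n s => u n * (kp al (t - s) * kp (ex n) s))
  (fun s => kp al (t - s) * kp al s) (fun n => `|u n| * (t `^ al) ^+ n) measurableT _ _ (eu _ (powR_ge0 _ _)) (intg_conv_kp t al0 al0).
- move=> n; apply: measurable_funM => //; apply: measurable_funM; last by case: (@causal_kp R (ex n)).
  by apply: meas_refl; case: (@causal_kp R al).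
- move=> n s _; rewrite normrM -mulrA ler_wpM2l//.
  rewrite ger0_norm ?mulr_ge0 ?kp_ge0//.
  have [st|st] := leP s t.
    rewrite mulrC [leRHS]mulrCA [leRHS]mulrC; apply: ler_wpM2r; first exact: kp_ge0.
    by rewrite mulrC; exact: kp_ex_le.
  by rewrite (@kp_neg _ al (t - s)) ?mul0r ?mulr0//; lra.
have e s : sumr (fun n => u n * (kp al (t - s) * kp (ex n) s)) = kp al (t - s) * psum u s.
  rewrite -sumrZ; last exact: psum_summable.
  by congr sumr; apply/funext => n; rewrite mulrCA.
rewrite /conv; under eq_Rintegral do rewrite e.
move=> ->; congr sumr; apply/funext => n.
rewrite RI_Z//; last exact: intg_conv_kp.
by rewrite -[X in _ * X]/(conv (kp al) (kp (ex n)) t) conv_kp_ex; ring.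
Qed.

(** This makes the resolvent series entire; it follows by dominated convergence, since [r^al < 1] inside
    the unit interval. *)
Lemma bcoef_cvg0 : bcoef n @[n --> \oo] --> 0.
Proof.
have -> : (0 : R) = RI `]0, 1[ (cst 0) by rewrite Rintegral_cst// mul0r.
have E n : bcoef n = RI `]0, 1[ (fun r => kp al (1 - r) * kp (ex n) r).
  rewrite /bcoef (conv_scale al0 (ex0 n) (causal_kp _) (causal_kp _) ltr01) mul1r.
  by apply: RI_ext => r _; rewrite !mul1r.
rewrite (funext E).
apply: (RI_dominated (h := fun r => kp al (1 - r) * kp al r)) => //.
- move=> n; apply: measurable_funTS; apply: measurable_funM; last by case: (@causal_kp R (ex n)).
  by apply: meas_refl; case: (@causal_kp R al).
- move=> r; rewrite /= in_itv/= => /andP[r0 r1].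
  rewrite (_ : (fun n => _) = (fun n => (kp al (1 - r) * kp al r) * (r `^ al) ^+ n)); last first.
    by apply/funext => n; rewrite kp_ex mulrA.
  rewrite -[X in _ --> X](mulr0 (kp al (1 - r) * kp al r)); apply: cvgM; first exact: cvg_cst.
  apply: cvg_expr; rewrite ger0_norm ?powR_ge0//.
  have e1 : (1 : R) `^ al = 1 by rewrite powR1.
  by rewrite -[ltRHS]e1; apply: gt0_ltr_powR; rewrite ?nnegrE// ltW.
- move=> n r; rewrite /= in_itv/= => /andP[r0 r1].
  rewrite ger0_norm ?mulr_ge0 ?kp_ge0//; apply: ler_wpM2l; first exact: kp_ge0.
  apply: (le_trans (kp_ex_le _ (ltW r1))); rewrite powR1 expr1n mulr1//.
- exact: intg_beta.
Qed.

End power_sums.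

(** * The relaxation kernel *)

Section conv_linear.
Context {R : realType}.
Implicit Types (a b c : R -> R) (p q r s t : R).

Lemma causalZ p a (c : R) : causal p a -> causal p (fun t => c * a t).
Proof.
move=> [na ma ba]; split => [t t0||S S0]; first by rewrite na ?mulr0.
  exact: measurable_funM.
have [A A0 HA] := ba S S0; exists (`|c| * A); first by rewrite mulr_ge0.
by move=> t tS; rewrite normrM -mulrA ler_wpM2l//; exact: HA.
Qed.

Lemma causalD p a b : causal p a -> causal p b -> causal p (fun t => a t + b t).
Proof.
move=> [na ma ba] [nb mb bb]; split => [t t0||S S0]; first by rewrite na ?nb ?addr0.
  exact: measurable_funD.
have [A A0 HA] := ba S S0; have [B B0 HB] := bb S S0.
exists (A + B); first by rewrite addr_ge0.
by move=> t tS; rewrite mulrDl (le_trans (ler_normD _ _))// lerD ?HA ?HB.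
Qed.

(** A larger exponent is a milder singularity. *)
Lemma causal_weaken p q a : p <= q -> causal q a -> causal p a.
Proof.
move=> pq [na ma ba]; split => // S S0; have [A A0 HA] := ba S S0.
exists (A * S `^ (q - p)); first by rewrite mulr_ge0 ?powR_ge0.
move=> t tS; have [t0|t0] := leP t 0; first by rewrite na// normr0 !mulr_ge0 ?kp_ge0 ?powR_ge0.
apply: (le_trans (HA t tS)); rewrite -mulrA; apply: ler_wpM2l => //.
rewrite !kpE// (_ : q - 1 = (q - p) + (p - 1)); last by ring.
rewrite powRD ?(gt_eqF t0) ?implybT//; apply: ler_wpM2r; first exact: powR_ge0.
by apply: powR_le; rewrite ?subr_ge0// ltW.
Qed.

Lemma conv_Dr p q a b c t : 0 < p -> 0 < q -> causal p a -> causal q b -> causal q c ->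
  conv a (fun s => b s + c s) t = conv a b t + conv a c t.
Proof.
move=> p0 q0 ca cb cc; rewrite /conv -RI_D//; [|exact: (intg_conv t p0 q0 ca cb)|exact: (intg_conv t p0 q0 ca cc)].
by apply: RI_ext => s _; rewrite mulrDr.
Qed.

Lemma conv_Zr p q a b (c : R) t : 0 < p -> 0 < q -> causal p a -> causal q b ->
  conv a (fun s => c * b s) t = c * conv a b t.
Proof.
move=> p0 q0 ca cb; rewrite /conv -RI_Z//; last exact: (intg_conv t p0 q0 ca cb).
by apply: RI_ext => s _; rewrite mulrCA.
Qed.

Lemma conv_Dl p q a b c t : 0 < p -> 0 < q -> causal p a -> causal p b -> causal q c ->
  conv (fun s => a s + b s) c t = conv a c t + conv b c t.
Proof.
move=> p0 q0 ca cb cc; rewrite /conv -RI_D//; [|exact: (intg_conv t p0 q0 ca cc)|exact: (intg_conv t p0 q0 cb cc)].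
by apply: RI_ext => s _; rewrite mulrDl.
Qed.

Lemma conv_Zl p q a b (c : R) t : 0 < p -> 0 < q -> causal p a -> causal q b ->
  conv (fun s => c * a s) b t = c * conv a b t.
Proof.
move=> p0 q0 ca cb; rewrite /conv -RI_Z//; last exact: (intg_conv t p0 q0 ca cb).
by apply: RI_ext => s _; rewrite mulrA.
Qed.

End conv_linear.

Lemma maximum_contradiction {R : realType} (x y k a b c : R) : x = k - a -> y = k - b -> x <= 0 ->
  a <= b + c -> c <= y * 2^-1 -> 0 < y -> False.
Proof. by move=> *; lra. Qed.

Lemma short_gap {R : realType} (t0 t1 s de : R) : s < t0 -> t1 <= s -> t0 - de <= t1 -> 0 < de ->
  0 < t0 - s < 2 * de.
Proof. by move=> *; apply/andP; split; lra. Qed.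

Lemma beyond_half {R : realType} (t0 t1 s de : R) : 0 < t0 -> t1 <= s -> t0 - de <= t1 -> de <= t0 / 4 ->
  0 < t0 / 2 /\ t0 / 2 <= s.
Proof. by move=> *; split; lra. Qed.

Section relaxation.
Context {R : realType}.
Variables (al kap m : R).
Hypotheses (al01 : 0 < al < 1) (kap0 : 0 < kap) (m0 : 0 < m).
Implicit Types (s t : R).

Let al0 : 0 < al. Proof. by case/andP: al01. Qed.
Let al1 : al < 1. Proof. by case/andP: al01. Qed.

(** Comparison of coefficients in [relax + m * kap * conv (kp al) relax = kap * kp al]. *)
Fixpoint rcoef n : R := if n is n'.+1 then - (m * kap * bcoef al n') * rcoef n' else kap.

Lemma entire_rcoef : entire rcoef.
Proof.
move=> K K0; apply: ratio_test.
have : m * kap * K * bcoef al n @[n --> \oo] --> m * kap * K * 0.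
  by apply: cvgM; [exact: cvg_cst|exact: bcoef_cvg0].
rewrite mulr0 => /cvgr0Pnorm_le /(_ 2^-1); rewrite invr_gt0 => /(_ (ltr0n _ _)).
apply: filterS => n h; rewrite exprS.
rewrite !normrM normrN !normrM !normr_id (ger0_norm K0) (gtr0_norm m0) (gtr0_norm kap0).
rewrite (ger0_norm (bcoef_ge0 _ _)) normrX.
have h2 : m * kap * K * bcoef al n <= 2^-1.
  by apply: le_trans h; exact: ler_norm.
rewrite (_ : _ * _ * _ * _ = (m * kap * K * bcoef al n) * (`|rcoef n| * `|K| ^+ n)); last first.
  by rewrite (ger0_norm K0); ring.
by apply: ler_wpM2r => //; rewrite mulr_ge0// exprn_ge0.
Qed.

(** The resolvent of [m * kap * t^(al-1)]; up to normalisation this is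
    [t^(al-1) E_(al,al)(- m t^al)]. *)
Definition relax t := psum al rcoef t.
(** [t * relax' t]. *)
Definition drelax t := psum al (dcoef al rcoef) t.

Let er := entire_rcoef.
Let ed : entire (dcoef al rcoef) := entire_dcoef er.
Let cr : causal al relax := causal_psum al0 er.
Let cd : causal al drelax := causal_psum al0 ed.
Let kr : cont_pos relax := psum_cont al0 er.
Let kd : cont_pos drelax := psum_cont al0 ed.
Let ck : causal al (kp al) := @causal_kp R al.
Let kk : cont_pos (kp al) := @kp_cont R al.

Lemma relax_volterra t : relax t + m * kap * conv (kp al) relax t = kap * kp al t.
Proof.
have [s1 s2] := sumr_shift (@psum_summable R al al0 rcoef t er).
rewrite /relax conv_psum// {1}/psum s2 mul1r.
have e : (fun n => bcoef al n * rcoef n * kp (n.+2%:R * al) t) =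
    (fun n => - (m * kap)^-1 * (rcoef n.+1 * kp (n.+2%:R * al) t)).
  by apply/funext => n /=; field; rewrite !gt_eqF.
rewrite e sumrZ//=; by field; rewrite !gt_eqF.
Qed.

Lemma drelax_volterra t : drelax t + m * kap * conv (kp al) drelax t = al * relax t - kap * kp al t.
Proof.
have [s1 s2] := sumr_shift (@psum_summable R al al0 rcoef t er).
have [s3 s4] := sumr_shift (@psum_summable R al al0 _ t ed).
rewrite /relax /drelax conv_psum// {1 2}/psum s2 s4 mul1r.
have e : (fun n => bcoef al n * dcoef al rcoef n * kp (n.+2%:R * al) t) =
    (fun n => - (m * kap)^-1 * (dcoef al rcoef n.+1 * kp (n.+2%:R * al) t - al * (rcoef n.+1 * kp (n.+2%:R * al) t))).
  by apply/funext => n /=; rewrite /dcoef /= -[in n.+2%:R]natr1; field; rewrite !gt_eqF.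
have s5 : summable (fun n => al * (rcoef n.+1 * kp (n.+2%:R * al) t)) by apply: summableZ.
rewrite e sumrZ; last exact: summableB.
have d0 : dcoef al rcoef 0 = (al - 1) * kap by rewrite /dcoef mul1r.
rewrite sumr_sub// sumrZ// d0 /=; by field; rewrite !gt_eqF.
Qed.

Lemma relax_derive t : 0 < t -> is_derive t 1 relax (drelax t / t).
Proof. exact: psum_derive. Qed.

Lemma causal_relax : causal al relax. Proof. exact: cr. Qed.
Lemma cont_relax : cont_pos relax. Proof. exact: kr. Qed.
Lemma causal_drelax : causal al drelax. Proof. exact: cd. Qed.
Lemma near0_powR (c e : R) : 0 < e -> exists2 d : R, 0 < d & forall t, 0 < t <= d -> c * t `^ al <= e.
Proof.
move=> e0; have : c * t `^ al @[t --> (0:R)^'+] --> c * 0.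
  by apply: cvgM; [exact: cvg_cst|exact: powR_cvg0].
rewrite mulr0 => /cvgr0Pnorm_le /(_ _ e0) [d /= d0 Hd].
exists (d / 2); first by rewrite divr_gt0.
move=> t /andP[t0 td]; apply: le_trans (ler_norm _) _; apply: Hd => //=.
by rewrite sub0r normrN gtr0_norm//; lra.
Qed.

(** Near zero the convolution term of the Volterra equation is smaller than [kap * kp al] by a factor [t^al]. *)
Let relax_pos0 : exists2 d : R, 0 < d & forall t, 0 < t <= d -> 0 < relax t.
Proof.
have [A A0 HA] := causal_le 1 cr.
have [d d0 Hd] := near0_powR (m * A * conv (kp al) (kp al) 1) (ltr0Sn R 1 : 0 < 2).
have [d1 d10 Hd1] := @near0_powR (m * A * conv (kp al) (kp al) 1) 2^-1 ltac:(by rewrite invr_gt0).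
exists (Num.min 1 d1); first by rewrite lt_min ltr01.
move=> t /andP[t0]; rewrite le_min => /andP[t1 td].
have k0 := kp_gt0 al t0.
have h1 : `|conv (kp al) relax t| <= A * (kp al t * t `^ al * conv (kp al) (kp al) 1).
  have := @conv_norm_le R al al (kp al) relax 1 A t al0 al0 ck cr ler01 A0.
  rewrite mul1r => H; apply: (le_trans (H _ _)).
  - by move=> s _; rewrite mul1r ger0_norm ?kp_ge0.
  - by move=> s st; apply: HA; lra.
  rewrite ler_wpM2l// (conv_kpE al0 al0 t0) kpE// (_ : al + al - 1 = al - 1 + al); last by ring.
  by rewrite powRD ?(gt_eqF t0) ?implybT.
have h2 := Hd1 t; rewrite t0 td in h2; have {}h2 := h2 isT.
have h3 := relax_volterra t; have h4 := ler_norm (conv (kp al) relax t).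
have -> : relax t = kap * (kp al t - m * conv (kp al) relax t) by move: h3; lra.
rewrite mulr_gt0// subr_gt0.
apply: (@le_lt_trans _ _ (m * (A * (kp al t * t `^ al * conv (kp al) (kp al) 1)))).
  by rewrite ler_pM2l// (le_trans h4).
rewrite (_ : m * _ = kp al t * (m * A * conv (kp al) (kp al) 1 * t `^ al)); last by ring.
rewrite -[ltRHS]mulr1 ltr_pM2l//; lra.
Qed.

Lemma kp_decr p s t : p <= 1 -> 0 < s -> s <= t -> kp p t <= kp p s.
Proof.
move=> p1 s0 st; have t0 := lt_le_trans s0 st; rewrite !kpE//.
rewrite -[p - 1]opprK !(powRN _ (- (p - 1))) lef_pV2 ?posrE ?powR_gt0//.
by apply: powR_le => //; lra.
Qed.

(** Positivity: at a first zero [t0] compare [relax / kp al] with its maximum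
    over a short interval ending at [t0]; the kernel [(1 - s / t)^(al-1)] decreases
    in [t], so only the short interval can lower the value, and by at most half. *)
Lemma relax_gt0 t : 0 < t -> 0 < relax t.
Proof.
move=> tp; rewrite ltNge; apply/negP => tn.
have [d d0 Hd] := relax_pos0.
pose Z : set R := [set s | 0 < s /\ relax s <= 0].
have Zt : Z t by [].
have Zlb s : Z s -> d <= s.
  move=> [s0 sn]; rewrite leNgt; apply/negP => sd; have := Hd s.
  by rewrite s0 (ltW sd) ltNge sn => /(_ isT).
have hZ : has_inf Z by split; [exists t|exists d].
set t0 := inf Z; have dt0 : d <= t0 by apply: lb_le_inf; [exists t|].
have t00 : 0 < t0 by exact: lt_le_trans dt0.
have pos s : 0 < s -> s < t0 -> 0 < relax s.
  move=> s0 st; rewrite ltNge; apply/negP => sn.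
  have : t0 <= s by apply: ge_inf; [exact: (proj2 hZ)|split].
  by lra.
have nt0 : relax t0 <= 0.
  rewrite leNgt; apply/negP => pt0.
  have /cvgr_gt /(_ _ pt0) [e /= e0 He] := kr t00.
  have [z Zz zt] := inf_adherent e0 hZ.
  have : t0 <= z by apply: ge_inf => //; exact: (proj2 hZ).
  move=> t0z; have := He z; rewrite /= distrC ger0_norm ?subr_ge0//.
  rewrite ltrBlDr addrC => /(_ zt); rewrite ltNge; by case: Zz => _ ->.
(* [P] bounds the kernel on the last half of the interval, relative to its value at [t0]; the factor [/ al]
   comes from integrating the kernel over the short interval *)
pose P := kp al (t0 / 2) / kp al t0 / al.
have kt0 := kp_gt0 al t00.
have [d1 d10 Hd1] := @near0_powR (m * kap * P) 2^-1 ltac:(by rewrite invr_gt0).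
pose de := Num.min (t0 / 4) (d1 / 4).
have de0 : 0 < de by rewrite lt_min !divr_gt0.
have [de1 de2] : de <= t0 / 4 /\ de <= d1 / 4 by rewrite !ge_min !lexx orbT.
have small0 : 0 < 2 * de <= d1 by apply/andP; split; lra.
(* by the Volterra equation, [M t] is [kap] minus a weighted integral of [relax] *)
pose M s := relax s / kp al s.
have MC s : 0 < s -> {for s, continuous M}.
  by move=> s0; apply: cvgM; [exact: kr|apply: cvgV; [rewrite gt_eqF// kp_gt0|exact: kk]].
have [||t1 t1I t1max] := @EVT_max R M (t0 - de) t0; first lra.
  by apply: continuous_in_subspaceT => s; rewrite inE/= in_itv/= => /andP[h _]; apply: MC; lra.
move: t1I; rewrite in_itv/= => /andP[t1a t1b].
have Mt1 : 0 < M t1.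
  apply: (@lt_le_trans _ _ (M (t0 - de))); last by apply: t1max; rewrite in_itv/= lexx/=; lra.
  by rewrite divr_gt0 ?kp_gt0 ?pos//; lra.
have t10 : 0 < t1 by lra.
have kt1 := kp_gt0 al t10.
have t1t0 : t1 < t0.
  rewrite lt_neqAle t1b andbT; apply/eqP => e; move: Mt1; rewrite e /M ltNge => /negP; apply.
  by rewrite pmulr_lle0 ?invr_gt0.
have i0 := intg_conv t0 al0 al0 ck cr; have i1 := intg_conv t1 al0 al0 ck cr.
pose h s := kp al (t0 - s) * \1_(`]0, 2 * de[) (t0 - s).
have ih : intg setT h /\ RI setT h = (2 * de) `^ al / al.
  have h1 := intg_kpt (2 * de) al0.
  have e : h = (fun s => kp al (-1 * s + t0) * \1_(`]0, 2 * de[) (-1 * s + t0)).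
    by apply/funext => s; rewrite mulN1r addrC.
  split; first by rewrite e; apply: (intg_affine _ _ h1); rewrite oppr_eq0 oner_eq0.
  have := @RI_affine R (-1) t0 _ _ h1; rewrite -e oppr_eq0 oner_eq0 normrN normr1 mul1r => <- //.
  have [|_ <-] := @intg_powR R al (2 * de) al0; first lra.
  rewrite [RHS]RI_restrict; apply: RI_ext => s _; rewrite patchE indicE; case: ifPn => hs; last by rewrite mulr0.
  by move: hs; rewrite inE/= in_itv/= => /andP[hs _]; rewrite mulr1 kpE.
have key s : (kp al t0)^-1 * (kp al (t0 - s) * relax s) <=
   (kp al t1)^-1 * (kp al (t1 - s) * relax s) + M t1 * kp al (t0 / 2) / kp al t0 * h s.
  have h0 : 0 <= M t1 * kp al (t0 / 2) / kp al t0 * h s.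
    have hh : 0 <= h s by rewrite mulr_ge0 ?kp_ge0// indicE.
    by rewrite mulr_ge0// divr_ge0 ?kp_ge0// mulr_ge0 ?kp_ge0// ltW.
  have [s0|s0] := leP s 0.
    by case: cr => nr _ _; rewrite (nr _ s0) !mulr0 add0r.
  have [st0|st0] := leP t0 s.
    rewrite (@kp_neg _ al (t0 - s)) ?subr_le0// (@kp_neg _ al (t1 - s)); last by lra.
    by rewrite !mul0r !mulr0 add0r.
  have rs := pos s s0 st0.
  have [st1|st1] := ltP s t1.
    apply: (@le_trans _ _ ((kp al t1)^-1 * (kp al (t1 - s) * relax s))); last by rewrite lerDl.
    rewrite !mulrA; apply: ler_wpM2r; first exact: ltW.
    rewrite ler_pdivrMl// mulrCA ler_pdivlMl//.
    rewrite (kpE al t10) (kpE al t00) -(@kpM _ al _ _ t10) -(@kpM _ al _ _ t00); apply: kp_decr; first exact: ltW.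
      by rewrite mulr_gt0// subr_gt0.
    by rewrite !mulrBr [t1 * t0]mulrC lerD2l lerN2 ler_wpM2r// ltW.
  apply: (@le_trans _ _ (M t1 * kp al (t0 / 2) / kp al t0 * h s)); last first.
    by rewrite lerDr mulr_ge0 ?invr_ge0 ?kp_ge0// mulr_ge0 ?kp_ge0// ltW.
  have sde : 0 < t0 - s < 2 * de := short_gap st0 st1 t1a de0.
  rewrite /h indicE mem_set ?mulr1; last by rewrite /= in_itv/=.
  have Ms : relax s <= M t1 * kp al (t0 / 2).
    apply: (@le_trans _ _ (M s * kp al s)).
      by rewrite /M divfK// gt_eqF// kp_gt0.
    apply: ler_pM; [|exact: kp_ge0| |].
    - by rewrite divr_ge0 ?kp_ge0// ltW.
    - by apply: t1max; rewrite in_itv/= (ltW st0) andbT (le_trans t1a).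
    - have ht : 0 < t0 / 2 /\ t0 / 2 <= s := beyond_half t00 st1 t1a de1.
      by case: ht => ? ?; apply: kp_decr; [exact: ltW| |].
  rewrite (_ : M t1 * _ / _ * _ = (kp al t0)^-1 * (kp al (t0 - s) * (M t1 * kp al (t0 / 2)))); last by ring.
  by apply: ler_wpM2l; [rewrite invr_ge0 kp_ge0|apply: ler_wpM2l; [exact: kp_ge0|]].
have [ih1 ih2] := ih.
have j0 := intgZ (kp al t0)^-1 measurableT i0.
have j1 := intgZ (kp al t1)^-1 measurableT i1.
have j2 := intgZ (M t1 * kp al (t0 / 2) / kp al t0) measurableT ih1.
have := RI_le measurableT j0 (intgD measurableT j1 j2) (fun s _ => key s).
rewrite (RI_D measurableT j1 j2) (RI_Z _ measurableT i0) (RI_Z _ measurableT i1) (RI_Z _ measurableT ih1) ih2.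
rewrite -[X in _ * X <= _]/(conv (kp al) relax t0) -[X in _ <= _ * X + _]/(conv (kp al) relax t1) => I01.
have V0 := relax_volterra t0; have V1 := relax_volterra t1.
have M0 : M t0 = kap - m * kap * ((kp al t0)^-1 * conv (kp al) relax t0).
  by rewrite /M (_ : relax t0 = kap * kp al t0 - m * kap * conv (kp al) relax t0); [field; rewrite gt_eqF|rewrite -V0; ring].
have M1 : M t1 = kap - m * kap * ((kp al t1)^-1 * conv (kp al) relax t1).
  by rewrite /M (_ : relax t1 = kap * kp al t1 - m * kap * conv (kp al) relax t1); [field; rewrite gt_eqF|rewrite -V1; ring].
have M0n : M t0 <= 0 by rewrite /M pmulr_lle0 ?invr_gt0.
have small := Hd1 (2 * de) small0.
have mk : 0 < m * kap by rewrite mulr_gt0.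
have I01' := ler_wpM2l (ltW mk) I01.
have small' := ler_wpM2l (ltW Mt1) small.
have E : m * kap * (M t1 * kp al (t0 / 2) / kp al t0 * ((2 * de) `^ al / al)) = M t1 * (m * kap * P * (2 * de) `^ al).
  by rewrite /P; ring.
rewrite mulrDr E in I01'.
exact: maximum_contradiction M0 M1 M0n I01' small' Mt1.
Qed.

Lemma relax_ge0 t : 0 <= relax t.
Proof. by have [t0|t0] := ltP 0 t; [exact/ltW/relax_gt0|case: cr => ->]. Qed.

Lemma relax_le t : relax t <= kap * kp al t.
Proof.
have mk : 0 <= m * kap by rewrite ltW// mulr_gt0.
rewrite -relax_volterra lerDl mulr_ge0//.
by apply: Rintegral_ge0 => s _; rewrite mulr_ge0 ?kp_ge0 ?relax_ge0.
Qed.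

(** [drelax] solves the Volterra equation of [relax] with right-hand side
    [f = al * relax - kap * kp al], so [drelax = f - m * conv relax f], and [|f| <= kap * kp al]. *)
Lemma drelax_le t : `|drelax t| <= 2 * kap * kp al t.
Proof.
pose f s := al * relax s + (- kap) * kp al s.
have cf : causal al f by apply: causalD; apply: causalZ.
have cone : causal al (conv (kp al) relax).
  apply: (@causal_weaken R al (al + al)); [by rewrite lerDl ltW|exact: causal_conv].
have cone2 : causal al (conv (kp al) drelax).
  apply: (@causal_weaken R al (al + al)); [by rewrite lerDl ltW|exact: causal_conv].
have E1 : (fun s => drelax s + m * kap * conv (kp al) drelax s) = f.
  by apply/funext => s; rewrite drelax_volterra /f mulNr.
have E2 : (fun s => relax s + m * kap * conv (kp al) relax s) = (fun s => kap * kp al s).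
  by apply/funext => s; rewrite relax_volterra.
have fle s : `|f s| <= kap * kp al s.
  rewrite /f mulNr ler_norml; have := relax_le s; have := relax_ge0 s => h1 h2.
  have h3 : al * relax s <= relax s by rewrite -[leRHS]mul1r ler_wpM2r// ltW.
  have h4 : 0 <= al * relax s by rewrite mulr_ge0// ltW.
  by apply/andP; split; lra.
have C1 : conv relax f t = kap * conv (kp al) drelax t.
  rewrite -E1 (conv_Dr t al0 al0 cr cd (causalZ _ cone2)) (conv_Zr _ t al0 al0 cr cone2).
  rewrite -(convA t al0 al0 al0 cr ck cd kr kk kd).
  have -> : conv relax (kp al) = conv (kp al) relax by apply/funext => s; rewrite (convC s al0 al0 cr ck).
  rewrite -(conv_Zl _ t al0 al0 cone cd) -(conv_Dl t al0 al0 cr (causalZ _ cone) cd) E2.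
  by rewrite (conv_Zl _ t al0 al0 ck cd).
have E3 : drelax t = f t - m * conv relax f t by rewrite C1 -E1; ring.
have C2 : `|conv relax f t| <= kap * conv (kp al) relax t.
  rewrite (convC t al0 al0 ck cr) -(conv_Zr _ t al0 al0 cr ck) /conv.
  apply: RI_norm_le => //.
  - by apply: measurable_funM; [apply: meas_refl; case: cr|case: cf].
  - exact: (intg_conv t al0 al0 cr (causalZ _ ck)).
  - move=> s _; rewrite normrM ger0_norm ?relax_ge0//; apply: ler_wpM2l; [exact: relax_ge0|exact: fle].
have C3 := relax_volterra t; have C4 := relax_ge0 t; have C5 := fle t.
rewrite E3; apply: (le_trans (ler_normB _ _)); rewrite normrM gtr0_norm//.
have C6 := ler_wpM2l (ltW m0) C2.
lra.
Qed.

End relaxation.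

(** * The Caputo derivative at a maximum, and a single mode *)

Section caputo_ge0_at_max.
Context {R : realType}.
Implicit Types (s t : R).

Lemma conv_itv (a b : R -> R) t : (forall s, s <= 0 -> a s = 0) -> (forall s, s <= 0 -> b s = 0) ->
  conv a b t = RI `]0, t[ (fun s => a (t - s) * b s).
Proof.
move=> na nb; rewrite [RHS]RI_restrict; apply: RI_ext => s _; rewrite patchE; case: ifPn => // /negP h.
have [s0|s0] := leP s 0; first by rewrite nb ?mulr0.
rewrite na ?mul0r// subr_le0 leNgt; apply/negP => st; apply: h.
by rewrite inE/= in_itv/= s0 st.
Qed.

(** At a maximum over the past the Caputo derivative is nonnegative (Luchko).  With
    [P s = (t0 - s)^(-al) (f s - f t0)] one has [P' <= (t0 - s)^(-al) f'], and [P] tends to zero at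
    [t0] because of the Lipschitz condition, while it is nonpositive near [0]. *)
Lemma caputo_ge0_at_max (al t0 K d : R) (f df : R -> R) : 0 < al < 1 -> 0 < t0 -> 0 < d ->
  (forall s, 0 < s < t0 -> is_derive s 1 f (df s)) ->
  (forall s, 0 < s < t0 -> {for s, continuous df}) ->
  intg `]0, t0[ (fun s => (t0 - s) `^ (- al) * df s) ->
  (forall s, 0 < s < t0 -> f s <= f t0) ->
  (forall s, t0 - d < s < t0 -> f t0 - f s <= K * (t0 - s)) ->
  0 <= RI `]0, t0[ (fun s => (t0 - s) `^ (- al) * df s).
Proof.
move=> /andP[al0 al1] t00 d0 fd cdf ik fmax fK.
pose g s := (t0 - s) `^ (- al) * df s.
pose de n : R := t0 / n.+3%:R.
have de0 n : 0 < de n by rewrite divr_gt0.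
have de1 n : de n < t0 / 2.
  by rewrite ltr_pM2l// ltf_pV2 ?posrE// ltr_nat.
have dcv : de n @[n --> \oo] --> 0.
  rewrite -[X in _ --> X](mulr0 t0); apply: cvgM; first exact: cvg_cst.
  have := @cvg_harmonic R; rewrite -(cvg_shiftS (harmonic : nat -> R)) -(cvg_shiftS (fun n => harmonic n.+1 : R)).
  by apply: cvg_trans.
pose I n : set R := [set` `[de n, t0 - de n]].
have IS n : I n `<=` [set` `]0, t0[].
  move=> s; rewrite /I/= !in_itv/= => /andP[s1 s2]; have := de0 n => h; apply/andP; split; lra.
have mI n : measurable (I n) by exact: measurable_itv.
have lim : RI (I n) g @[n --> \oo] --> RI `]0, t0[ g.
  have e n : RI (I n) g = RI `]0, t0[ (fun s => g s * \1_(I n) s).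
    rewrite [LHS]RI_restrict [RHS]RI_restrict; apply: RI_ext => s _; rewrite !patchE indicE.
    case: ifPn => [h|/negPf h]; rewrite ?h.
      by rewrite mem_set ?mulr1//; apply: (IS n); apply/set_mem.
    by rewrite mulr0; case: ifP.
  rewrite (funext e).
  apply: (RI_dominated (h := fun s => `|g s|)); [exact: measurable_itv| | | |].
  - move=> n; apply: measurable_funM; first exact: (intg_meas _ ik).
    exact: measurable_indic.
  - move=> s; rewrite /= in_itv/= => /andP[s0 st].
    have sde : 0 < Num.min s (t0 - s) by rewrite lt_min s0 subr_gt0.
    move/cvgr0Pnorm_lt : dcv => /(_ _ sde) dn.
    apply: cvg_near_cst; move: dn; apply: filterS => n.
    rewrite gtr0_norm// lt_min => /andP[h1 h2].
    by rewrite indicE mem_set ?mulr1// /I/= in_itv/=; apply/andP; split; lra.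
  - move=> n s _; rewrite normrM ler_piMr// indicE; case: (_ \in _); rewrite ?normr0 ?normr1//.
  - by apply: intg_norm => //; exact: measurable_itv.
pose P s := (t0 - s) `^ (- al) * (f s - f t0).
have dP s : 0 < s < t0 -> is_derive s 1 P (al * (t0 - s) `^ (- al - 1) * (f s - f t0) + g s).
  move=> s0t; have st : 0 < t0 - s by case/andP: s0t => _ ?; rewrite subr_gt0.
  have d1 : is_derive s 1 (fun s => t0 - s) (-1).
    by apply: dv_eq (dvB (dv_cst t0 s) (dv_id s)) _; rewrite sub0r.
  have d2 := @dv_comp R (fun u => u `^ (- al)) (fun s => t0 - s) s _ _ (dv_powR (- al) st) d1.
  have d3 : is_derive s 1 (fun s => f s - f t0) (df s).
    by apply: dv_eq (dvB (fd s s0t) (dv_cst (f t0) s)) _; rewrite subr0.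
  by apply: dv_eq (dvM d2 d3) _; rewrite /g; ring.
(* integrate over the truncated interval; the boundary term at [0] has the right sign *)
have lower n : - K * de n `^ (1 - al) <= RI (I n) g \/ d <= de n.
  have [ded|ded] := ltP (de n) d; [left|by right].
  have ab : de n < t0 - de n by have := de1 n; lra.
  have inI s : de n <= s <= t0 - de n -> 0 < s < t0.
    by move=> /andP[h1 h2]; have := de0 n => h; apply/andP; split; lra.
  pose h s := al * (t0 - s) `^ (- al - 1) * (f s - f t0).
  have cts e s : 0 < s < t0 -> {for s, continuous (fun s => (t0 - s) `^ e)}.
    move=> /andP[_ st]; have st' : 0 < t0 - s by rewrite subr_gt0.
    apply: (@cont_comp _ (fun u => u `^ e)); first exact: cont_powR.
    by apply: cvgB; [exact: cvg_cst|exact: cvg_id].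
  have cf s : 0 < s < t0 -> {for s, continuous (fun s => f s - f t0)}.
    by move=> s0; apply: cvgB; [exact: (dv_cont (fd s s0))|exact: cvg_cst].
  have ch s : 0 < s < t0 -> {for s, continuous h}.
    by move=> s0; apply: cvgM; [apply: cvgM; [exact: cvg_cst|exact: cts]|exact: cf].
  have cg s : 0 < s < t0 -> {for s, continuous g}.
    by move=> s0; apply: cvgM; [exact: cts|exact: cdf].
  have [iP EP] := @continuous_FTC2R R (fun s => h s + g s) P (de n) (t0 - de n) ab
    (fun s si => cvgD (ch s (inI s si)) (cg s (inI s si))) (fun s si => dP s (inI s si)).
  have ig : intg (I n) g by apply: intgS ik => //; exact: measurable_itv.
  apply: (@le_trans _ _ (RI (I n) (fun s => h s + g s))); last first.
    apply: RI_le => // s; rewrite /I/= in_itv/= => sI.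
    rewrite gerDr /h mulr_ge0_le0//; first by rewrite mulr_ge0 ?powR_ge0// ltW.
    by rewrite subr_le0 fmax// inI.
  rewrite EP; apply: (@le_trans _ _ (P (t0 - de n))); last first.
    rewrite lerDl oppr_ge0 /P mulr_ge0_le0 ?powR_ge0// subr_le0 fmax//.
    by apply: inI; rewrite lexx ltW.
  have := fK (t0 - de n); rewrite subKr => H.
  have {}H : f t0 - f (t0 - de n) <= K * de n by apply: H; have := de0 n => h0; apply/andP; split; lra.
  rewrite /P subKr (_ : 1 - al = - al + 1); last by ring.
  rewrite powRD ?(gt_eqF (de0 n)) ?implybT// powRr1 ?(ltW (de0 n))//.
  rewrite (_ : - K * _ = de n `^ (- al) * (- (K * de n))); last by ring.
  by apply: ler_wpM2l; [exact: powR_ge0|lra].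
have lim2 : - K * de n `^ (1 - al) @[n --> \oo] --> - K * 0.
  apply: cvgM; first exact: cvg_cst.
  have h : 0 < 1 - al by lra.
  have /cvg_at_rightP := @powR_cvg0 R (1 - al) h; apply; split => //.
rewrite mulr0 in lim2.
apply: (ler_cvg_to lim2 lim).
move/cvgr0Pnorm_lt : dcv => /(_ _ d0); apply: filterS => n.
by rewrite gtr0_norm// => h; case: (lower n) => // ?; exfalso; lra.
Qed.

End caputo_ge0_at_max.

Section gamma.
Context {R : realType}.

(** The integral must be shown to converge, as it would be zero by convention otherwise. *)
Lemma Gamma_gt0 (s : R) : 0 < s <= 1 -> 0 < Gamma s.
Proof.
move=> /andP[s0 s1].
have cexp : continuous (fun t : R => expR (- t)).
  move=> t; apply: (@cont_comp _ expR); first exact: continuous_expR.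
  by apply: cvgN; exact: cvg_id.
have iexp : intg `[1, +oo[ (fun t : R => expR (- t)).
  apply/integrableP; split.
    by apply/measurable_EFinP; apply: measurable_funTS; exact: continuous_measurable_fun.
  rewrite (_ : (\int[_]_(x in _) _)%E = (\int[leb]_(t in `[1%R, +oo[) (expR (- t))%:E)%E); last first.
    by apply: eq_integral => t _; rewrite /= ger0_norm ?expR_ge0.
  have dF (x : R) : is_derive x 1 (fun t : R => - expR (- t)) (expR (- x)).
    by apply: dv_eq (dvN (dv_comp (is_derive_expR _) (dvN (dv_id x)))) _; rewrite mulrN1 opprK.
  rewrite (@ge0_continuous_FTC2y R (fun t => expR (- t)) (fun t => - expR (- t)) 1 0) ?ltry//.
  - exact: continuous_subspaceT.
  - by rewrite -oppr0; apply: cvgN; exact: cvgr_expR.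
  - by apply: cvg_at_right_filter; exact: dv_cont (dF 1).
  - by move=> x _; exact: dv1.
have mI : measurable ([set` `]0, +oo[] : set R) by exact: measurable_itv.
have i1 : intg `]0, +oo[ (fun t => kp s t * \1_(`]0, 1[) t) by apply: (intgS _ _ _ (intg_kpt 1 s0)).
have i2 : intg `]0, +oo[ ((fun t : R => expR (- t)) \_ `[1, +oo[).
  by apply: (intgS (D := setT)) => //; apply/(intg_restrict _ _).1 => //; exact: measurable_itv.
have mf : measurable_fun ([set` `]0, +oo[] : set R) (fun t : R => t `^ (s - 1) * expR (- t)).
  apply: measurable_funTS; apply: measurable_funM; first exact: measurable_powR.
  exact: continuous_measurable_fun.
have i3 : intg `]0, +oo[ (fun t : R => t `^ (s - 1) * expR (- t)).
  apply: (intg_le mI mf _ (intgD mI i1 i2)) => t; rewrite /= in_itv/= andbT => t0.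
  rewrite ger0_norm ?mulr_ge0 ?powR_ge0 ?expR_ge0// patchE indicE !mem_setE /= !in_itv/= t0 andbT /=.
  have [t1|t1] := ltP t 1; rewrite /= ?mulr1 ?mulr0 ?add0r.
    by apply: ler_wpDr => //; rewrite kpE// ler_piMr ?powR_ge0// -expR0 ler_expR oppr_le0 ltW.
  by rewrite ler_piMl ?expR_ge0// -kpE// (le_trans (kp_decr _ _ t1))// kpE// powR1.
have [p1 p2] := intg_powR s0 (@ltr01 R).
have e1 : RI `]0, +oo[ (fun t => kp s t * \1_(`]0, 1[) t) = 1 / s.
  rewrite powR1 in p2; rewrite -p2 [LHS]RI_restrict [RHS]RI_restrict; apply: RI_ext => t _.
  rewrite !patchE indicE !mem_setE /= !in_itv/= andbT.
  have [t0|t0] := ltP 0 t => //=; case: ifP => h; rewrite ?mulr0// mulr1 kpE//.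
apply: (@lt_le_trans _ _ (expR (-1) * (1 / s))); first by rewrite mulr_gt0 ?expR_gt0// divr_gt0.
rewrite -e1 -(RI_Z _ mI i1); apply: (RI_le mI (intgZ _ mI i1) i3) => t.
rewrite /= in_itv/= andbT => t0; rewrite indicE mem_setE /= in_itv/= t0 /=.
have [t1|_] := ltP t 1; last by rewrite !mulr0 mulr_ge0 ?powR_ge0 ?expR_ge0.
rewrite mulr1 mulrC kpE//; by apply: ler_wpM2l; [exact: powR_ge0|rewrite ler_expR lerN2 ltW].
Qed.

End gamma.

Section mode.
Context {R : realType}.
Variables (al Ga m A g0 sg : R) (b b1 : R -> R).
Hypotheses (al01 : 0 < al < 1) (Ga0 : 0 < Ga) (m0 : 0 < m).
Hypotheses (cb : causal 1 b) (cb1 : causal 1 b1).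
Hypothesis db : forall s : R, 0 < s -> is_derive s 1 b (b1 s / s).
Hypotheses (bA : forall s : R, `|b s| <= A) (b1A : forall s : R, `|b1 s| <= A).
Implicit Types (s t : R).

Let al0 : 0 < al. Proof. by case/andP: al01. Qed.
Let al1 : al < 1. Proof. by case/andP: al01. Qed.
Let al10 : 0 < 1 - al. Proof. by rewrite subr_gt0. Qed.
Let one0 : (0 : R) < 1. Proof. exact: ltr01. Qed.
Let kb : cont_pos b. Proof. by move=> t t0; exact: dv_cont (db t0). Qed.

(** The constant making [kp (1 - al) / Ga] and [kap * kp al] convolve to [1]. *)
Definition kap : R := Ga / conv (kp (1 - al)) (kp al) 1.

Let beta0 : 0 < conv (kp (1 - al)) (kp al) 1.
Proof.
rewrite (conv_scale al10 al0 (causal_kp _) (causal_kp _) one0) mul1r.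
have [i1 e1] := intg_powR al0 (@ltr01 R).
apply: (@lt_le_trans _ _ (RI `]0, 1[ (fun r => r `^ (al - 1)))).
  by rewrite e1 divr_gt0// powR_gt0.
apply: RI_le => //; first exact: (intg_scale al10 al0 (causal_kp _) (causal_kp _) one0).
move=> r; rewrite /= in_itv/= => /andP[r0 r1]; rewrite !mul1r (kpE _ r0) ler_peMl ?powR_ge0//.
have e2 : kp (1 - al) 1 = 1 by rewrite kpE// powR1.
rewrite -[leLHS]e2; apply: kp_decr; rewrite ?subr_gt0//.
- by rewrite gerBl ltW.
- by rewrite gerBl ltW.
Qed.

Lemma kap_gt0 : 0 < kap. Proof. by rewrite divr_gt0. Qed.
Let kap0 := kap_gt0.

Let w := relax al kap m.
Let y := drelax al kap m.
Let cw : causal al w. Proof. exact: causal_relax. Qed.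
Let cy : causal al y. Proof. exact: causal_drelax. Qed.
Let kw : cont_pos w. Proof. exact: cont_relax. Qed.
Let cka : causal al (kp al). Proof. exact: causal_kp. Qed.
Let kka : cont_pos (kp al). Proof. exact: kp_cont. Qed.
Let ckb : causal (1 - al) (kp (1 - al)). Proof. exact: causal_kp. Qed.
Let kkb : cont_pos (kp (1 - al)). Proof. exact: kp_cont. Qed.
Let ck1 : causal 1 (@kp R 1). Proof. exact: causal_kp. Qed.
Let kk1 : cont_pos (@kp R 1). Proof. exact: kp_cont. Qed.

(** The right-hand side [source - m * mode] of the scalar equation at time zero. *)
Definition mc : R := g0 - m * sg.

(** The solution of the scalar equation is found through its derivative: the Caputo equation
    for [mode] is a Volterra equation for [mode_dt], solved by means of the resolvent [relax].  Here
    [g0] is the initial value of the source and [b] its derivative, and [sg] is the initial value of the mode. *)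
Definition mode_dt t : R := mc * w t + conv w b t.
Definition mode t : R := sg + conv (kp 1) mode_dt t.
Definition mode_dtt t : R := (mc * y t + (conv w b t + conv y b t + conv w b1 t)) / t.
Definition mode_src t : R := g0 + conv (kp 1) b t.

Let cwb : causal al (conv w b).
Proof. by apply: (@causal_weaken R al (al + 1)); [rewrite lerDl|exact: causal_conv]. Qed.

Let kwb : cont_pos (conv w b).
Proof. exact: (conv_cont al0 one0). Qed.

Let cD : causal al mode_dt.
Proof. by apply: causalD => //; exact: causalZ. Qed.

Let kD : cont_pos mode_dt.
Proof. by move=> t t0; apply: cvgD; [apply: cvgM; [exact: cvg_cst|exact: kw]|exact: kwb]. Qed.

Lemma mode_derive t : 0 < t -> is_derive t 1 mode (mode_dt t).
Proof.
move=> t0; apply: dv_eq (dvD (dv_cst sg t) (conv1_derive al0 cD kD t0)) _.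
by rewrite add0r.
Qed.

Lemma mode_dt_derive t : 0 < t -> is_derive t 1 mode_dt (mode_dtt t).
Proof.
move=> t0; have d1 : is_derive t 1 w (y t / t) by exact: relax_derive.
have d2 : is_derive t 1 (conv w b) ((conv w b t + conv y b t + conv w b1 t) / t).
  by apply: (conv_derive al0 one0) => // s s0; exact: relax_derive.
by apply: dv_eq (dvD (dvZ mc d1) d2) _; rewrite /mode_dtt; ring.
Qed.

Lemma mode_le0 t : t <= 0 -> mode t = sg.
Proof.
move=> t0; rewrite /mode conv_neg ?addr0//; first exact: kp_neg.
by case: cD.
Qed.

Lemma mode_src_derive t : 0 < t -> is_derive t 1 mode_src (b t).
Proof.
move=> t0; apply: dv_eq (dvD (dv_cst g0 t) (conv1_derive one0 cb kb t0)) _.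
by rewrite add0r.
Qed.

Let A0 : 0 <= A. Proof. exact: le_trans (normr_ge0 _) (bA 0). Qed.

Let conv_wb_le (a d : R -> R) (B : R) t : 0 <= B -> causal al a -> causal 1 d ->
  (forall s, `|a s| <= B * kp al s) -> (forall s, `|d s| <= A) ->
  `|conv a d t| <= B * A * conv (kp al) (kp 1) t.
Proof.
move=> B0 ca cd ha hd; apply: (conv_norm_le al0 one0 ca cd) => // s _.
have [s0|s0] := leP s 0; first by case: cd => ->//; rewrite normr0 mulr_ge0 ?kp_ge0.
by rewrite kpE// subrr powRr0 mulr1.
Qed.

Let wle s : `|w s| <= kap * kp al s.
Proof. by rewrite ger0_norm; [exact: relax_le|exact: relax_ge0]. Qed.

Let kp1_le t : conv (kp al) (kp 1) t = conv (kp al) (kp 1) 1 * kp (al + 1) t.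
Proof.
have [t0|t0] := ltP 0 t; first by rewrite conv_kpE// kpE// mulrC.
by rewrite conv_neg ?kp_neg ?mulr0// => s s0; rewrite kp_neg.
Qed.

Let B1 : R := conv (kp al) (kp 1) 1.
Let B10 : 0 <= B1.
Proof. by apply: Rintegral_ge0 => s _; rewrite mulr_ge0 ?kp_ge0. Qed.

Lemma mode_dt_le t : 0 < t -> `|mode_dt t| <= kap * (`|mc| + A * B1 * t) * t `^ (al - 1).
Proof.
move=> t0; rewrite /mode_dt; apply: (le_trans (ler_normD _ _)).
have h1 := conv_wb_le t (ltW kap0) cw cb wle bA.
have h2 := wle t; rewrite (kpE _ t0) in h2.
rewrite kp1_le kpE// (_ : al + 1 - 1 = 1 + (al - 1)) in h1; last by ring.
rewrite powRD ?(gt_eqF t0) ?implybT// powRr1 ?(ltW t0)// in h1.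
rewrite normrM; have h3 := ler_wpM2l (normr_ge0 mc) h2.
rewrite (_ : kap * _ * _ = `|mc| * (kap * t `^ (al - 1)) + kap * A * (B1 * (t * t `^ (al - 1)))); last by ring.
exact: lerD.
Qed.

Lemma mode_dtt_le t : 0 < t -> `|mode_dtt t| <= 4 * kap * (`|mc| + A * B1 * t) * t `^ (al - 2).
Proof.
move=> t0; have h1 := conv_wb_le t (ltW kap0) cw cb wle bA.
have h1' := conv_wb_le t (ltW kap0) cw cb1 wle b1A.
have yle s : `|y s| <= 2 * kap * kp al s by exact: drelax_le.
have kap20 : 0 <= 2 * kap by rewrite mulr_ge0// ltW.
have h2 := conv_wb_le t kap20 cy cb yle bA.
have h3 := yle t; rewrite (kpE _ t0) in h3; have {}h3 := ler_wpM2l (normr_ge0 mc) h3.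
rewrite kp1_le kpE// (_ : al + 1 - 1 = 1 + (al - 1)) in h1 h1' h2; last by ring.
rewrite powRD ?(gt_eqF t0) ?implybT// powRr1 ?(ltW t0)// in h1 h1' h2.
have e : t `^ (al - 2) = t `^ (al - 1) / t.
  rewrite (_ : al - 2 = al - 1 - 1); last by ring.
  by rewrite [LHS]powRB ?(gt_eqF t0) ?implybT// powRr1 ?ltW.
rewrite e /mode_dtt normrM normfV (gtr0_norm t0) mulrA; apply: ler_wpM2r; first by rewrite invr_ge0 ltW.
apply: (le_trans (ler_normD _ _)); rewrite normrM.
have h4 := ler_normD (conv w b t + conv y b t) (conv w b1 t).
have h5 := ler_normD (conv w b t) (conv y b t).
rewrite -/B1 in h1 h1' h2.
set p := t `^ (al - 1) in h1 h1' h2 h3 *; have p0 : 0 <= p by exact: powR_ge0.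
have q0 : 0 <= `|mc| * kap * p by rewrite mulr_ge0// mulr_ge0// ltW.
rewrite (_ : 4 * kap * _ * _ = 4 * (`|mc| * kap * p) + 4 * (kap * A * (B1 * (t * p)))); last by ring.
rewrite (_ : 2 * kap * A * _ = 2 * (kap * A * (B1 * (t * p)))) in h2; last by ring.
rewrite (_ : `|mc| * (2 * kap * p) = 2 * (`|mc| * kap * p)) in h3; last by ring.
lra.
Qed.

(** Convolution of [relax] with the Caputo kernel: the kernels [kp (1 - al)] and [kp al] convolve to a
    constant, so that the Volterra equation of [relax] can be integrated. *)
Let RE : conv (kp (1 - al)) w = (fun t => Ga * (kp 1 t + (- m) * conv (kp 1) w t)).
Proof.
apply/funext => t.
have cone : causal al (conv (kp al) w).
  by apply: (@causal_weaken R al (al + al)); [rewrite lerDl ltW|exact: causal_conv].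
have E : w = (fun s => kap * kp al s + - (m * kap) * conv (kp al) w s).
  by apply/funext => s; rewrite -(relax_volterra al01 kap0 m0 s); rewrite /w; ring.
have K1 s : conv (kp (1 - al)) (kp al) s = conv (kp (1 - al)) (kp al) 1 * kp 1 s.
  have [s0|s0] := ltP 0 s; first by rewrite (conv_kpE al10 al0 s0) mulrC kpE// subrK.
  by rewrite (conv_neg _ _ s0) ?kp_neg ?mulr0// => u u0; rewrite kp_neg.
rewrite {1}E (conv_Dr t al10 al0 ckb (causalZ _ cka) (causalZ _ cone)).
rewrite (conv_Zr _ t al10 al0 ckb cka) (conv_Zr _ t al10 al0 ckb cone).
rewrite -(convA t al10 al0 al0 ckb cka cw kkb kka kw) (funext K1).
rewrite (conv_Zl _ t one0 al0 ck1 cw) /kap.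
set c := conv (kp (1 - al)) (kp al) 1; have c0 : c != 0 := lt0r_neq0 beta0.
by move: c0 (kp 1 t) (conv (kp 1) w t) => c0 u z; field.
Qed.

Lemma mode_caputo t : 0 < t ->
  RI `]0, t[ (fun s => (t - s) `^ (- al) * mode_dt s) = Ga * (mode_src t - m * mode t).
Proof.
move=> t0; transitivity (conv (kp (1 - al)) mode_dt t).
  rewrite conv_itv; [|exact: kp_neg|by case: cD].
  apply: RI_ext => s; rewrite /= in_itv/= => /andP[_ st]; rewrite kpE ?subr_gt0//.
  by congr (_ `^ _ * _); ring.
have c1w : causal 1 (conv (kp 1) w).
  by apply: (@causal_weaken R 1 (1 + al)); [rewrite lerDl ltW|exact: causal_conv].
rewrite (conv_Dr t al10 al0 ckb (causalZ _ cw) cwb) (conv_Zr _ t al10 al0 ckb cw).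
rewrite -(convA t al10 al0 one0 ckb cw cb kkb kw kb) RE.
rewrite (conv_Zl _ t one0 one0 (causalD ck1 (causalZ _ c1w)) cb).
rewrite (conv_Dl t one0 one0 ck1 (causalZ _ c1w) cb) (conv_Zl _ t one0 one0 c1w cb).
rewrite (convA t one0 al0 one0 ck1 cw cb kk1 kw kb).
rewrite /mode_src /mode (conv_Dr t one0 al0 ck1 (causalZ _ cw) cwb) (conv_Zr _ t one0 al0 ck1 cw).
rewrite (kpE _ t0) subrr powRr0 /mc; ring.
Qed.

Lemma mode_caputo_intg t : 0 < t -> intg `]0, t[ (fun s => (t - s) `^ (- al) * mode_dt s).
Proof.
move=> t0; have := intg_conv t al10 al0 ckb cD.
move=> /(intgS measurableT (measurable_itv `]0, t[) (@subsetT _ _)); apply: intg_ext => //= s.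
rewrite in_itv/= => /andP[_ st]; rewrite kpE ?subr_gt0//; by congr (_ `^ _ * _); ring.
Qed.

Lemma mode_dt_cont : cont_pos mode_dt. Proof. exact: kD. Qed.

Lemma mode_cont t : {for t, continuous mode}.
Proof.
have [t0|t0] := ltP 0 t; first exact: dv_cont (mode_derive t0).
have near1 : \forall s \near t, s <= 1.
  have t1 : t < 1 by lra.
  by have := near_lt t1; apply: filterS => s /ltW.
have [C C0 HC] := causal_le 1 (causal_conv one0 al0 ck1 cD kk1 kD).
suff : mode s @[s --> t] --> mode t by [].
rewrite (mode_le0 t0) -[X in _ --> X]addr0; apply: cvgD; first exact: cvg_cst.
apply/cvgr0Pnorm_le => e e0; have [d d0 Hd] := @near0_powR R al al01 C e e0.
have nd : \forall s \near t, s < d by apply: near_lt; lra.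
move: near1 nd; apply: filterS2 => s s1 sd.
apply: (le_trans (HC s s1)); have [s0|s0] := leP s 0; first by rewrite kp_neg// mulr0 ltW.
rewrite kpE// (_ : 1 + al - 1 = al); last by ring.
by apply: Hd; rewrite s0 ltW.
Qed.

End mode.

(** * Differentiation off a null set *)

Section null_sets.
Context {R : realType}.
Implicit Types (x y z : R) (E : set R).

Lemma dv_local (f : R -> R) x d (e : R) : is_derive x 1 f d -> 0 < e ->
  exists2 r : R, 0 < r & forall y, `|y - x| < r -> `|f y - f x - d * (y - x)| <= e * `|y - x|.
Proof.
move=> fd e0; have := dv_cvg fd => /cvgrPdist_le /(_ _ e0).
move=> /nbhs_ballP[r /= r0 Hr]; exists r => // y yr.
have [->|yx] := eqVneq y x; first by rewrite !subrr mulr0 subrr normr0 mulr0.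
have yx0 : y - x != 0 by rewrite subr_eq0.
have := Hr (y - x); rewrite /ball/= sub0r normrN => /(_ yr yx0).
rewrite [x + _]addrC subrK (_ : f y - f x - d * (y - x) = - ((d - (f y - f x) / (y - x)) * (y - x))); last by field.
by rewrite normrN normrM => h; apply: ler_wpM2r.
Qed.

(** The measures of the pieces [U n `&` ]-oo, y]] of a sequence of open sets shrinking to the
    null set add up to a bounded function of [y] with infinite slope at each point of the set. *)
Lemma steep_function E : lebesgue_measure.-negligible E ->
  exists h : R -> R, [/\ {homo h : y z / y <= z}, forall y, 0 <= h y <= 2 &
    forall x, E x -> forall N : nat, exists2 d : R, 0 < d &
      forall y z, x - d < y -> y <= z -> z < x + d -> N%:R * (z - y) <= h z - h y].
Proof.
move=> /negligible_outer_measure E0.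
have p0 n : 0 < 2^-1 ^+ n :> R by rewrite exprn_gt0.
have /choice[U HU] : forall n, exists U : set R, [/\ open U, E `<=` U & (leb U <= (2^-1 ^+ n)%:E)%E].
  move=> n; have [U [oU EU UE]] := outer_measure_open_le E (p0 n).
  by exists U; split => //; rewrite E0 add0e in UE.
have mU n : @measurable _ (measurableTypeR R) (U n) by apply: open_measurable; have [] := HU n.
have mI y : @measurable _ (measurableTypeR R) [set` `]-oo, y]] by exact: measurable_itv.
have mUI n y : @measurable _ (measurableTypeR R) (U n `&` `]-oo, y]) by exact: measurableI.
pose m n y := fine (leb (U n `&` `]-oo, y])).
have le n y : (leb (U n `&` `]-oo, y]) <= (2^-1 ^+ n)%:E)%E.
  have [_ _ H] := HU n; apply: le_trans H; apply: le_measure; rewrite ?inE; [exact: mUI|exact: mU|exact: subIsetl].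
have fin n y : leb (U n `&` `]-oo, y]) \is a fin_num.
  by rewrite ge0_fin_numE// (le_lt_trans (le n y))// ltry.
have m0 n y : 0 <= m n y by exact: fine_ge0.
have mle n y : m n y <= 2^-1 ^+ n by rewrite -lee_fin fineK.
have mmono n y z : y <= z -> m n y <= m n z.
  move=> yz; rewrite /m fine_le//; apply: le_measure; rewrite ?inE; [exact: mUI|exact: mUI|].
  by apply: setIS => s /=; rewrite !in_itv/= => /le_trans; apply.
have sg : summable (fun n => 2^-1 ^+ n : R).
  apply: ratio_test; apply: nearW => n; rewrite exprS normrM ger0_norm//.
have sm y : summable (fun n => m n y) by apply: summable_le sg => n; rewrite ger0_norm.
have sd y z : summable (fun n => m n z - m n y) by exact: summableB.
exists (fun y => sumr (fun n => m n y)); split.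
- by move=> y z yz; apply: sumr_le => // n; exact: mmono.
- move=> y; apply/andP; split.
    by have := @series_le_sumr R (fun n => m n y) 0 (fun n => m0 n y) (sm y); rewrite /series/= big_geq.
  apply: (le_trans (sumr_le (sm y) sg (fun n => mle n y))).
  apply: limr_le => //; apply: nearW => n; rewrite /series/=.
  suff -> : \sum_(0 <= k < n) (2^-1 : R) ^+ k = 2 - 2 * 2^-1 ^+ n by rewrite gerBl mulr_ge0// ltW.
  elim: n => [|n IH]; first by rewrite big_geq// expr0 mulr1 subrr.
  by rewrite big_nat_recr//= IH exprS; field.
- move=> x Ex N.
  have [d d0 Hd] : exists2 d : R, 0 < d & forall n, (n < N)%N -> forall y, `|y - x| < d -> U n y.
    elim: N => [|N [d d0 IH]]; first by exists 1.
    have [oU EU _] := HU N; have /nbhs_ballP[d' /= d'0 Hd'] : nbhs x (U N) by apply: open_nbhs_nbhs; split => //; exact: EU.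
    exists (Num.min d d'); first by rewrite lt_min d0 d'0.
    move=> n; rewrite ltnS leq_eqVlt => /orP[/eqP ->|nN] y; rewrite lt_min => /andP[y1 y2]; last exact: IH.
    by apply: Hd'; rewrite /ball/= distrC.
  exists d => // y z xy yz zx.
  rewrite -sumr_sub//; apply: (@le_trans _ _ (series (fun n => m n z - m n y) N)); last first.
    by apply: series_le_sumr => // n; rewrite subr_ge0 mmono.
  rewrite /series/= mulr_natl -[X in _ *+ X]subn0 -sumr_const_nat.
  apply: ler_sum_nat => n /andP[_ nN].
  have mK y' : (m n y')%:E = leb (U n `&` `]-oo, y']) by exact: fineK.
  rewrite lerBrDl -lee_fin EFinD !mK.
  have yz' : (z - y)%:E = leb (`]y, z] : set R).
    rewrite lebesgue_measure_itv/= lte_fin; case: ltP => //.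
    by move=> zy; rewrite (_ : z = y) ?subrr//; apply/eqP; rewrite eq_le zy.
  rewrite yz' -measureU; last 3 first.
  - exact: mUI.
  - exact: measurable_itv.
  - rewrite -subset0 => s [[_ /=]]; rewrite !in_itv/= => sy /andP[ys _].
    by have := lt_le_trans ys sy; rewrite ltxx.
  apply: le_measure; rewrite ?inE; [by apply: measurableU; [exact: mUI|exact: measurable_itv]|exact: mUI|].
  move=> s [[Us /=]|/=]; rewrite !in_itv/= => H; split => //=; rewrite ?in_itv/=.
  + exact: le_trans yz.
  + by move: H => /andP[ys sz]; apply: (Hd n nN); rewrite ltr_norml; apply/andP; split; lra.
  + by case/andP: H.
Qed.

(** A supremum argument; unlike with a sign condition on the derivative, an infinite slope is permitted. *)
Lemma locally_increasing (F : R -> R) a b : a <= b ->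
  (forall x, a <= x <= b -> exists2 d : R, 0 < d &
    forall y, a <= y <= b -> (x - d < y -> y <= x -> F y <= F x) /\ (x <= y -> y < x + d -> F x <= F y)) ->
  F a <= F b.
Proof.
move=> ab HF.
pose S : set R := [set t | a <= t <= b /\ forall s, a <= s <= t -> F a <= F s].
have Sa : S a by split; [rewrite lexx|move=> s /le_anti <-].
have hs : has_sup S by split; [exists a|exists b => t [/andP[]]].
set c := sup S.
have ac : a <= c by apply: ub_le_sup => //; case: hs.
have cb : c <= b by apply: ge_sup; [exists a|move=> t [/andP[]]].
have cab : a <= c <= b by rewrite ac.
have [d d0 Hd] := HF c cab.
have below s : a <= s -> s < c -> F a <= F s.
  move=> as_ sc; have [t St st] := sup_gt (proj1 hs) sc.
  by case: St => _; apply; rewrite as_ ltW.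
have Fc : F a <= F c.
  have [->//|ac'] := eqVneq a c; have {}ac' : a < c by rewrite lt_neqAle ac'.
  pose s := Num.max a (c - d / 2).
  have sc : s < c by rewrite gt_max ac'/=; lra.
  have as_ : a <= s by rewrite le_max lexx.
  apply: (le_trans (below s as_ sc)); apply: (Hd s _).1; last exact: ltW.
    by rewrite as_ (le_trans (ltW sc)).
  by rewrite lt_max; apply/orP; right; lra.
have [->//|cb'] := eqVneq b c.
have {}cb' : c < b by rewrite lt_neqAle eq_sym cb'.
pose t := Num.min b (c + d / 2).
have ct : c < t by rewrite lt_min cb'/=; lra.
have tb : t <= b by rewrite ge_min lexx.
suff St : S t by have := ub_le_sup (proj2 hs) St; rewrite -/c leNgt ct.
split; first by rewrite tb (le_trans ac (ltW ct)).
move=> s /andP[as_ st]; have [sc|cs] := ltP s c; first exact: below.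
apply: (le_trans Fc); apply: (Hd s _).2 => //; first by rewrite as_ (le_trans st).
by apply: (le_lt_trans st); rewrite gt_min; apply/orP; right; lra.
Qed.

(** A derivative that exists everywhere and is bounded off a null set is bounded: adding a
    small multiple of a steep function makes [M y - f y] locally increasing at every point. *)
Lemma derivative_bound_ae E (f df : R -> R) a b M : lebesgue_measure.-negligible E ->
  (forall x, a <= x <= b -> is_derive x 1 f (df x)) ->
  (forall x, a <= x <= b -> ~ E x -> df x <= M) -> a <= b -> f b - f a <= M * (b - a).
Proof.
move=> E0 fd dM ab; have [h [hm hb hE]] := steep_function E0.
have key e : 0 < e -> f b - f a <= M * (b - a) + e * (b - a + 2).
  move=> e0; pose F y := (M + e) * y - f y + e * h y.
  suff : F a <= F b.
    rewrite /F; have /andP[h1 h2] := hb a; have /andP[h3 h4] := hb b.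
    have : e * h b <= e * (h a + 2) by rewrite ler_pM2l//; lra.
    lra.
  apply: locally_increasing => // x xab.
  have [Ex|nEx] := pselect (E x).
    pose N := (truncn (`|df x - M| / e)).+1.
    have HN : df x - M <= e * N%:R.
      apply: (le_trans (ler_norm _)); rewrite -ler_pdivrMl// mulrC; apply: ltW.
      by rewrite truncnS_gt.
    have [d d0 Hd] := hE x Ex N; have [r r0 Hr] := dv_local (fd x xab) e0.
    exists (Num.min d r); first by rewrite lt_min d0.
    move=> y _; split => h1 h2.
      have {h1}[h1 h1'] : x - d < y /\ x - r < y.
        by split; apply: le_lt_trans h1; rewrite lerD2l lerN2 ge_min lexx ?orbT.
      have := Hd y x h1 h2 _; rewrite ltrDl => /(_ d0) H.
      have := Hr y; rewrite ler0_norm ?subr_le0// opprB => /(_ _) H'.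
      have {}H' := H' _; rewrite ler_norml in H'.
      have /andP[H1 H2] : - (e * (x - y)) <= f y - f x - df x * (y - x) <= e * (x - y) by apply: H'; lra.
      have H3 : (df x - M) * (x - y) <= e * N%:R * (x - y) by apply: ler_wpM2r => //; rewrite subr_ge0.
      have H4 : e * (N%:R * (x - y)) <= e * (h x - h y) by rewrite ler_pM2l.
      rewrite /F; lra.
    have {h2}[h2 h2'] : y < x + d /\ y < x + r.
      by split; apply: (lt_le_trans h2); rewrite lerD2l ge_min lexx ?orbT.
    have := Hd x y _ h1 h2; rewrite ltrBlDr ltrDl => /(_ d0) H.
    have := Hr y; rewrite ger0_norm ?subr_ge0// => H'; rewrite ler_norml in H'.
    have /andP[H1 H2] : - (e * (y - x)) <= f y - f x - df x * (y - x) <= e * (y - x) by apply: H'; lra.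
    have H3 : (df x - M) * (y - x) <= e * N%:R * (y - x) by apply: ler_wpM2r => //; rewrite subr_ge0.
    have H4 : e * (N%:R * (y - x)) <= e * (h y - h x) by rewrite ler_pM2l.
    rewrite /F; lra.
  have [r r0 Hr] := dv_local (fd x xab) e0; have dx := dM x xab nEx.
  exists r => // y _; split => h1 h2.
    have := Hr y; rewrite ler0_norm ?subr_le0// opprB => H'; rewrite ler_norml in H'.
    have /andP[H1 H2] : - (e * (x - y)) <= f y - f x - df x * (y - x) <= e * (x - y) by apply: H'; lra.
    have H3 : df x * (x - y) <= M * (x - y) by apply: ler_wpM2r => //; rewrite subr_ge0.
    have H4 : e * h y <= e * h x by rewrite ler_pM2l// hm.
    rewrite /F; lra.
  have := Hr y; rewrite ger0_norm ?subr_ge0// => H'; rewrite ler_norml in H'.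
  have /andP[H1 H2] : - (e * (y - x)) <= f y - f x - df x * (y - x) <= e * (y - x) by apply: H'; lra.
  have H3 : df x * (y - x) <= M * (y - x) by apply: ler_wpM2r => //; rewrite subr_ge0.
  have H4 : e * h x <= e * h y by rewrite ler_pM2l// hm.
  rewrite /F; lra.
apply/ler_addgt0Pr => e e0; have c0 : 0 < b - a + 2 by lra.
have := key (e / (b - a + 2)); rewrite divr_gt0// => /(_ isT).
by rewrite divfK// gt_eqF.
Qed.

Lemma lipschitz_ae E (f df : R -> R) a b M : lebesgue_measure.-negligible E ->
  (forall x, a <= x <= b -> is_derive x 1 f (df x)) ->
  (forall x, a <= x <= b -> ~ E x -> `|df x| <= M) -> a <= b -> `|f b - f a| <= M * (b - a).
Proof.
move=> E0 fd dM ab; rewrite ler_norml; apply/andP; split.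
  rewrite lerNl opprB (_ : f a - f b = (- f b) - (- f a)); last by ring.
  apply: (@derivative_bound_ae E (fun x => - f x) (fun x => - df x)) => // x xab; first exact: dvN (fd x xab).
  by move=> nE; have := dM x xab nE; rewrite ler_norml lerNl => /andP[].
apply: (@derivative_bound_ae E f df) => // x xab nE.
exact: le_trans (ler_norm _) (dM x xab nE).
Qed.

End null_sets.

(** * The maximum principle *)

Section barrier.
Context {R : realType}.
Implicit Types (x y z t : R) (E : set R).

(** A primitive of a steep function: convex, with infinite second derivative on the null set. *)
Lemma barrier E a b : lebesgue_measure.-negligible E -> a <= b ->
  exists H : R -> R, [/\ continuous H, forall x, a <= x <= b -> 0 <= H x <= 2 * (b - a) &
    forall x, a < x -> forall N : nat, N = 0%N \/ E x -> exists2 r : R, 0 < r &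
      forall t, 0 < t < r -> N%:R * t ^+ 2 <= H (x + t) + H (x - t) - 2 * H x].
Proof.
move=> E0 ab; have [h [hm hb hE]] := steep_function E0.
pose H0 x := RI `[a, x] h.
have ih y z : intg `[y, z] h.
  apply: (@intg_le R _ _ (fun=> 2)); [exact: measurable_itv| | |].
  - exact: nondecreasing_measurable.
  - by move=> s _; have /andP[h1 h2] := hb s; rewrite ger0_norm.
  - apply: intg_cst; first exact: measurable_itv.
    rewrite lebesgue_measure_itv/=; case: ifP => _; rewrite ?ltry//.
have ic c y z : intg `]y, z] (fun=> c).
  by apply: intg_cst; [exact: measurable_itv|rewrite lebesgue_measure_itv/=; case: ifP => _; rewrite ?ltry].
have Ic c y z : y <= z -> RI `]y, z] (fun=> c) = c * (z - y).
  move=> yz; rewrite Rintegral_cst; last exact: measurable_itv.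
  have lm : lebesgue_measure ([set` `]y, z]] : set R) = (z - y)%:E.
    rewrite lebesgue_measure_itv/= lte_fin; case: ltP => //= zy.
    by rewrite (_ : z = y) ?subrr//; apply/eqP; rewrite eq_le zy.
  by rewrite -[z - y]/(fine (z - y)%:E) -lm.
have Hyz y z : a <= y -> y <= z -> h y * (z - y) <= H0 z - H0 y <= h z * (z - y).
  move=> ay yz; rewrite /H0 (Rintegral_itvB (ih a z)) ?bnd_simp//.
  have i1 : intg `]y, z] h.
    by apply: (intgS _ _ _ (ih a z)) => // s; rewrite /= !in_itv/= => /andP[ys ->]; rewrite (le_trans ay (ltW ys)).
  have mI : measurable ([set` `]y, z]] : set R) by exact: measurable_itv.
  by rewrite -!Ic//; apply/andP; split; apply: RI_le => // s; rewrite /= in_itv/= => /andP[ys sz]; apply: hm => //; exact: ltW.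
pose H x := H0 (Num.max a x).
have mono y z : y <= z -> 0 <= H z - H y <= 2 * (z - y).
  move=> yz; have maxs : Num.max a y <= Num.max a z by rewrite ge_max le_max lexx/= le_max yz orbT.
  have amy : a <= Num.max a y by rewrite le_max lexx.
  have /andP[h1 h2] := Hyz (Num.max a y) (Num.max a z) amy maxs.
  have d1 : Num.max a z - Num.max a y <= z - y by case: (leP a y) => ?; case: (leP a z) => ?; lra.
  have /andP[h3 h4] := hb (Num.max a y); have /andP[h5 h6] := hb (Num.max a z).
  apply/andP; split; first by apply: (le_trans _ h1); rewrite mulr_ge0// subr_ge0.
  apply: (le_trans h2); apply: ler_pM => //; by rewrite subr_ge0.
exists H; split.
- move=> x; apply/cvgrPdist_le => e e0.
  near=> y; have xy : `|x - y| <= e / 2.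
    by near: y; apply: cvgr_dist_le; [exact: cvg_id|rewrite divr_gt0].
  have lip : `|H x - H y| <= 2 * `|x - y|.
    have [yx|/ltW xy'] := leP y x.
      by have /andP[h1 h2] := mono y x yx; rewrite ger0_norm// ger0_norm ?subr_ge0.
    by have /andP[h1 h2] := mono x y xy'; rewrite distrC [`|x - y|]distrC ger0_norm// ger0_norm ?subr_ge0.
  by apply: (le_trans lip); rewrite mulrC -ler_pdivlMr.
- move=> x /andP[ax xb].
  have Ha : H a = 0.
    rewrite /H maxxx /H0 set_itv1 Rintegral_set1//.
  have /andP[h1 h2] := mono a x ax; rewrite Ha !subr0 in h1 h2; rewrite h1 (le_trans h2)//.
  by rewrite ler_pM2l// lerD2r.
- move=> x ax N NE.
  have [d d0 Hd] : exists2 d : R, 0 < d & forall t, 0 < t < d -> 4 * N%:R * t <= h (x + t) - h x.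
    case: NE => [->|Ex].
      by exists 1 => // t /andP[t0 _]; rewrite mulr0 mul0r subr_ge0 hm// lerDl ltW.
    have [d d0 Hd] := hE x Ex (4 * N)%N; exists d => // t /andP[t0 td].
    have := Hd x (x + t); rewrite ltrBlDr ltrDl lerDl ltrD2l addrAC subrr add0r natrM; apply => //.
    exact: ltW.
  exists (Num.min d (x - a)); first by rewrite lt_min d0 subr_gt0.
  move=> t; rewrite lt_min => /and3P[t0 td tx].
  rewrite /H !max_r; [|lra|lra|lra].
  have /andP[_ h1] : h (x - t) * (x - (x - t)) <= H0 x - H0 (x - t) <= h x * (x - (x - t)) by apply: Hyz; lra.
  have /andP[h2 _] : h x * (x + t / 2 - x) <= H0 (x + t / 2) - H0 x <= h (x + t / 2) * (x + t / 2 - x) by apply: Hyz; lra.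
  have /andP[h3 _] : h (x + t / 2) * (x + t - (x + t / 2)) <= H0 (x + t) - H0 (x + t / 2) <= h (x + t) * (x + t - (x + t / 2)) by apply: Hyz; lra.
  have h4 : 4 * N%:R * (t / 2) <= h (x + t / 2) - h x by apply: Hd; apply/andP; split; lra.
  have h5 : 4 * N%:R * (t / 2) * (t / 2) <= (h (x + t / 2) - h x) * (t / 2) by apply: ler_wpM2r => //; lra.
  rewrite (_ : N%:R * t ^+ 2 = 4 * N%:R * (t / 2) * (t / 2)); last by field.
  rewrite (_ : x - (x - t) = t) in h1; last by ring.
  rewrite (_ : x + t / 2 - x = t / 2) in h2; last by ring.
  rewrite (_ : x + t - (x + t / 2) = t / 2) in h3; last by field.
  lra.
Unshelve. all: by end_near. Qed.

End barrier.

Section max_principle.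
Context {R : realType}.
Implicit Types (x y z t s : R) (E : set R).

Lemma itv_neighbour (a b x t : R) : 0 < t -> t < x - a -> t < b - x -> a <= x + t <= b /\ a <= x - t <= b.
Proof. by move=> *; split; apply/andP; split; lra. Qed.

Lemma itv_ball (a b x r y : R) : r <= x - a -> r <= b - x -> x - r < y -> y < x + r -> a < y < b.
Proof. by move=> *; apply/andP; split; lra. Qed.

(** Symmetric second differences converge to the second derivative, by the mean value theorem applied
    to [s |-> w (x + s) + w (x - s) - d2 s^2]. *)
Lemma second_diff_local (w dw : R -> R) x d2 (r : R) : 0 < r ->
  (forall y, x - r < y < x + r -> is_derive y 1 w (dw y)) -> is_derive x 1 dw d2 ->
  forall e : R, 0 < e -> exists2 r1 : R, 0 < r1 & forall t, 0 < t < r1 ->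
    `|w (x + t) + w (x - t) - 2 * w x - d2 * t ^+ 2| <= e * t ^+ 2.
Proof.
move=> r0 wd dwd e e0; have e20 : 0 < e / 2 by rewrite divr_gt0.
have [r1 r10 Hr1] := dv_local dwd e20.
exists (Num.min r r1); first by rewrite lt_min r0.
move=> t /andP[t0]; rewrite lt_min => /andP[tr tr1].
pose F s := w (x + s) + w (x - s) - d2 * s ^+ 2.
have Fd s : 0 <= s <= t -> is_derive s 1 F (dw (x + s) - dw (x - s) - 2 * d2 * s).
  move=> /andP[s0 st].
  have dp : is_derive s 1 (fun s => x + s) 1 by apply: dv_eq (dvD (dv_cst x s) (dv_id s)) _; rewrite add0r.
  have dm : is_derive s 1 (fun s => x - s) (-1) by apply: dv_eq (dvB (dv_cst x s) (dv_id s)) _; rewrite sub0r.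
  have w1 : is_derive (x + s) 1 w (dw (x + s)) by apply: wd; apply/andP; split; lra.
  have w2 : is_derive (x - s) 1 w (dw (x - s)) by apply: wd; apply/andP; split; lra.
  have d1 := @dv_comp R w (fun s => x + s) s _ _ w1 dp.
  have d3 := @dv_comp R w (fun s => x - s) s _ _ w2 dm.
  have d4 := dvZ d2 (dvM (dv_id s) (dv_id s)).
  apply: dv_eq (dvB (dvD d1 d3) d4) _; ring.
have [s /andP[s0 st] E] := mean_value t0 Fd.
have e1 : x + s - x = s by ring.
have e2 : x - s - x = - s by ring.
have := Hr1 (x + s); rewrite e1 (gtr0_norm s0) => /(_ _) H1.
have := Hr1 (x - s); rewrite e2 normrN (gtr0_norm s0) => /(_ _) H2.
have sr1 := lt_trans st tr1; have {}H1 := H1 sr1; have {}H2 := H2 sr1.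
have -> : w (x + t) + w (x - t) - 2 * w x - d2 * t ^+ 2 = (dw (x + s) - dw (x - s) - 2 * d2 * s) * t.
  rewrite subr0 in E; rewrite -E /F addr0 subr0; ring.
rewrite normrM (gtr0_norm t0) expr2 mulrA; apply: ler_wpM2r; first exact: ltW.
have -> : dw (x + s) - dw (x - s) - 2 * d2 * s = (dw (x + s) - dw x - d2 * s) - (dw (x - s) - dw x - d2 * - s) by ring.
apply: (le_trans (ler_normB _ _)); apply: (le_trans (lerD H1 H2)).
rewrite -mulrDl -splitr; apply: ler_wpM2l; exact: ltW.
Qed.

Lemma second_diff_le (w dw : R -> R) x d2 c (r : R) : 0 < r ->
  (forall y, x - r < y < x + r -> is_derive y 1 w (dw y)) -> is_derive x 1 dw d2 ->
  (forall t, 0 < t < r -> w (x + t) + w (x - t) - 2 * w x <= c * t ^+ 2) -> d2 <= c.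
Proof.
move=> r0 wd dwd H; apply/ler_addgt0Pr => e e0.
have [r1 r10 Hr1] := second_diff_local r0 wd dwd e0.
pose t := Num.min r r1 / 2.
have m0 : 0 < Num.min r r1 by rewrite lt_min r0.
have t0 : 0 < t by rewrite divr_gt0.
have tm : t < Num.min r r1 by rewrite ltr_pdivrMr// ltr_pMr// ltr1n.
have [tr tr1] : t < r /\ t < r1 by move: tm; rewrite lt_min => /andP[].
have H1 : w (x + t) + w (x - t) - 2 * w x <= c * t ^+ 2 by apply: H; rewrite t0.
have := Hr1 t; rewrite t0 tr1 => /(_ isT); rewrite ler_norml => /andP[H2 _].
rewrite -(ler_pM2r (exprn_gt0 2 t0)) mulrDl; lra.
Qed.

(** At a positive maximum of [W + e H], the time-fractional derivative is nonnegative, because the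
    barrier [H] does not depend on time; and [H] prevents the maximum from lying over the
    exceptional set, where the equation is not available. *)
Lemma max_principle E al Ga kap q a b T (W Wx Wxx Wt : R -> R -> R) :
  lebesgue_measure.-negligible E -> 0 < al < 1 -> 0 < Ga -> 0 < kap -> 0 < q -> a < b -> 0 < T ->
  {within [set` `[a, b]] `*` [set` `[0, T]], continuous (fun z : R * R => W z.1 z.2)} ->
  (forall x t, a < x < b -> 0 < t <= T ->
     is_derive x 1 (W^~ t) (Wx x t) /\ is_derive x 1 (Wx^~ t) (Wxx x t)) ->
  (forall x s, a < x < b -> 0 < s < T -> is_derive s 1 (W x) (Wt x s) /\ {for s, continuous (Wt x)}) ->
  (forall x t, a < x < b -> 0 < t <= T -> intg `]0, t[ (fun s => (t - s) `^ (- al) * Wt x s)) ->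
  (forall x t, a < x < b -> 0 < t <= T -> exists K d : R, 0 < d /\
     forall s, t - d < s < t -> `|W x t - W x s| <= K * (t - s)) ->
  (forall x t, a < x < b -> ~ E x -> 0 < t <= T ->
     RI `]0, t[ (fun s => (t - s) `^ (- al) * Wt x s) = Ga * (kap * Wxx x t - q * W x t)) ->
  (forall x, a <= x <= b -> W x 0 <= 0) ->
  (forall t, 0 <= t <= T -> W a t <= 0 /\ W b t <= 0) ->
  forall x t, a <= x <= b -> 0 <= t <= T -> W x t <= 0.
Proof.
move=> E0 al01 Ga0 kap0 q0 ab T0 cW dW tW iW lW pde W0 Wab x1 t1 x1ab t1T.
rewrite leNgt; apply/negP => W1.
have [H [cH H01 HE]] := barrier E0 (ltW ab).
pose D := 2 * (b - a) + 1; have D0 : 0 < D by rewrite /D; lra.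
pose e := W x1 t1 / 2 / D; have e0 : 0 < e by rewrite divr_gt0// divr_gt0.
have eH x : a <= x <= b -> 0 <= e * H x <= W x1 t1 / 2.
  move=> xab; have /andP[h1 h2] := H01 x xab; apply/andP; split; first by rewrite mulr_ge0// ltW.
  rewrite /e mulrAC ler_pdivrMr//; apply: ler_wpM2l; first by rewrite divr_ge0// ltW.
  by apply: (le_trans h2); rewrite /D lerDl.
pose A : set (R * R) := [set` `[a, b]] `*` [set` `[0, T]].
have A1 : A (x1, t1) by split; rewrite /= in_itv.
have [|||[x0 t0] /set_mem[/= x0ab t0T] Hmax] := @compact_EVT_max _ R (fun z : R * R => W z.1 z.2 + e * H z.1) A.
- by exists (x1, t1).
- by apply: compact_setX; exact: segment_compact.
- have cE : continuous (fun z : R * R => e * H z.1).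
    by move=> z; apply: cvgM; [exact: cvg_cst|exact: (continuous_comp (@cvg_fst _ _ (nbhs z.1) (nbhs z.2) _) (cH z.1))].
  by move=> z; apply: cvgD; [exact: cW|exact: (continuous_subspaceT cE)].
rewrite !in_itv/= in x0ab t0T.
have M1 x t : a <= x <= b -> 0 <= t <= T -> W x t + e * H x <= W x0 t0 + e * H x0.
  by move=> xab tT; apply: (Hmax (x, t)); rewrite inE; split; rewrite /= in_itv.
have Wpos : 0 < W x0 t0.
  have := M1 x1 t1 x1ab t1T; have /andP[h1 h2] := eH x1 x1ab; have /andP[h3 h4] := eH x0 x0ab; lra.
have t00 : 0 < t0.
  have /andP[t0' _] := t0T; rewrite lt_neqAle t0' andbT; apply/eqP => t0E.
  by move: Wpos; rewrite -t0E ltNge W0.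
have [Wa Wb] := Wab t0 t0T.
have x0i : a < x0 < b.
  have /andP[ax xb] := x0ab; rewrite !lt_neqAle ax xb !andbT; apply/andP; split; apply/eqP => xE.
    by move: Wpos; rewrite -xE ltNge Wa.
  by move: Wpos; rewrite xE ltNge Wb.
have t0T' : 0 < t0 <= T by rewrite t00; case/andP: t0T.
have /andP[ax xb] := x0i.
have [d1 d2] := dW x0 t0 x0i t0T'.
have key N : N = 0%N \/ E x0 -> Wxx x0 t0 <= - (e * N%:R).
  move=> NE; have [r r0 Hr] := HE x0 ax N NE.
  pose r' := Num.min r (Num.min (x0 - a) (b - x0)).
  have r'0 : 0 < r' by rewrite !lt_min r0 !subr_gt0.
  have inr t : t < r' -> [/\ t < r, t < x0 - a & t < b - x0] by rewrite !lt_min => /and3P[].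
  have rr : [/\ r' <= r, r' <= x0 - a & r' <= b - x0] by split; rewrite !ge_min lexx ?orbT.
  apply: (@second_diff_le (W^~ t0) (Wx^~ t0) x0 _ _ r' r'0) => //.
    move=> y /andP[y1 y2]; case: rr => _ r1 r2; exact: (dW y t0 (itv_ball r1 r2 y1 y2) t0T').1.
  move=> t /andP[tp tr]; have [h1 h2 h3] := inr t tr.
  have m1 : W (x0 + t) t0 + e * H (x0 + t) <= W x0 t0 + e * H x0 by exact: M1 _ _ (itv_neighbour tp h2 h3).1 t0T.
  have m2 : W (x0 - t) t0 + e * H (x0 - t) <= W x0 t0 + e * H x0 by exact: M1 _ _ (itv_neighbour tp h2 h3).2 t0T.
  have m3 : e * (N%:R * t ^+ 2) <= e * (H (x0 + t) + H (x0 - t) - 2 * H x0).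
    by rewrite ler_pM2l//; apply: Hr; rewrite tp.
  lra.
have nE : ~ E x0.
  move=> Ex; have /key : (truncn (`|Wxx x0 t0| / e)).+1 = 0%N \/ E x0 by right.
  have h : `|Wxx x0 t0| / e < (truncn (`|Wxx x0 t0| / e)).+1%:R by exact: truncnS_gt.
  rewrite ltr_pdivrMr// mulrC in h; move: (truncn _) h => n h k.
  suff h2 : e * n.+1%:R <= `|Wxx x0 t0| by have := lt_le_trans h h2; rewrite ltxx.
  by rewrite -normrN; apply: le_trans (ler_norm _); rewrite lerNr.
have /key : 0%N = 0%N \/ E x0 by left.
rewrite mulr0 oppr0 => Wxx0.
have [K [d [d0 Hd]]] := lW x0 t0 x0i t0T'.
have t0T0 : t0 <= T by case/andP: t0T'.
have inT s : 0 < s < t0 -> 0 < s < T by move=> /andP[-> st]; rewrite (lt_le_trans st).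
have L : 0 <= RI `]0, t0[ (fun s => (t0 - s) `^ (- al) * Wt x0 s).
  apply: (@caputo_ge0_at_max R al t0 K d (W x0)) => //.
  - by move=> s /inT s0; exact: (tW x0 s x0i s0).1.
  - by move=> s /inT s0; exact: (tW x0 s x0i s0).2.
  - exact: iW.
  - move=> s /andP[s0 st]; have := M1 x0 s x0ab; rewrite lerD2r; apply.
    by rewrite (ltW s0) (le_trans (ltW st)).
  - by move=> s sd; apply: le_trans (Hd s sd); exact: ler_norm.
rewrite pde// pmulr_rge0// in L.
have : kap * Wxx x0 t0 <= 0 by rewrite pmulr_rle0.
have : 0 < q * W x0 t0 by rewrite mulr_gt0.
lra.
Qed.

End max_principle.

(** * The sine system *)

Section p_series.
Context {R : realType}.

Lemma summable_bounded (u : R ^nat) (M : R) : (forall n, 0 <= u n) -> (forall n, series u n <= M) -> summable u.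
Proof.
move=> u0 uM; apply: nondecreasing_is_cvgn.
  by move=> i j ij; rewrite /series/= (big_cat_nat _ ij)//= lerDl sumr_ge0.
by exists M => _ [n _ <-].
Qed.

(** The terms are at most the increments of the bounded sequence [- n^(-e) / e]. *)
Lemma p_series_cvg (e : R) : 0 < e -> summable (fun n => n.+1%:R `^ (- (1 + e)) : R).
Proof.
move=> e0; pose b n : R := n.+1%:R `^ (- e).
have step n : n.+2%:R `^ (- (1 + e)) <= e^-1 * (b n - b n.+1).
  have np : (n.+1%:R : R) < n.+2%:R by rewrite ltr_nat.
  have pos (x : R) : n.+1%:R <= x <= n.+2%:R -> 0 < x by move=> /andP[h _]; apply: lt_le_trans h.
  have [c /andP[c1 c2] E] := mean_value np (fun x hx => dv_powR (- e) (pos x hx)).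
  have c0 : 0 < c by apply: pos; rewrite !ltW.
  have n2 : n.+2%:R - n.+1%:R = 1 :> R by rewrite -[n.+2%:R]natr1 addrAC subrr add0r.
  rewrite n2 mulr1 in E.
  have -> : b n - b n.+1 = e * c `^ (- e - 1) by rewrite /b -opprB E mulNr opprK.
  rewrite mulKf ?gt_eqF// (_ : - (1 + e) = - e - 1); last by ring.
  by rewrite -!kpE//; apply: kp_decr => //; [lra|exact: ltW].
apply: (@summable_bounded _ (1 + e^-1)) => [n|n]; first exact: powR_ge0.
have H : series (fun n => n.+1%:R `^ (- (1 + e)) : R) n.+1 <= 1 + e^-1 * (1 - b n).
  elim: n => [|n IH]; first by rewrite /series/= big_nat1 /b !powR1 subrr mulr0 addr0.
  rewrite /series/= big_nat_recr//=; apply: (le_trans (lerD IH (step n))).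
  by rewrite -addrA lerD2l -mulrDr addrA subrK.
apply: (@le_trans _ _ (series (fun n => n.+1%:R `^ (- (1 + e)) : R) n.+1)).
  by rewrite /series/= big_nat_recr//= lerDl powR_ge0.
apply: (le_trans H); rewrite lerD2l ler_piMr//; first by rewrite invr_ge0 ltW.
by rewrite gerBl powR_ge0.
Qed.

End p_series.

Lemma ae_mono {R : realType} (P Q : R -> Prop) : (forall x, P x -> Q x) ->
  {ae lebesgue_measure, forall x, P x} -> {ae lebesgue_measure, forall x, Q x}.
Proof. by move=> PQ [A [mA A0 PA]]; exists A; split => // x /= nQ; apply: PA => /= Px; exact/nQ/PQ. Qed.

Section sine_system.
Context {R : realType}.
Variables (xl xr : R).
Hypothesis hx : xl < xr.
Implicit Types (x y : R) (n m k : nat).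

Let ell := xr - xl.
Let ell0 : 0 < ell. Proof. by rewrite subr_gt0. Qed.
Let D : set R := [set` `]xl, xr[].
Let mD : measurable D. Proof. exact: measurable_itv. Qed.

Definition angle x : R := pi * (x - xl) / (xr - xl).
Definition freq n : R := n.+1%:R * pi / (xr - xl).
Definition eigfun n x : R := Num.sqrt (2 / (xr - xl)) * sin (freq n * (x - xl)).

Lemma freq_gt0 n : 0 < freq n.
Proof. by rewrite divr_gt0 ?mulr_gt0// ?pi_gt0. Qed.

Lemma freq_angle n x : freq n * (x - xl) = n.+1%:R * angle x.
Proof. by rewrite /freq /angle; field; rewrite gt_eqF. Qed.

Lemma sin_npi n : sin (n%:R * pi) = 0 :> R.
Proof.
elim: n => [|n IH]; first by rewrite mul0r sin0.
by rewrite -natr1 mulrDl mul1r sinDpi IH oppr0.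
Qed.

Lemma angle_l : angle xl = 0. Proof. by rewrite /angle subrr mulr0 mul0r. Qed.
Lemma angle_r : angle xr = pi. Proof. by rewrite /angle mulfK// gt_eqF. Qed.

Lemma eigfun_l n : eigfun n xl = 0. Proof. by rewrite /eigfun subrr mulr0 sin0 mulr0. Qed.
Lemma eigfun_r n : eigfun n xr = 0.
Proof. by rewrite /eigfun freq_angle angle_r sin_npi mulr0. Qed.

Lemma dv_affine (a b x : R) : is_derive x 1 (fun y => a * (y - b)) a.
Proof. by apply: dv_eq (dvZ a (dvB (dv_id x) (dv_cst b x))) _; rewrite subr0 mulr1. Qed.

Lemma cont_angle : continuous angle.
Proof.
have d x : is_derive x 1 angle (pi / (xr - xl)).
  by apply: dv_ext (dv_affine (pi / (xr - xl)) xl x) => y; rewrite /angle mulrAC.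
by move=> x; exact: dv_cont (d x).
Qed.

Lemma eigfun_norm n x : `|eigfun n x| <= Num.sqrt (2 / (xr - xl)).
Proof. by rewrite /eigfun normrM ger0_norm ?sqrtr_ge0// ler_piMr ?sqrtr_ge0// sin_max. Qed.

Lemma dv_sin_freq n x : is_derive x 1 (fun y => sin (freq n * (y - xl))) (freq n * cos (freq n * (x - xl))).
Proof.
by apply: dv_eq (@dv_comp R sin _ x _ _ (is_derive_sin _) (dv_affine (freq n) xl x)) _; rewrite mulrC.
Qed.

Lemma dv_cos_freq n x : is_derive x 1 (fun y => cos (freq n * (y - xl))) (- (freq n * sin (freq n * (x - xl)))).
Proof.
by apply: dv_eq (@dv_comp R cos _ x _ _ (is_derive_cos _) (dv_affine (freq n) xl x)) _; rewrite mulrC mulrN.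
Qed.

Lemma eigfun_cont n : continuous (eigfun n).
Proof. by move=> x; exact: dv_cont (dvZ _ (dv_sin_freq n x)). Qed.

Lemma eigfun_meas n (E : set R) : measurable_fun E (eigfun n).
Proof. by apply: measurable_funTS; apply: continuous_measurable_fun; exact: eigfun_cont. Qed.

Lemma RI_closed (f : R -> R) : intg `[xl, xr] f -> RI D f = RI `[xl, xr] f.
Proof.
move=> i1; rewrite -Rintegral_itv_obnd_cbnd; last by apply: (intgS _ _ _ i1) => // s; exact: subset_itv_oc_cc.
by rewrite -Rintegral_itv_bndo_bndc//; apply: (intgS _ _ _ i1) => // s; exact: subset_itv_oo_cc.
Qed.

Lemma intg_cont (f : R -> R) : continuous f -> intg D f.
Proof.
move=> cf; apply: (@intgS R `[xl, xr]) => //; first by move=> s; exact: subset_itv_oo_cc.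
by apply: continuous_compact_integrable; [exact: segment_compact|exact: continuous_subspaceT].
Qed.

Lemma cont_cos_angle k : continuous (fun x => cos (k%:R * angle x)).
Proof.
move=> x; apply: (@cont_comp R cos (fun x => k%:R * angle x)); first exact: continuous_cos.
by apply: cvgM; [exact: cvg_cst|exact: cont_angle].
Qed.

Lemma RI_cos k : RI D (fun x => cos (k%:R * angle x)) = if k == 0%N then ell else 0.
Proof.
have c0 := @cont_cos_angle k.
case: k c0 => [|k] c0.
  have d (x : R) : xl <= x <= xr -> is_derive x 1 (fun y : R => y) (cos (0%:R * angle x)).
    by move=> _; rewrite mul0r cos0; exact: dv_id.
  have [i1 e1] := continuous_FTC2R hx (fun x _ => c0 x) d.
  by rewrite RI_closed.
have d x : xl <= x <= xr -> is_derive x 1 (fun y => (freq k)^-1 * sin (freq k * (y - xl))) (cos (k.+1%:R * angle x)).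
  move=> _; apply: dv_eq (dvZ _ (dv_sin_freq k x)) _.
  by rewrite mulKf ?gt_eqF ?freq_gt0// freq_angle.
have [i1 e1] := continuous_FTC2R hx (fun x _ => c0 x) d; rewrite RI_closed// e1.
by rewrite !freq_angle angle_r angle_l mulr0 sin0 sin_npi !mulr0 subrr.
Qed.

Lemma eigfun_orthonormal n m : RI D (fun x => eigfun n x * eigfun m x) = (n == m)%:R.
Proof.
pose d := ((n - m) + (m - n))%N.
have E x : eigfun n x * eigfun m x = (cos (d%:R * angle x) - cos ((n + m).+2%:R * angle x)) / ell.
  have -> : cos (d%:R * angle x) = cos (n.+1%:R * angle x - m.+1%:R * angle x).
    rewrite -mulrBl; have [nm|/ltnW mn] := leqP m n.
      by rewrite /d (eqP nm) addn0 natrB//; congr (cos (_ * _)); rewrite -!natr1; ring.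
    rewrite /d (eqP mn) add0n natrB// -cosN -mulNr; congr (cos (_ * _)); rewrite -!natr1; ring.
  rewrite (_ : (n + m).+2%:R * angle x = n.+1%:R * angle x + m.+1%:R * angle x); last first.
    by rewrite -mulrDl -natrD addSn addnS.
  rewrite cosB cosD /eigfun !freq_angle.
  have s2 : Num.sqrt (2 / (xr - xl)) ^+ 2 = 2 / ell by rewrite sqr_sqrtr// divr_ge0// ltW.
  set s := Num.sqrt _ in s2 *.
  rewrite (_ : s * _ * _ = s ^+ 2 * (sin (n.+1%:R * angle x) * sin (m.+1%:R * angle x))); last by ring.
  rewrite s2; field; rewrite gt_eqF//.
have e2 : RI D (fun x => eigfun n x * eigfun m x) =
    RI D (fun x => ell^-1 * (cos (d%:R * angle x) - cos ((n + m).+2%:R * angle x))).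
  by apply: RI_ext => x _; rewrite E mulrC.
rewrite e2 RI_Z//; last by apply: intgB => //; apply: intg_cont; exact: cont_cos_angle.
rewrite RI_B//; [|apply: intg_cont; exact: cont_cos_angle..].
rewrite !RI_cos /= subr0 /d addn_eq0 !subn_eq0 -eqn_leq.
by case: eqP => _; rewrite ?mulr0// mulVf// gt_eqF.
Qed.

Lemma angle_in x : xl < x < xr -> 0 < angle x < pi.
Proof.
move=> /andP[x1 x2]; rewrite /angle divr_gt0 ?mulr_gt0 ?pi_gt0 ?subr_gt0//=.
by rewrite ltr_pdivrMr// ltr_pM2l ?pi_gt0// ltrD2r.
Qed.

Lemma angle_lt x y : x < y -> angle x < angle y.
Proof. by move=> xy; rewrite /angle ltr_pM2r ?invr_gt0// ltr_pM2l ?pi_gt0// ltrD2r. Qed.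

(** By induction on the degree, since [2 sin (k y) cos y = sin ((k + 1) y) + sin ((k - 1) y)]. *)
Lemma sine_poly_orthogonal (F : R -> R) (P : {poly R}) : intg D F ->
  (forall n, RI D (fun x => F x * sin (n.+1%:R * angle x)) = 0) ->
  forall k, intg D (fun x => F x * sin (k%:R * angle x) * P.[cos (angle x)]) /\
            RI D (fun x => F x * sin (k%:R * angle x) * P.[cos (angle x)]) = 0.
Proof.
move=> iF F0.
have csin k : continuous (fun x => sin (k%:R * angle x)).
  move=> x; apply: (@cont_comp R sin (fun x => k%:R * angle x)); first exact: continuous_sin.
  by apply: cvgM; [exact: cvg_cst|exact: cont_angle].
have ccos : continuous (fun x => cos (angle x)).
  by move=> x; apply: (@cont_comp R cos angle); [exact: continuous_cos|exact: cont_angle].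
have imul (f b : R -> R) (B : R) : intg D f -> continuous b -> (forall x, `|b x| <= B) -> intg D (fun x => f x * b x).
  move=> i1 cb bB; apply: (@intg_le R D _ (fun x => B * `|f x|)) => //.
  - apply: measurable_funM; first exact: (intg_meas mD i1).
    by apply: measurable_funTS; exact: continuous_measurable_fun.
  - by move=> s _; rewrite normrM mulrC ler_wpM2r.
  - by apply: intgZ => //; exact: intg_norm.
have i0 k : intg D (fun x => F x * sin (k%:R * angle x)) by apply: (imul _ _ 1) => // x; exact: sin_max.
elim/poly_ind: P => [|P c IH] k.
  have e : (fun x => F x * sin (k%:R * angle x) * (0 : {poly R}).[cos (angle x)]) = (fun x => 0 * F x).
    by apply/funext => x; rewrite horner0 mulr0 mul0r.
  by rewrite e; split; [exact: intgZ|rewrite RI_Z// mul0r].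
have E x : F x * sin (k%:R * angle x) * (P * 'X + c%:P).[cos (angle x)] =
    F x * sin (k%:R * angle x) * P.[cos (angle x)] * cos (angle x) + c * (F x * sin (k%:R * angle x)).
  by rewrite hornerMXaddC; ring.
have e : (fun x => F x * sin (k%:R * angle x) * (P * 'X + c%:P).[cos (angle x)]) =
    (fun x => F x * sin (k%:R * angle x) * P.[cos (angle x)] * cos (angle x) + c * (F x * sin (k%:R * angle x))).
  by apply/funext.
have i1 : intg D (fun x => F x * sin (k%:R * angle x) * P.[cos (angle x)] * cos (angle x)).
  by apply: (imul _ _ 1) => //; [exact: (IH k).1|move=> x; exact: cos_max].
rewrite e; split; first by apply: intgD => //; exact: intgZ.
rewrite RI_D//; last exact: intgZ.
rewrite RI_Z//.
case: k {E e} i1 => [|k] i1.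
  have z : (fun x => F x * sin (0%:R * angle x) * P.[cos (angle x)] * cos (angle x)) = (fun x => 0 * F x).
    by apply/funext => x; rewrite mul0r sin0 mulr0 !mul0r.
  have z' : (fun x => F x * sin (0%:R * angle x)) = (fun x => 0 * F x).
    by apply/funext => x; rewrite mul0r sin0 mulr0 mul0r.
  by rewrite z z' RI_Z// !mul0r mulr0 addr0.
have e : (fun x => F x * sin (k.+1%:R * angle x) * P.[cos (angle x)] * cos (angle x)) =
   (fun x => 2^-1 * (F x * sin (k.+2%:R * angle x) * P.[cos (angle x)] + F x * sin (k%:R * angle x) * P.[cos (angle x)])).
  apply/funext => x; have e1 : k.+2%:R * angle x = k.+1%:R * angle x + angle x by rewrite -natr1; ring.
  have e2 : k%:R * angle x = k.+1%:R * angle x - angle x by rewrite -natr1; ring.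
  by rewrite e1 e2 sinD sinB; field.
have [[j1 z1] [j2 z2]] := (IH k.+2, IH k).
rewrite e RI_Z//; last exact: intgD.
by rewrite RI_D// z1 z2 F0 addr0 !mulr0 addr0.
Qed.

(** As [n] grows, [(1 - t^n)^(2^n)] tends to one for [t < 1/2] and to zero for [1/2 < t <= 1]; this
    is the elementary step in the proof of Weierstrass' theorem by Brosowski and Deutsch. *)
Let step n t : R := (1 - t ^+ n) ^+ (2 ^ n).

Let step01 n t : 0 <= t <= 1 -> 0 <= step n t <= 1.
Proof.
move=> /andP[t0 t1]; have h : 0 <= t ^+ n <= 1 by rewrite exprn_ge0// exprn_ile1.
have {}h : 0 <= 1 - t ^+ n <= 1 by case/andP: h => ? ?; apply/andP; split; lra.
by case/andP: h => h1 h2; rewrite /step exprn_ge0// exprn_ile1.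
Qed.

Let bernoulli (u : R) m : -1 <= u -> 1 + m%:R * u <= (1 + u) ^+ m.
Proof.
move=> u1; elim: m => [|m IH]; first by rewrite mul0r addr0 expr0.
have u2 : 0 <= 1 + u by lra.
rewrite exprS; apply: (le_trans _ (ler_wpM2l u2 IH)).
rewrite -natr1; have : 0 <= m%:R * u ^+ 2 by rewrite mulr_ge0// sqr_ge0.
lra.
Qed.

Let step_lt t : 0 <= t < 2^-1 -> step n t @[n --> \oo] --> (1 : R).
Proof.
move=> /andP[t0 t1].
have t2 : t <= 1 by lra.
apply: (@squeeze_cvgr _ _ _ R (fun n => 1 - (2 * t) ^+ n) (fun=> 1)); [| |exact: cvg_cst].
- apply: nearW => n; have /andP[_ ->] := step01 n (introT andP (conj t0 t2)); rewrite andbT.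
  have := @bernoulli (- t ^+ n) (2 ^ n)%N; rewrite natrX exprMn mulrN; apply.
  by rewrite lerN2 exprn_ile1.
- rewrite -[X in _ --> X]subr0; apply: cvgB; first exact: cvg_cst.
  by apply: cvg_expr; rewrite ger0_norm; lra.
Qed.

Let step_gt t : 2^-1 < t <= 1 -> step n t @[n --> \oo] --> (0 : R).
Proof.
move=> /andP[t1 t2]; have t0 : 0 <= t by lra.
have b n : step n t <= (2 * t) ^- n.
  have tn : 0 <= t ^+ n <= 1 by rewrite exprn_ge0// exprn_ile1.
  have /andP[tn0 tn1] := tn.
  have p : 0 < (1 + t ^+ n) ^+ (2 ^ n) by rewrite exprn_gt0//; lra.
  have q : 0 < (2 * t) ^+ n by rewrite exprn_gt0//; lra.
  have h1 : step n t * (1 + t ^+ n) ^+ (2 ^ n) <= 1.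
    rewrite /step -exprMn exprn_ile1//.
      by rewrite mulr_ge0//; lra.
    by rewrite -subr_sqr expr1n gerBl sqr_ge0.
  have h2 : (2 * t) ^+ n <= (1 + t ^+ n) ^+ (2 ^ n).
    have := @bernoulli (t ^+ n) (2 ^ n)%N; rewrite natrX exprMn => h; apply: le_trans (h _); lra.
  have /andP[s0 _] := step01 n (introT andP (conj t0 t2)).
  rewrite -[_ ^- n]mul1r ler_pdivlMr//; apply: le_trans h1.
  exact: ler_wpM2l.
apply: (@squeeze_cvgr _ _ _ R (fun=> 0) (fun n => ((2 * t)^-1) ^+ n)); [|exact: cvg_cst|].
- apply: nearW => n; have /andP[-> _] := step01 n (introT andP (conj t0 t2)).
  by rewrite exprVn b.
- by apply: cvg_expr; rewrite ger0_norm ?invr_ge0; [rewrite invf_lt1; lra|lra].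
Qed.

(** The polynomials [(1 - t^n)^(2^n)] in [t = 1/2 + (cos y - cos y0) / 4] converge boundedly to the
    indicator function of [cos y < cos y0], that is, of [y0 < y]. *)
Lemma sine_tail (F : R -> R) x0 : intg D F ->
  (forall n, RI D (fun x => F x * sin (n.+1%:R * angle x)) = 0) -> xl < x0 < xr ->
  RI `]x0, xr[ (fun x => F x * sin (angle x)) = 0.
Proof.
move=> iF F0 /andP[x1 x2].
pose c0 := cos (angle x0).
pose t x := 2^-1 + (cos (angle x) - c0) / 4.
pose Pn n : {poly R} := (1 - ((2^-1 - c0 / 4)%:P + (4^-1)%:P * 'X) ^+ n) ^+ (2 ^ n).
have PnE n x : (Pn n).[cos (angle x)] = step n (t x).
  rewrite /Pn /step !(hornerE, horner_exp); congr ((1 - _ ^+ _) ^+ _); rewrite /t; ring.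
pose G n x := F x * sin (angle x) * step n (t x).
have H n : intg D (G n) /\ RI D (G n) = 0.
  have := sine_poly_orthogonal (Pn n) iF F0 1.
  by rewrite (_ : (fun x => _) = G n)//; apply/funext => x; rewrite PnE mul1r.
have t01 x : 0 <= t x <= 1.
  rewrite /t /c0; have := cos_le1 (angle x); have := cos_le1 (angle x0).
  have := cos_geN1 (angle x); have := cos_geN1 (angle x0); move=> *; apply/andP; split; lra.
have incos x y : xl < x -> x < y -> y < xr -> cos (angle y) < cos (angle x).
  move=> lx xy yr; have xr' := lt_trans xy yr; have ly := lt_trans lx xy.
  have /andP[a1 a2] := angle_in (introT andP (conj lx xr')).
  have /andP[a3 a4] := angle_in (introT andP (conj ly yr)).
  by rewrite ltr_cos ?in_itv/= ?ltW// angle_lt.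
have S1 : [set` `]xl, x0[] `<=` D by apply: subset_itvl; rewrite bnd_simp ltW.
have S2 : [set` `]x0, xr[] `<=` D by apply: subset_itvr; rewrite bnd_simp ltW.
have dom n x : `|G n x| <= `|F x|.
  rewrite /G normrM normrM -mulrA ler_piMr// mulr_ile1// ?sin_max//.
  by have /andP[h1 h2] := step01 n (t01 x); rewrite ger0_norm.
have iN : intg D (fun x => `|F x|) by exact: intg_norm.
have mG n : measurable_fun D (G n) by exact: (intg_meas mD (H n).1).
have sp n : RI `]xl, x0[ (G n) + RI `]x0, xr[ (G n) = 0.
  have [i1 z1] := H n; rewrite -z1.
  rewrite (Rintegral_itv_bndo_bndc (intgS mD _ S1 i1))//.
  rewrite -(@Rintegral_itvB R (G n) (BRight xl) (BLeft xr) x0 i1) ?bnd_simp//; last exact: ltW.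
  by rewrite addrC subrK.
have l1 : RI `]xl, x0[ (G n) @[n --> \oo] --> (0 : R).
  have := @RI_dominated R `]xl, x0[ G (fun=> 0) (fun x => `|F x|).
  rewrite (_ : RI _ (fun=> 0) = 0) ?Rintegral_cst ?mul0r//; apply => //.
  - by move=> n; exact: measurable_funS (mG n).
  - move=> x; rewrite /= in_itv/= => /andP[lx xx0].
    rewrite -[X in _ --> X](mulr0 (F x * sin (angle x))); apply: cvgM; first exact: cvg_cst.
    apply: step_gt; have /andP[_ ->] := t01 x; rewrite andbT /t.
    by have := incos x x0 lx xx0 x2; rewrite -/c0; lra.
  - exact: (intgS mD _ S1 iN).
have l2 : RI `]x0, xr[ (G n) @[n --> \oo] --> RI `]x0, xr[ (fun x => F x * sin (angle x)).
  apply: (@RI_dominated R `]x0, xr[ G _ (fun x => `|F x|)) => //.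
  - by move=> n; exact: measurable_funS (mG n).
  - move=> x; rewrite /= in_itv/= => /andP[xx0 rx].
    rewrite -[X in _ --> X](mulr1 (F x * sin (angle x))); apply: cvgM; first exact: cvg_cst.
    apply: step_lt; have /andP[-> _] := t01 x; rewrite /= /t.
    by have := incos x0 x x1 xx0 rx; rewrite -/c0; lra.
  - exact: (intgS mD _ S2 iN).
have e : (fun n => RI `]x0, xr[ (G n)) = (fun n => - RI `]xl, x0[ (G n)).
  by apply/funext => n; apply/eqP; rewrite -addr_eq0 addrC sp.
rewrite e in l2; have l3 : (fun n => - RI `]xl, x0[ (G n)) n @[n --> \oo] --> (0 : R).
  by rewrite -oppr0; exact: cvgN.
by rewrite -(cvg_lim (@Rhausdorff R) l2) (cvg_lim (@Rhausdorff R) l3).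
Qed.

(** Testing against smoothed indicator functions shows that all the tail integrals of [F x * sin (angle x)]
    vanish, and Lebesgue's differentiation theorem concludes, the sine being positive inside the interval. *)
Lemma sine_complete (F : R -> R) : intg D F ->
  (forall n, RI D (fun x => F x * eigfun n x) = 0) -> {ae leb, forall x, D x -> F x = 0}.
Proof.
move=> iF Fe.
have F0 n : RI D (fun x => F x * sin (n.+1%:R * angle x)) = 0.
  have c0 : Num.sqrt (2 / (xr - xl)) != 0 by rewrite gt_eqF// sqrtr_gt0 divr_gt0.
  have := Fe n; have -> : (fun x => F x * eigfun n x) = (fun x => Num.sqrt (2 / (xr - xl)) * (F x * sin (n.+1%:R * angle x))).
    by apply/funext => x; rewrite /eigfun freq_angle; ring.
  rewrite RI_Z//; last first.
    apply: (@intg_le R D _ (fun x => `|F x|)) => //; last exact: intg_norm.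
      apply: measurable_funM; first exact: (intg_meas mD iF).
      apply: measurable_funTS; apply: continuous_measurable_fun => x.
      apply: (@cont_comp R sin (fun x => n.+1%:R * angle x)); first exact: continuous_sin.
      by apply: cvgM; [exact: cvg_cst|exact: cont_angle].
    by move=> s _; rewrite normrM ler_piMr// sin_max.
  by move/eqP; rewrite mulf_eq0 (negbTE c0) /= => /eqP.
pose G := (fun x => F x * sin (angle x)) \_ D.
have iGD : intg D (fun x => F x * sin (angle x)).
  apply: (@intg_le R D _ (fun x => `|F x|)) => //; last exact: intg_norm.
    apply: measurable_funM; first exact: (intg_meas mD iF).
    apply: measurable_funTS; apply: continuous_measurable_fun => x.
    by apply: (@cont_comp R sin angle); [exact: continuous_sin|exact: cont_angle].
  by move=> s _; rewrite normrM ler_piMr// sin_max.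
have iG : intg setT G by exact/(intg_restrict _ mD).1.
have iG' y : intg `]-oo, y] G by apply: (intgS measurableT _ _ iG).
have := FTC1Ny iG' (integrable_locally mD iGD).
apply: ae_mono => x FT Dx; have := FT => -[dG].
have /andP[lx rx] : xl < x < xr by move: Dx; rewrite /D/= in_itv.
pose Phi y := RI `]-oo, y] G.
have cst y : xl < y < xr -> Phi y = RI setT G.
  move=> /andP[ly yr].
  have z : RI `]y, +oo[ G = 0.
    rewrite -(sine_tail iF F0 (introT andP (conj ly yr))) [LHS]RI_restrict [RHS]RI_restrict.
    apply: RI_ext => s _; rewrite /G !patchE !mem_setE/= !in_itv/= andbT.
    have [ys|ys] := ltP y s => //=.
    by rewrite (lt_trans ly ys).
  rewrite -(set_itvNyy R) -[LHS]addr0 -z.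
  have iNy : intg `]-oo, +oo[ G by rewrite set_itvNyy.
  by rewrite -(@Rintegral_itvB R G -oo%O +oo%O y iNy) ?bnd_simp// addrC subrK.
have d0 : is_derive x 1 Phi 0.
  apply: (dv_near _ (dv_cst (RI setT G) x)).
  by near=> y; rewrite cst//; apply/andP; split; near: y; [exact: near_gt|exact: near_lt].
rewrite (dv1 d0) /G patchE mem_set// => /esym/eqP.
rewrite mulf_eq0 => /orP[/eqP//|/eqP s0].
have := sin_gt0_pi (angle_in (introT andP (conj lx rx))); by rewrite s0 ltxx.
Unshelve. all: by end_near. Qed.

Lemma intg_eigfun (w : R -> R) n : intg D w -> intg D (fun x => w x * eigfun n x).
Proof.
move=> iw; apply: (@intg_le R D _ (fun x => Num.sqrt (2 / (xr - xl)) * `|w x|)) => //.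
- by apply: measurable_funM; [exact: (intg_meas mD iw)|exact: eigfun_meas].
- by move=> x _; rewrite normrM mulrC ler_wpM2r// eigfun_norm.
- by apply: intgZ => //; exact: intg_norm.
Qed.

(** The uniformly convergent series has the same coefficients as [f], and the sines are complete. *)
Lemma sine_expansion (f : R -> R) : intg D f -> summable (fun n => `|RI D (fun x => f x * eigfun n x)|) ->
  {ae leb, forall x, D x -> f x = sumr (fun n => RI D (fun x => f x * eigfun n x) * eigfun n x)}.
Proof.
move=> i1 sf; pose c n := RI D (fun x => f x * eigfun n x).
pose s0 := Num.sqrt (2 / (xr - xl)).
have b n x : `|c n * eigfun n x| <= `|c n| * s0 by rewrite normrM ler_wpM2l// eigfun_norm.
have sb : summable (fun n => `|c n| * s0).
  by rewrite (_ : (fun n => _) = (fun n => s0 * `|c n|)); [exact: summableZ|apply/funext => n; rewrite mulrC].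
have i1c : intg D (fun=> 1 : R) by apply: intg_cont; exact: cst_continuous.
have mc n : measurable_fun D (fun x => c n * eigfun n x) by apply: measurable_funM => //; exact: eigfun_meas.
have [i2 _] := sumr_integral mD mc (fun n x _ => eq_ind_r (fun z => _ <= z) (b n x) (mulr1 _)) sb i1c.
pose g x := sumr (fun n => c n * eigfun n x).
have ge m : RI D (fun x => g x * eigfun m x) = c m.
  have sg x : summable (fun n => c n * eigfun n x) by exact: summable_le (b^~ x) sb.
  have -> : RI D (fun x => g x * eigfun m x) = RI D (fun x => sumr (fun n => eigfun m x * (c n * eigfun n x))).
    by apply: RI_ext => x _; rewrite sumrZ// mulrC.
  have mc' n : measurable_fun D (fun x => eigfun m x * (c n * eigfun n x)).
    by apply: measurable_funM => //; exact: eigfun_meas.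
  have b' n x : D x -> `|eigfun m x * (c n * eigfun n x)| <= `|c n| * s0 * (s0 * 1).
    by move=> _; rewrite normrM mulrC mulr1 ler_pM// eigfun_norm.
  have [_ ->] := sumr_integral mD mc' b' sb (intgZ s0 mD i1c).
  have -> : (fun n => RI D (fun x => eigfun m x * (c n * eigfun n x))) = (fun n => c n * (n == m)%:R).
    apply/funext => n; rewrite -(eigfun_orthonormal n m) -RI_Z//; last by apply: intg_eigfun; apply: intg_cont; exact: eigfun_cont.
    by apply: RI_ext => x _; ring.
  apply: cvg_lim => //; apply: cvg_near_cst; near=> N.
  have mN : (m < N)%N by near: N; exact: nbhs_infty_gt.
  rewrite /series/= (bigD1_seq m)/= ?mem_index_iota ?iota_uniq// eqxx mulr1 big1 ?addr0// => n /negPf ->.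
  by rewrite mulr0.
have := @sine_complete (fun x => f x - g x) (intgB mD i1 i2).
have H m : RI D (fun x => (f x - g x) * eigfun m x) = 0.
  rewrite (_ : (fun x => _) = (fun x => f x * eigfun m x - g x * eigfun m x)); last by apply/funext => x; ring.
  by rewrite RI_B ?ge ?subrr//; exact: intg_eigfun.
move=> /(_ H); apply: ae_mono => x h Dx; apply/eqP; rewrite -subr_eq0; apply/eqP; exact: h.
Unshelve. all: by end_near. Qed.

End sine_system.

(** * Eigenvalues and eigenfunctions *)

Section prelim.
Context {R : realType}.

Lemma mid_in (a b : R) : a < b -> a < (a + b) / 2 < b.
Proof. by move=> ab; apply/andP; split; lra. Qed.

Lemma const_oo (f : R -> R) (a b x y : R) : (forall z : R, a < z < b -> is_derive z 1 f 0) ->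
  a < x < b -> a < y < b -> f x = f y.
Proof.
move=> fd; wlog xy : x y / x < y.
  by move=> H xab yab; case: (ltgtP x y) => [xy|yx|->//]; [exact: H|apply/esym; exact: H].
move=> /andP[ax xb] /andP[ay yb].
have [|c _ ] := @mean_value R f (fun=> 0) x y xy.
  by move=> z /andP[xz zy]; apply: fd; rewrite (lt_le_trans ax xz) (le_lt_trans zy yb).
by rewrite mul0r => /eqP; rewrite subr_eq0 => /eqP.
Qed.

(** [|u| <= 1 + u^2] on a bounded interval. *)
Lemma L2_intg (xl xr : R) w : in_L2 xl xr w -> intg `]xl, xr[ w.
Proof.
rewrite /in_L2 => wL; have mD : measurable ([set` `]xl, xr[] : set R) by exact: measurable_itv.
have le12 : (1 : R) <= 2 by rewrite ler1n.
have i2 := Lfun_integrable le12 wL.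
have mw : measurable_fun setT (w \_ `]xl, xr[) by move: wL => /andP[/[!inE]/= mf _].
have i3 : intg `]xl, xr[ (fun x => 1 + `|(w \_ `]xl, xr[) x| `^ 2).
  apply: intgD => //; last by apply: (intgS measurableT _ _ i2).
  by apply: intg_cst => //; rewrite lebesgue_measure_itv/=; case: ifP => _; rewrite ?ltry.
have i4 : intg `]xl, xr[ (w \_ `]xl, xr[).
  apply: (intg_le mD _ _ i3); first exact: measurable_funTS.
  move=> x _; set u := `|_|; have u0 : 0 <= u by exact: normr_ge0.
  rewrite powR_mulrn//; have := sqr_ge0 (u - 1); lra.
apply: (intg_ext mD _ i4) => x Dx; by rewrite patchE mem_set.
Qed.

Lemma powR_anti (p a b : R) : 0 <= p -> 0 < a -> a <= b -> b `^ (- p) <= a `^ (- p).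
Proof.
move=> p0 a0 ab; rewrite !powRN lef_pV2 ?posrE ?powR_gt0 ?(lt_le_trans a0)//.
by apply: powR_le => //; exact: ltW.
Qed.

End prelim.

Section eigen.
Context {R : realType}.
Variables (sigma q xl xr : R).
Hypotheses (hx : xl < xr) (s0 : 0 < sigma) (q0 : 0 < q).
Implicit Types (x y m : R) (n : nat).

Let ell0 : 0 < xr - xl. Proof. by rewrite subr_gt0. Qed.
Let D : set R := [set` `]xl, xr[].
Let mD : measurable D. Proof. exact: measurable_itv. Qed.
Let kap : R := sigma ^+ 2 / 2.
Let kap0 : 0 < kap. Proof. by rewrite divr_gt0// exprn_gt0. Qed.

Notation freq := (freq xl xr).
Notation eigfun := (eigfun xl xr).

Definition eigval n : R := sigma ^+ 2 / 2 * freq n ^+ 2 + q.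

Lemma eigval_gt0 n : 0 < eigval n.
Proof. by rewrite ltr_wpDl// mulr_ge0 ?sqr_ge0// ltW. Qed.

Let sq n x := sin (freq n * (x - xl)).
Let cq n x := cos (freq n * (x - xl)).

Lemma eigfun_SL n : SL_solution sigma q xl xr (eigval n) (eigfun n).
Proof.
pose c := Num.sqrt (2 / (xr - xl)).
have d1 x : is_derive x 1 (eigfun n) (c * (freq n * cq n x)) by exact: dvZ (dv_sin_freq _ _ _ _).
have e1 : derive1 (eigfun n) = (fun x => c * freq n * cq n x).
  by apply/funext => x; rewrite (dv1 (d1 x)) mulrA.
have d2 x : is_derive x 1 (derive1 (eigfun n)) (c * freq n * - (freq n * sq n x)).
  by rewrite e1; exact: dvZ (dv_cos_freq _ _ _ _).
split.
- by apply: continuous_subspaceT; exact: eigfun_cont.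
- by move=> x _; split; [case: (d1 x)|case: (d2 x)].
- move=> x _; rewrite (_ : derive1n 2 (eigfun n) x = derive1 (derive1 (eigfun n)) x)// (dv1 (d2 x)).
  by rewrite /eigfun /eigval -/c /sq; ring.
- by split; [exact: eigfun_l|exact: eigfun_r].
Qed.

Lemma right_limit (f : R -> R) a b : a < b -> {within `[a, b], continuous f} -> f x @[x --> a^'+] --> f a.
Proof. by move=> ab /(continuous_within_itvP _ ab)[]. Qed.

(** Two first integrals of [phi'' = - freq^2 phi] determine [phi] up to a constant factor. *)
Lemma SL_multiple n (phi : R -> R) : SL_solution sigma q xl xr (eigval n) phi ->
  exists c : R, forall x, xl <= x <= xr -> phi x = c * eigfun n x.
Proof.
move=> [cphi dphi ephi [phil phir]].
pose dp := derive1 phi.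
have om0 : freq n != 0 by rewrite gt_eqF// freq_gt0.
have inD x : xl < x < xr -> x \in `]xl, xr[ by rewrite in_itv.
have d1 x : xl < x < xr -> is_derive x 1 phi (dp x) by move=> /inD /dphi[h _]; exact: dv_derivable.
have d2 x : xl < x < xr -> is_derive x 1 dp (- freq n ^+ 2 * phi x).
  move=> xD; have [_ h] := dphi x (inD x xD); apply: dv_eq (dv_derivable h) _.
  have := ephi x (inD x xD); rewrite (_ : derive1n 2 phi x = derive1 dp x)// /eigval -/kap => e.
  have {}e : kap * derive1 dp x = kap * (- freq n ^+ 2 * phi x) by lra.
  by apply: (mulfI _ e); rewrite gt_eqF.
pose A x := phi x * cq n x - dp x * sq n x / freq n.
pose B x := phi x * sq n x + dp x * cq n x / freq n.
have dA x : xl < x < xr -> is_derive x 1 A 0.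
  move=> xD; have ds := dv_sin_freq xl xr n x; have dc := dv_cos_freq xl xr n x.
  apply: dv_eq (dvB (dvM (d1 x xD) dc) (dvM (dvM (d2 x xD) ds) (dv_cst (freq n)^-1 x))) _.
  by field.
have dB x : xl < x < xr -> is_derive x 1 B 0.
  move=> xD; have ds := dv_sin_freq xl xr n x; have dc := dv_cos_freq xl xr n x.
  apply: dv_eq (dvD (dvM (d1 x xD) ds) (dvM (dvM (d2 x xD) dc) (dv_cst (freq n)^-1 x))) _.
  by field.
pose x0 := (xl + xr) / 2.
have x0D : xl < x0 < xr by exact: mid_in.
have E x : xl < x < xr -> phi x = A x0 * cq n x + B x0 * sq n x.
  move=> xD; rewrite (const_oo dA x0D xD) (const_oo dB x0D xD) /A /B.
  have cs : cq n x ^+ 2 + sq n x ^+ 2 = 1 by exact: cos2Dsin2.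
  rewrite (_ : _ + _ = phi x * (cq n x ^+ 2 + sq n x ^+ 2)); last by ring.
  by rewrite cs mulr1.
have A0 : A x0 = 0.
  have l1 := right_limit hx cphi; rewrite phil in l1.
  have cc : continuous (fun x => A x0 * cq n x + B x0 * sq n x).
    move=> x; apply: cvgD; (apply: cvgM; first exact: cvg_cst).
      exact: (dv_cont (dv_cos_freq xl xr n x)).
    exact: (dv_cont (dv_sin_freq xl xr n x)).
  have l2 : A x0 * cq n x + B x0 * sq n x @[x --> xl^'+] --> A x0.
    have := cvg_at_right_filter (cc xl).
    have -> : cq n xl = 1 by rewrite /cq subrr mulr0 cos0.
    have -> : sq n xl = 0 by rewrite /sq subrr mulr0 sin0.
    by rewrite mulr1 mulr0 addr0.
  have l3 : phi x @[x --> xl^'+] --> A x0.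
    apply: cvg_trans l2; apply: near_eq_cvg; near=> x.
    by rewrite [RHS]E//; apply/andP; split; near: x; [exact: nbhs_right_gt|exact: nbhs_right_lt].
  exact: (cvg_unique _ l3 l1).
exists (B x0 / Num.sqrt (2 / (xr - xl))) => x /andP[x1 x2].
have c0 : Num.sqrt (2 / (xr - xl)) != 0 by rewrite gt_eqF// sqrtr_gt0 divr_gt0.
have [->|xxl] := eqVneq x xl; first by rewrite phil eigfun_l mulr0.
have [->|xxr] := eqVneq x xr; first by rewrite phir eigfun_r// mulr0.
rewrite E ?A0 ?mul0r ?add0r /eigfun ?mulrA ?divfK//.
by rewrite lt_neqAle eq_sym xxl x1 lt_neqAle xxr.
Unshelve. all: by end_near. Qed.

Variables (mu0 : nat -> R) (psi : nat -> R -> R).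
Hypothesis hSL : SL_eigensystem sigma q xl xr mu0 psi.

Lemma psi_inner i : inner_L2 xl xr (psi i) (psi i) = 1.
Proof.
case: hSL => _ _ /(_ i) + _; rewrite /norm_L2 => h.
have p : 0 < inner_L2 xl xr (psi i) (psi i) by rewrite -sqrtr_gt0 h.
by rewrite -(sqr_sqrtr (ltW p)) h expr1n.
Qed.

(** Every [eigval n] is in the list, since [eigfun n] is an eigenfunction, and the normalised eigenfunctions for it are
    [eigfun n] and its opposite.  The order in which the eigenvalues are listed is arbitrary. *)
Lemma eigen_index n : exists i s, [/\ mu0 i = eigval n, `|s| = 1 &
  forall x, xl <= x <= xr -> psi i x = s * eigfun n x].
Proof.
case: (hSL) => _ sol _ /(_ (eigval n) (eigfun n) (eigfun_SL n)) ex.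
have [|i mi] := ex.
  pose x := xl + (xr - xl) / (n.+1%:R * 2).
  have n0 : 0 < n.+1%:R :> R by [].
  have n1 : 1 <= n.+1%:R :> R by rewrite ler1n.
  have p : 0 < (xr - xl) / (n.+1%:R * 2) by rewrite divr_gt0// mulr_gt0.
  have pl : (xr - xl) / (n.+1%:R * 2) < xr - xl.
    rewrite ltr_pdivrMr ?mulr_gt0// ltr_pMr//; lra.
  exists x; first by rewrite in_itv/= /x ltrDl p -ltrBrDl pl.
  rewrite /eigfun mulf_neq0// ?gt_eqF ?sqrtr_gt0 ?divr_gt0//.
  rewrite (_ : freq n * (x - xl) = pi / 2) ?sin_pihalf//.
  rewrite /freq /x; field; rewrite !gt_eqF//.
have soli := sol i; rewrite -mi in soli.
have [c Hc] := SL_multiple soli.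
exists i, c; split => //.
have := psi_inner i.
have -> : inner_L2 xl xr (psi i) (psi i) = RI D (fun x => c ^+ 2 * (eigfun n x * eigfun n x)).
  apply: RI_ext => x; rewrite /D/= in_itv/= => /andP[x1 x2]; rewrite Hc ?(ltW x1) ?(ltW x2)//; ring.
rewrite RI_Z//; last first.
  by apply: intg_cont => //  x; apply: cvgM; exact: eigfun_cont.
rewrite eigfun_orthonormal// eqxx mulr1 => c2.
by apply/eqP; rewrite -(@eqrXn2 _ 2)// real_normK ?num_real// c2 expr1n.
Qed.

(** At an extremum of an eigenfunction of the right sign, [phi'' phi <= 0]. *)
Lemma eigen_ge i : q <= mu0 i.
Proof.
case: (hSL) => _ /(_ i)[cphi dphi ephi [phil phir]] _ _.
have inD x : xl < x < xr -> x \in `]xl, xr[ by rewrite in_itv.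
have key s x1 : xl < x1 < xr -> 0 < s * psi i x1 -> q <= mu0 i.
  move=> /andP[l1 r1] p1; pose w x := s * psi i x.
  have cw : {within `[xl, xr], continuous w} by move=> x; apply: cvgM; [exact: cvg_cst|exact: cphi].
  have [x0 x0D wmax] := EVT_max (ltW hx) cw.
  have w0 : 0 < w x0 by apply: (lt_le_trans p1); apply: wmax; rewrite in_itv/= !ltW.
  have {x0D}/andP[lx0 rx0] : xl <= x0 <= xr by move: x0D; rewrite in_itv.
  have lx : xl < x0.
    by rewrite lt_neqAle lx0 andbT; apply/eqP => e; move: w0; rewrite /w -e phil mulr0 ltxx.
  have rx : x0 < xr.
    by rewrite lt_neqAle rx0 andbT; apply/eqP => e; move: w0; rewrite /w e phir mulr0 ltxx.
  have x0D : xl < x0 < xr by rewrite lx.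
  pose r := Num.min (x0 - xl) (xr - x0).
  have r0 : 0 < r by rewrite lt_min !subr_gt0 lx.
  have [rl rr] : r <= x0 - xl /\ r <= xr - x0 by split; rewrite ge_min lexx ?orbT.
  have d1 y : x0 - r < y < x0 + r -> is_derive y 1 w (s * derive1 (psi i) y).
    move=> /andP[y1 y2]; apply: dvZ; apply: dv_derivable.
    by have [] := dphi y; rewrite // in_itv/=; apply/andP; split; lra.
  have d2 : is_derive x0 1 (fun y => s * derive1 (psi i) y) (s * derive1n 2 (psi i) x0).
    by apply: dvZ; apply: dv_derivable; have [] := dphi x0 (inD x0 x0D).
  have w2 : s * derive1n 2 (psi i) x0 <= 0.
    apply: (second_diff_le r0 d1 d2) => t /andP[t0 tr]; rewrite mul0r.
    have h1 : w (x0 + t) <= w x0 by apply: wmax; rewrite in_itv/=; apply/andP; split; lra.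
    have h2 : w (x0 - t) <= w x0 by apply: wmax; rewrite in_itv/=; apply/andP; split; lra.
    lra.
  have e := ephi x0 (inD x0 x0D).
  have e2 : kap * (s * derive1n 2 (psi i) x0) = (q - mu0 i) * w x0.
    have e' : kap * derive1n 2 (psi i) x0 = q * psi i x0 - mu0 i * psi i x0 by rewrite -e /kap; ring.
    by rewrite mulrCA e' /w; ring.
  have : (q - mu0 i) * w x0 <= 0 by rewrite -e2 pmulr_rle0.
  by rewrite pmulr_lle0// subr_le0.
have [[x xD xn]|nex] := pselect (exists2 x, xl < x < xr & psi i x != 0).
  move: xn; rewrite neq_lt => /orP[xn|xp].
    by apply: (key (-1) x xD); rewrite mulN1r oppr_gt0.
  by apply: (key 1 x xD); rewrite mul1r.
have := psi_inner i; rewrite /inner_L2 (RI_ext (g := fun=> 0)) ?Rintegral_cst ?mul0r//.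
  by move/eqP; rewrite eq_sym oner_eq0.
move=> x; rewrite /= in_itv/= => xD; apply/eqP; rewrite mulf_eq0 orbb; apply/negPn/negP => xn.
by apply: nex; exists x.
Qed.

Definition coef (w : R -> R) n : R := RI D (fun x => w x * eigfun n x).

(** A single term of the series that defines the norm. *)
Lemma coef_le nu w n : in_L2 xl xr w -> cvgn (HL_series xl xr mu0 psi nu w) ->
  `|coef w n| <= eigval n `^ (- nu) * norm_HL xl xr mu0 psi nu w.
Proof.
move=> wL cv; have [i [s [mi s1 Hs]]] := eigen_index n.
have e : `|coef w n| = `|inner_L2 xl xr w (psi i)|.
  have -> : inner_L2 xl xr w (psi i) = RI D (fun x => s * (w x * eigfun n x)).
    apply: RI_ext => x; rewrite /D/= in_itv/= => /andP[x1 x2]; rewrite Hs ?(ltW x1) ?(ltW x2)//; ring.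
  by rewrite RI_Z ?normrM ?s1 ?mul1r//; apply: intg_eigfun; exact: L2_intg.
have t0 k : 0 <= mu0 k `^ (2 * nu) * `|inner_L2 xl xr w (psi k)| ^+ 2.
  by rewrite mulr_ge0 ?powR_ge0// exprn_ge0.
have h : mu0 i `^ (2 * nu) * `|inner_L2 xl xr w (psi i)| ^+ 2 <= limn (HL_series xl xr mu0 psi nu w).
  apply: le_trans (series_le_sumr i.+1 t0 cv).
  by rewrite /series/= big_nat_recr//= lerDr sumr_ge0.
rewrite -e mi in h.
have p : 0 < eigval n `^ nu by rewrite powR_gt0// eigval_gt0.
have e2 : eigval n `^ (2 * nu) * `|coef w n| ^+ 2 = (eigval n `^ nu * `|coef w n|) ^+ 2.
  by rewrite exprMn; congr (_ * _); rewrite -powR_mulrn ?powR_ge0// -powRrM mulrC.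
rewrite powRN mulrC -[X in _ <= _ * X^-1]/(eigval n `^ nu) ler_pdivlMr// mulrC /norm_HL.
rewrite -[leLHS]ger0_norm ?mulr_ge0 ?powR_ge0// -sqrtr_sqr ler_wsqrtr//.
by rewrite -e2.
Qed.

Lemma HL_weaken (nu nu' : R) w : nu' <= nu -> cvgn (HL_series xl xr mu0 psi nu w) ->
  cvgn (HL_series xl xr mu0 psi nu' w).
Proof.
move=> nn cv; have := @summableZ R (q `^ (2 * (nu' - nu))) _ cv.
apply: summable_le => k.
have mk : 0 < mu0 k by exact: lt_le_trans (eigen_ge k).
rewrite ger0_norm ?mulr_ge0 ?powR_ge0 ?exprn_ge0// mulrA; apply: ler_wpM2r; first exact: exprn_ge0.
rewrite (_ : 2 * nu' = 2 * (nu' - nu) + 2 * nu); last by ring.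
rewrite powRD ?(gt_eqF mk) ?implybT//; apply: ler_wpM2r; first exact: powR_ge0.
rewrite -[2 * (nu' - nu)]opprK; apply: powR_anti => //; last exact: eigen_ge.
by rewrite oppr_ge0 pmulr_rle0// subr_le0.
Qed.

Lemma summable_eigval (e : R) : 0 < e -> summable (fun n => eigval n `^ (- ((1 + e) / 2))).
Proof.
move=> e0; pose c := kap * (pi / (xr - xl)) ^+ 2.
have c0 : 0 < c by rewrite mulr_gt0// exprn_gt0// divr_gt0// pi_gt0.
have := @summableZ R (c `^ (- ((1 + e) / 2))) _ (p_series_cvg e0).
apply: summable_le => n; rewrite ger0_norm ?powR_ge0//.
have n0 : 0 < n.+1%:R :> R by [].
have -> : n.+1%:R `^ (- (1 + e)) = (n.+1%:R ^+ 2) `^ (- ((1 + e) / 2)).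
  by rewrite -powR_mulrn ?ltW// -powRrM; congr (_ `^ _); field.
have cn : 0 < c * n.+1%:R ^+ 2 by rewrite mulr_gt0// exprn_gt0.
have -> : c `^ (- ((1 + e) / 2)) * (n.+1%:R ^+ 2) `^ (- ((1 + e) / 2)) = (c * n.+1%:R ^+ 2) `^ (- ((1 + e) / 2)).
  by rewrite powRM// ltW// exprn_gt0.
apply: powR_anti => //; first by rewrite divr_ge0// addr_ge0// ltW.
rewrite /eigval -/kap /freq /c (_ : kap * _ * _ = kap * (n.+1%:R * pi / (xr - xl)) ^+ 2); last by ring.
by rewrite lerDl ltW.
Qed.

End eigen.

(** * Derivatives relative to an interval *)

Section derivative_in_facts.
Context {R : realType}.
Implicit Types (D : interval R) (f g : R -> R) (x y l : R).

(** One-sided and two-sided derivatives with their value, as a relation, because [derive_in] is a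
    limit operator that is uninformative unless the limit is known to exist. *)
Definition has_din D f x l : Prop := diff_quotient f x y @[y --> within [set` D] x^'] --> l.

Definition limit_point_of D x : Prop := forall d : R, 0 < d -> exists y, [/\ y \in D, y != x & `|y - x| < d].

Lemma within_dnbhsP D x (P : R -> Prop) :
  (\forall y \near within [set` D] x^', P y) <->
  exists2 d : R, 0 < d & forall y, y \in D -> y != x -> `|y - x| < d -> P y.
Proof.
split=> [|[d d0 H]].
  rewrite /within/= /prop_near1/= => /nbhs_ballP[d /= d0 Hd]; exists d => // y yD yx yd.
  by apply: (Hd y) => //; rewrite /ball/= distrC.
rewrite /within/=; apply/nbhs_ballP; exists d => // y /=; rewrite /ball/= distrC => yd yx yD.
exact: H.
Qed.

Lemma has_dinP D f x l : has_din D f x l <-> forall e : R, 0 < e -> exists2 d : R, 0 < d &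
  forall y, y \in D -> y != x -> `|y - x| < d -> `|diff_quotient f x y - l| <= e.
Proof.
split=> [/cvgrPdist_le H e /H /within_dnbhsP[d d0 Hd]|H].
  by exists d => // y yD yx yd; rewrite distrC; exact: Hd.
apply/cvgrPdist_le => e /H[d d0 Hd]; apply/within_dnbhsP; exists d => // y yD yx yd.
by rewrite distrC; exact: Hd.
Qed.

Lemma limit_point_proper D x : limit_point_of D x -> ProperFilter (within [set` D] x^').
Proof.
move=> acc; split; last by apply: within_filter.
move=> /within_dnbhsP[d d0 H]; have [y [yD yx yd]] := acc d d0; exact: (H y).
Qed.

Lemma has_din_unique D f x l : limit_point_of D x -> has_din D f x l -> derive_in D f x = l.
Proof. by move=> /limit_point_proper PF h; apply: cvg_lim. Qed.

Lemma has_din_derivable D f x l : has_din D f x l -> derivable_in D f x.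
Proof. by move=> h; apply/cvg_ex; exists l. Qed.

Lemma derivable_has_din D f x : derivable_in D f x -> has_din D f x (derive_in D f x).
Proof. by []. Qed.

Lemma has_din_ext D f g x l : (forall y, y \in D -> f y = g y) -> x \in D ->
  has_din D f x l -> has_din D g x l.
Proof.
move=> fg xD /has_dinP H; apply/has_dinP => e /H[d d0 Hd]; exists d => // y yD yx yd.
by rewrite /diff_quotient -!fg//; exact: Hd.
Qed.

Lemma is_derive_has_din D f x l : is_derive x 1 f l -> has_din D f x l.
Proof.
move=> fd; apply/has_dinP => e e0; have [r r0 Hr] := dv_local fd e0.
exists r => // y _ yx yr; have yx0 : y - x != 0 by rewrite subr_eq0.
rewrite /diff_quotient (_ : _ - l = (f y - f x - l * (y - x)) / (y - x)); last by field.
by rewrite normrM normfV ler_pdivrMr ?normr_gt0//; exact: Hr.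
Qed.

Lemma local_dv f x l : (forall e : R, 0 < e -> exists2 d : R, 0 < d &
  forall y, y != x -> `|y - x| < d -> `|diff_quotient f x y - l| <= e) -> is_derive x 1 f l.
Proof.
move=> H; apply: cvg_dv; apply/cvgrPdist_le => e /H[d d0 Hd].
apply/nbhs_ballP; exists d => // h /=; rewrite /ball/= sub0r normrN => hd h0.
have e1 : x + h - x = h by ring.
have := Hd (x + h); rewrite /diff_quotient e1 distrC; apply => //.
by rewrite -subr_eq0 e1.
Qed.

Lemma has_din_interior D f x l : (\forall y \near x, y \in D) -> has_din D f x l -> is_derive x 1 f l.
Proof.
move=> /nbhs_ballP[r /= r0 Hr] /has_dinP H; apply: local_dv => e /H[d d0 Hd].
exists (Num.min r d); first by rewrite lt_min r0.
move=> y yx; rewrite lt_min => /andP[yr yd]; apply: Hd => //.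
by apply: Hr; rewrite /ball/= distrC.
Qed.

Lemma has_din_seq D f x l (s : nat -> R) : has_din D f x l ->
  (forall n, s n \in D) -> (forall n, s n != x) -> s n @[n --> \oo] --> x ->
  diff_quotient f x (s n) @[n --> \oo] --> l.
Proof.
move=> /has_dinP H sD sx cs; apply/cvgrPdist_le => e /H[d d0 Hd].
move/cvgrPdist_lt : cs => /(_ _ d0); apply: filterS => n; rewrite distrC => sn.
by rewrite distrC; exact: Hd.
Qed.

(** Sequences suffice, which gives access to the dominated convergence theorem. *)
Lemma seq_has_din D f x l (r : R) : 0 < r -> (forall s : nat -> R,
  (forall n, s n \in D) -> (forall n, s n != x) -> (forall n, `|s n - x| < r) -> s n @[n --> \oo] --> x ->
  diff_quotient f x (s n) @[n --> \oo] --> l) -> has_din D f x l.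
Proof.
move=> r0 H; apply/has_dinP => e e0; apply: contrapT => nH.
have bad n : exists y, [/\ y \in D, y != x, `|y - x| < Num.min r n.+1%:R^-1 & e < `|diff_quotient f x y - l|].
  apply: contrapT => nex; apply: nH; exists (Num.min r n.+1%:R^-1); first by rewrite lt_min r0 invr_gt0 ltr0n.
  move=> y yD yx yn; rewrite leNgt; apply/negP => yl; apply: nex; by exists y.
have /choice[s Hs] := bad.
have cs : s n @[n --> \oo] --> x.
  apply/cvgrPdist_lt => d d0; have := @cvg_harmonic R => /cvgrPdist_lt /(_ _ d0).
  apply: filterS => n; rewrite sub0r normrN ger0_norm ?invr_ge0// => nd.
  by have [_ _ h _] := Hs n; rewrite distrC; apply: lt_trans nd; move: h; rewrite lt_min => /andP[].
have sr n : `|s n - x| < r by have [_ _ + _] := Hs n; rewrite lt_min => /andP[].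
have := H s (fun n => let: And4 h _ _ _ := Hs n in h) (fun n => let: And4 _ h _ _ := Hs n in h) sr cs.
move=> /cvgrPdist_lt /(_ _ e0)[N _ /(_ N (leqnn N))]; rewrite /= distrC.
by have [_ _ _ h] := Hs N; rewrite ltNge (ltW h).
Qed.

Lemma has_din_cont D f x l : has_din D f x l -> x \in D -> forall e : R, 0 < e ->
  exists2 d : R, 0 < d & forall y, y \in D -> `|y - x| < d -> `|f y - f x| <= e.
Proof.
move=> /has_dinP /(_ _ ltr01)[d d0 Hd] xD e e0.
pose K := `|l| + 1; have K0 : 0 < K by rewrite ltr_wpDl.
exists (Num.min d (e / K)); first by rewrite lt_min d0 divr_gt0.
move=> y yD; rewrite lt_min => /andP[yd ye].
have [->|yx] := eqVneq y x; first by rewrite subrr normr0 ltW.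
have yx0 : y - x != 0 by rewrite subr_eq0.
have := Hd y yD yx yd; rewrite /diff_quotient => h.
have {}h : `|(f y - f x) / (y - x)| <= K.
  by rewrite -[X in `|X|](subrK l) (le_trans (ler_normD _ _))// addrC lerD2l.
rewrite normrM normfV ler_pdivrMr ?normr_gt0// in h; apply: (le_trans h).
by rewrite mulrC -ler_pdivlMr//; exact: ltW.
Qed.

Lemma acc_oc (T x : R) : 0 < x <= T -> limit_point_of `]0, T] x.
Proof.
move=> /andP[x0 xT] d d0; pose m := Num.min x d / 2.
have m0 : 0 < Num.min x d by rewrite lt_min x0.
have mh : m < Num.min x d by rewrite /m; lra.
have [mx md] : m < x /\ m < d by move: mh; rewrite lt_min => /andP[].
have m1 : 0 < m by rewrite divr_gt0.
exists (x - m); split.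
- by rewrite in_itv/=; apply/andP; split; lra.
- by rewrite -subr_eq0 addrAC subrr add0r oppr_eq0 gt_eqF.
- by rewrite addrAC subrr add0r normrN gtr0_norm.
Qed.

Lemma acc_cc (a b x : R) : a < b -> a <= x <= b -> limit_point_of `[a, b] x.
Proof.
move=> ab /andP[ax xb] d d0.
have [xb'|bx] := ltP x b.
  pose m := Num.min (b - x) d / 2.
  have m0 : 0 < Num.min (b - x) d by rewrite lt_min subr_gt0 xb'.
  have mh : m < Num.min (b - x) d by rewrite /m; lra.
  have [mx md] : m < b - x /\ m < d by move: mh; rewrite lt_min => /andP[].
  have m1 : 0 < m by rewrite divr_gt0.
  exists (x + m); split.
  - by rewrite in_itv/=; apply/andP; split; lra.
  - by rewrite -subr_eq0 addrAC subrr add0r gt_eqF.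
  - by rewrite addrAC subrr add0r gtr0_norm.
have xa : a < x by exact: lt_le_trans bx.
pose m := Num.min (x - a) d / 2.
have m0 : 0 < Num.min (x - a) d by rewrite lt_min subr_gt0 xa.
have mh : m < Num.min (x - a) d by rewrite /m; lra.
have [mx md] : m < x - a /\ m < d by move: mh; rewrite lt_min => /andP[].
have m1 : 0 < m by rewrite divr_gt0.
exists (x - m); split.
- by rewrite in_itv/=; apply/andP; split; lra.
- by rewrite -subr_eq0 addrAC subrr add0r oppr_eq0 gt_eqF.
- by rewrite addrAC subrr add0r normrN gtr0_norm.
Qed.

Lemma near_oo (a b x : R) : a < x < b -> \forall y \near x, a < y < b.
Proof.
by move=> /andP[ax xb]; near=> y; apply/andP; split; near: y; [exact: near_gt|exact: near_lt].
Unshelve. all: by end_near. Qed.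

End derivative_in_facts.

(** * Coefficients of time-dependent data *)

Section almost_everywhere.
Context {R : realType}.
Implicit Types (x t : R).

Lemma RI_null (D N : set R) (f : R -> R) : measurable D -> measurable N -> leb N = 0%E ->
  intg D f -> RI D f = RI (D `\` N) f.
Proof. move=> mD mN N0 i1; rewrite /Rintegral.
by rewrite (@negligible_integral _ (measurableTypeR R) R lebesgue_measure D N (EFin \o f) mN mD i1 N0). Qed.

(** Pointwise properties that are closed under limits in time need only be checked at rational
    times, so that the exceptional set can be chosen independent of time. *)
Lemma ae_all_times (D : set R) (T : R) (h : R -> R -> R) :
  (forall x t, D x -> t \in `]0, T] -> forall e : R, 0 < e -> exists2 d : R, 0 < d &
     forall s, s \in `]0, T] -> `|s - t| < d -> `|h x s - h x t| <= e) ->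
  (forall t, t \in `]0, T] -> {ae lebesgue_measure, forall x, D x -> h x t <= 0}) ->
  {ae lebesgue_measure, forall x, D x -> forall t, t \in `]0, T] -> h x t <= 0}.
Proof.
move=> hc hae.
pose P (n : nat) x := forall r : rat, unpickle n = Some r -> ratr r \in `]0, T] -> D x -> h x (ratr r) <= 0.
have aeP n : {ae lebesgue_measure, forall x, P n x}.
  rewrite /P; case: (unpickle n) => [r|]; last first.
    by apply: (ae_mono (P := fun=> True)) => //; exists set0; split => // x /=.
  have [rT|rT] := boolP (ratr r \in `]0, T] : bool); last first.
    apply: (ae_mono (P := fun=> True)); last by exists set0; split => // x /=.
    by move=> x _ r' [<-]; rewrite (negbTE rT).
  by apply: ae_mono (hae _ rT) => x hx r' [<-] _.
apply: ae_mono (ae_foralln aeP) => x Px Dx t tT.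
apply/ler_addgt0Pr => e e0; rewrite add0r.
have [d d0 Hd] := hc x t Dx tT e e0.
have /andP[t0 tT'] : 0 < t <= T by move: tT; rewrite in_itv.
have lt : Num.max 0 (t - d) < t by rewrite gt_max t0/= gtrBl.
have [r] := rat_in_itvoo lt; rewrite in_itv/= gt_max => /andP[/andP[r0 rd] rt].
have rT : ratr r \in `]0, T] by rewrite in_itv/= r0 (le_trans (ltW rt)).
have h1 : h x (ratr r) <= 0 by apply: (Px (pickle r)) => //; rewrite pickleK.
have h2 : `|h x (ratr r) - h x t| <= e.
  by apply: Hd => //; rewrite ltr_norml; apply/andP; split; lra.
move: h2; rewrite ler_norml => /andP[h2 h3]; lra.
Qed.

(** Tonelli: a measurable set with null vertical sections has null horizontal sections. *)
Lemma ae_swap (B : set (measurableTypeR R * measurableTypeR R)) : measurable B ->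
  (forall t, {ae lebesgue_measure, forall x, ~ B (x, t)}) ->
  {ae lebesgue_measure, forall x, {ae lebesgue_measure, forall t, ~ B (x, t)}}.
Proof.
move=> mB Bt.
have mf : measurable_fun setT (fun z : measurableTypeR R * measurableTypeR R => (\1_B z)%:E : \bar R).
  by apply/measurable_EFinP; exact: measurable_indic.
have f0 z : (0 <= (\1_B z)%:E :> \bar R)%E by rewrite lee_fin.
have null (g : measurableTypeR R -> R) : measurable_fun setT (fun x => (g x)%:E) -> (forall x, 0 <= g x) ->
    (\int[lebesgue_measure]_x (g x)%:E = 0)%E -> {ae lebesgue_measure, forall x, g x = 0}.
  move=> mg g0 ig; have := (@ae_eq_integral_abs _ _ _ lebesgue_measure setT measurableT _ mg).1.
  rewrite (_ : (\int[_]_(x in _) `|_|)%E = 0%E); last first.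
    by rewrite -ig; apply: eq_integral => x _; rewrite gee0_abs// lee_fin.
  by move=> /(_ erefl); apply: ae_mono => x /(_ I) [].
have I2 t : (\int[lebesgue_measure]_x (\1_B (x, t))%:E = 0 :> \bar R)%E.
  have -> : (\int[lebesgue_measure]_x (\1_B (x, t))%:E = \int[lebesgue_measure]_(x in setT) (cst 0 x) :> \bar R)%E.
    apply: ae_eq_integral => //.
    - by apply/measurable_EFinP; apply: (measurableT_comp (measurable_indic mB)); exact: measurable_pair2.
    - apply: ae_mono (Bt t) => x nB _ /=.
      by rewrite indicE memNset.
  exact: integral0.
have I1 := @fubini_tonelli _ _ _ _ R lebesgue_measure lebesgue_measure _ mf f0.
have I0 : (\int[lebesgue_measure]_x \int[lebesgue_measure]_t (\1_B (x, t))%:E = 0 :> \bar R)%E.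
  by rewrite I1 (eq_integral (cst 0%E)) ?integral0// => t _; rewrite I2.
have mF := @measurable_fun_fubini_tonelli_F _ _ _ _ R lebesgue_measure _ mf f0.
have := (@ae_eq_integral_abs _ _ _ lebesgue_measure setT measurableT _ mF).1.
rewrite (_ : (\int[_]_(x in _) `|_|)%E = 0%E); last first.
  by rewrite -I0; apply: eq_integral => x _; rewrite gee0_abs// integral_ge0.
move=> /(_ erefl); apply: ae_mono => x /(_ I); rewrite /fubini_F /= => Ix.
have mx : measurable_fun setT (fun t => (\1_B (x, t))%:E : \bar R).
  by apply/measurable_EFinP; apply: (measurableT_comp (measurable_indic mB)); exact: measurable_pair1.
apply: ae_mono (null (fun t => \1_B (x, t)) mx (fun t => _) Ix) => //.
by move=> t; rewrite indicE => + Bxt; rewrite mem_set// => /eqP; rewrite oner_eq0.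
Qed.

End almost_everywhere.

Section data.
Context {R : realType}.
Variables (xl xr T : R).
Hypotheses (hx : xl < xr) (hT : 0 < T).
Implicit Types (x t s : R) (n : nat).

Let D : set R := [set` `]xl, xr[].
Let mD : measurable D. Proof. exact: measurable_itv. Qed.
Let J : interval R := `]0, T].
Notation eigfun := (eigfun xl xr).
Notation coef := (coef xl xr).
Let sc : R := Num.sqrt (2 / (xr - xl)).
Let sc0 : 0 <= sc. Proof. exact: sqrtr_ge0. Qed.

Lemma ae_and (P Q : R -> Prop) : {ae lebesgue_measure, forall x, P x} ->
  {ae lebesgue_measure, forall x, Q x} -> {ae lebesgue_measure, forall x, P x /\ Q x}.
Proof.
move=> hP hQ; apply: (@negligibleS _ _ _ lebesgue_measure _ _ _ (negligibleU hP hQ)).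
move=> x /= H; have [Px|nP] := pselect (P x); last by left.
by right => Qx; apply: H.
Qed.

(** Differentiation under the integral sign by dominated convergence, along sequences; the Lipschitz bound
    is required for almost every [x] only. *)
Lemma coef_has_din (E : set R) (f : R -> R -> R) (df : R -> R) t (r K : R) n :
  lebesgue_measure.-negligible E -> t \in J -> 0 < r ->
  (forall x, D x -> has_din J (f x) t (df x)) ->
  (forall s, s \in J -> intg D (f^~ s)) -> intg D df ->
  (forall x s, D x -> ~ E x -> s \in J -> `|s - t| < r -> `|f x s - f x t| <= K * `|s - t|) ->
  has_din J (fun s => coef (f^~ s) n) t (coef df n).
Proof.
move=> [N [mN N0 EN]] tJ r0 fd if_ idf fK.
apply: (seq_has_din r0) => s sJ st sr cs.
have mDN : measurable (D `\` N) by exact: measurableD.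
have DND : D `\` N `<=` D by move=> x [].
have e j : diff_quotient (fun s => coef (f^~ s) n) t (s j) =
    RI (D `\` N) (fun x => diff_quotient (f x) t (s j) * eigfun n x).
  have i1 := intg_eigfun n (if_ _ (sJ j)); have i2 := intg_eigfun n (if_ _ tJ).
  have -> : diff_quotient (fun s => coef (f^~ s) n) t (s j) = RI D (fun x => (s j - t)^-1 * (f x (s j) * eigfun n x - f x t * eigfun n x)).
    by rewrite RI_Z ?RI_B//; [rewrite mulrC|exact: intgB].
  rewrite (RI_null mD mN N0); last by apply: intgZ => //; exact: intgB.
  by apply: RI_ext => x _; rewrite /diff_quotient; ring.
rewrite (funext e) /coef (RI_null mD mN N0 (intg_eigfun n idf)).
apply: (@RI_dominated R _ _ _ (fun=> K * sc)) => //.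
- move=> j; apply: measurable_funM; last exact: eigfun_meas.
  apply: (measurable_funS mD DND); apply: measurable_funM => //.
  by apply: measurable_funB; apply: (intg_meas mD); exact: if_.
- move=> x [Dx _]; apply: cvgM; last exact: cvg_cst.
  exact: (has_din_seq (fd x Dx)).
- move=> j x [Dx nN]; rewrite normrM; apply: ler_pM => //; last exact: eigfun_norm.
  have st0 : 0 < `|s j - t| by rewrite normr_gt0 subr_eq0.
  rewrite normrM normfV ler_pdivrMr//; apply: fK => //.
  by move=> Ex; apply: nN; exact: EN.
- apply: (intgS mD mDN DND); apply: intg_cst => //.
  by rewrite lebesgue_measure_itv/=; case: ifP => _; rewrite ?ltry.
Qed.

(** [lipschitz_ae] up to and including the endpoint [T], where [f] is only one-sidedly differentiable. *)
Lemma has_din_lipschitz (E : set R) (f df : R -> R) (a M : R) : lebesgue_measure.-negligible E -> 0 < a ->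
  (forall t, t \in J -> has_din J f t (df t)) -> 0 <= M ->
  (forall t, a <= t < T -> ~ E t -> `|df t| <= M) ->
  forall s t, s \in J -> t \in J -> a <= s -> a <= t -> `|f s - f t| <= M * `|s - t|.
Proof.
move=> E0 a0 fd M0 dM.
have key s t : a <= s -> s <= t -> t < T -> `|f t - f s| <= M * (t - s).
  move=> as_ st tT; apply: (lipschitz_ae (df := df) E0) => // u /andP[su ut].
    have u0 : 0 < u < T by rewrite (lt_le_trans a0 (le_trans as_ su)) (le_lt_trans ut).
    apply: (@has_din_interior _ J); last by apply: fd; case/andP: u0 => ? ?; rewrite in_itv/= ltW// andbT.
    by have := near_oo u0; apply: filterS => v /andP[v0 vT]; rewrite in_itv/= v0 ltW.
  by apply: dM; rewrite (le_trans as_ su) (le_lt_trans ut).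
have key2 s t : s \in J -> t \in J -> a <= s -> s <= t -> `|f t - f s| <= M * (t - s).
  move=> sJ tJ as_ st; have [tT|Tt] := ltP t T; first exact: key.
  have tE : t = T by apply/eqP; rewrite eq_le Tt andbT; move: tJ; rewrite in_itv => /andP[].
  have [->|st'] := eqVneq s t; first by rewrite !subrr normr0 mulr0.
  have {}st' : s < t by rewrite lt_neqAle st'.
  apply/ler_addgt0Pr => e e0.
  have [d d0 Hd] := has_din_cont (fd t tJ) tJ e0.
  pose u := Num.max s (t - d / 2).
  have ut : u < t by rewrite gt_max st'/=; lra.
  have su : s <= u by rewrite le_max lexx.
  have du : `|u - t| < d.
    rewrite distrC gtr0_norm ?subr_gt0// ltrBlDr -ltrBlDl lt_max; apply/orP; right; lra.
  have s0 : 0 < s by exact: lt_le_trans as_.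
  have uJ : u \in J by rewrite in_itv/= (lt_le_trans s0 su) -tE ltW.
  have h1 := Hd u uJ du; have h2 : `|f u - f s| <= M * (u - s) by apply: key => //; rewrite -tE.
  rewrite (_ : f t - f s = (f u - f s) - (f u - f t)); last by ring.
  apply: (le_trans (ler_normB _ _)); apply: lerD => //; apply: (le_trans h2).
  by apply: ler_wpM2l => //; rewrite lerD2r ltW.
move=> s t sJ tJ as_ at_; have [st|/ltW ts] := leP s t.
  by rewrite distrC [`|s - t|]distrC [`|t - s|]ger0_norm ?subr_ge0//; exact: key2.
by rewrite [`|s - t|]ger0_norm ?subr_ge0//; exact: key2.
Qed.

Variables (g g1 g2 : R -> R -> R) (rho : R) (a : nat -> R).
Hypothesis dg : forall x t, D x -> t \in J -> has_din J (g x) t (g1 x t).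
Hypothesis dg1 : forall x t, D x -> t \in J -> has_din J (g1 x) t (g2 x t).
Hypothesis ig : forall t, t \in J -> intg D (g^~ t).
Hypothesis ig1 : forall t, t \in J -> intg D (g1^~ t).
Hypothesis ig2 : forall t, t \in J -> intg D (g2^~ t).
Hypotheses (a0 : forall n, 0 <= a n) (sa : summable a).
Hypothesis c0 : forall t n, t \in J -> `|coef (g^~ t) n| <= a n.
Hypothesis c1 : forall t n, t \in J -> `|coef (g1^~ t) n| <= a n.
Hypothesis c2 : forall t n, t \in J -> `|coef (g2^~ t) n| <= t `^ (- rho) * a n.

Let K : R := sumr (fun n => sc * a n).
Let sK : summable (fun n => sc * a n). Proof. exact: summableZ. Qed.
Let K0 : 0 <= K.
Proof.
have := @series_le_sumr R (fun n => sc * a n) 0; rewrite /series/= big_geq//; apply => //.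
by move=> n; rewrite mulr_ge0.
Qed.

Let sum_bound (c : nat -> R) (B : R) x : 0 <= B -> (forall n, `|c n| <= B * a n) ->
  summable (fun n => c n * eigfun n x) /\ `|sumr (fun n => c n * eigfun n x)| <= B * K.
Proof.
move=> B0 cB; have b n : `|c n * eigfun n x| <= B * (sc * a n).
  by rewrite normrM [sc * _]mulrC mulrA ler_pM// eigfun_norm.
have sB : summable (fun n => B * (sc * a n)) by exact: summableZ.
split; first exact: summable_le b sB.
by rewrite -sumrZ//; exact: sumr_norm_le.
Qed.

Lemma ae_expansion (w : R -> R) (B : R) : 0 <= B -> intg D w -> (forall n, `|coef w n| <= B * a n) ->
  {ae lebesgue_measure, forall x, D x -> w x = sumr (fun n => coef w n * eigfun n x)}.
Proof.
move=> B0 iw wB; apply: sine_expansion => //.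
apply: (summable_norm (M := fun n => B * a n)) => //; exact: summableZ.
Qed.

Lemma ae_bound (w : R -> R) (B : R) : 0 <= B -> intg D w -> (forall n, `|coef w n| <= B * a n) ->
  {ae lebesgue_measure, forall x, D x -> `|w x| <= B * K}.
Proof.
by move=> B0 iw wB; apply: ae_mono (ae_expansion B0 iw wB) => x + Dx => ->//; exact: (sum_bound x B0 wB).2.
Qed.

Let null0 : lebesgue_measure.-negligible (set0 : set R). Proof. exact: negligible_set0. Qed.

(** The slicewise bounds on [g1] hold for almost every [x] at all times, and [g] is then Lipschitz in time with
    a constant independent of [x]. *)
Lemma coef_derive t n : t \in J -> has_din J (fun s => coef (g^~ s) n) t (coef (g1^~ t) n).
Proof.
move=> tJ; have ae1 : {ae lebesgue_measure, forall x, D x -> forall t, t \in J -> `|g1 x t| - K <= 0}.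
  apply: ae_all_times.
    move=> x s Dx sJ e e0; have [d d0 Hd] := has_din_cont (dg1 Dx sJ) sJ e0.
    exists d => // u uJ us; rewrite (_ : _ - _ - _ = `|g1 x u| - `|g1 x s|); last by ring.
    by apply: (le_trans (ler_dist_dist _ _)); exact: Hd.
  move=> s sJ; have := @ae_bound (g1^~ s) 1 ler01 (ig1 sJ); rewrite mul1r => H.
  apply: ae_mono (H _) => [x h Dx|m]; first by rewrite subr_le0; exact: h.
  by rewrite mul1r; exact: c1.
apply: (@coef_has_din _ g (g1^~ t) t 1 K n ae1 tJ ltr01) => //.
- by move=> x Dx; exact: dg.
- exact: ig1.
move=> x s Dx /contrapT H sJ _.
have m0 : 0 < Num.min s t by rewrite lt_min; move: sJ tJ; rewrite !in_itv/= => /andP[-> _] /andP[].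
apply: (has_din_lipschitz null0 m0 (fun u uJ => dg Dx uJ) K0) => //; rewrite ?ge_min ?lexx ?orbT//.
move=> u /andP[mu_ uT] _; rewrite -subr_le0; apply: H => //.
by rewrite in_itv/= (lt_le_trans m0 mu_) ltW.
Qed.

(** One exceptional set for all times: both sides are continuous in time. *)
Lemma ae_series : {ae lebesgue_measure, forall x, D x -> forall t, t \in J ->
  g x t = sumr (fun n => coef (g^~ t) n * eigfun n x)}.
Proof.
pose h x t := `|g x t - sumr (fun n => coef (g^~ t) n * eigfun n x)|.
suff : {ae lebesgue_measure, forall x, D x -> forall t, t \in J -> h x t <= 0}.
  apply: ae_mono => x H Dx t tJ; have := H Dx t tJ; rewrite normr_le0 subr_eq0 => /eqP//.
apply: ae_all_times; last first.
  move=> t tJ; have := @ae_expansion (g^~ t) 1 ler01 (ig tJ) => H.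
  apply: ae_mono (H _) => [x e Dx|m]; last by rewrite mul1r; exact: c0.
  by rewrite /h e// subrr normr0.
move=> x t Dx tJ e e0; have e20 : 0 < e / 2 by rewrite divr_gt0.
have [d d0 Hd] := has_din_cont (dg Dx tJ) tJ e20.
have K1 : 0 < K + 1 by rewrite ltr_wpDl.
exists (Num.min d (e / 2 / (K + 1))); first by rewrite lt_min d0 divr_gt0.
move=> s sJ; rewrite lt_min => /andP[sd se].
have lip n : `|coef (g^~ s) n - coef (g^~ t) n| <= `|s - t| * a n.
  have m0 : 0 < Num.min s t by rewrite lt_min; move: sJ tJ; rewrite !in_itv/= => /andP[-> _] /andP[].
  have gb u : Num.min s t <= u < T -> ~ (set0 : set R) u -> `|coef (g1^~ u) n| <= a n.
    by move=> /andP[mu_ uT] _; apply: c1; rewrite in_itv/= (lt_le_trans m0 mu_) ltW.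
  have L := @has_din_lipschitz set0 (fun s => coef (g^~ s) n) (fun s => coef (g1^~ s) n) (Num.min s t) (a n) null0 m0 (fun u uJ => @coef_derive u n uJ) (a0 n) gb s t sJ tJ.
  by rewrite [leRHS]mulrC; apply: L; rewrite ge_min lexx ?orbT.
have [_ h2] := sum_bound x (normr_ge0 _) lip.
have b1 u : u \in J -> summable (fun n => coef (g^~ u) n * eigfun n x).
  by move=> uJ; have [] := @sum_bound (fun n => coef (g^~ u) n) 1 x ler01 _ => // n; rewrite mul1r c0.
have e3 : sumr (fun n => (coef (g^~ s) n - coef (g^~ t) n) * eigfun n x) =
    sumr (fun n => coef (g^~ s) n * eigfun n x) - sumr (fun n => coef (g^~ t) n * eigfun n x).
  by rewrite -sumr_sub; [congr sumr; apply/funext => n; rewrite mulrBl|exact: b1|exact: b1].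
rewrite e3 in h2.
apply: (le_trans (ler_dist_dist _ _)).
have h1 := Hd s sJ sd.
rewrite (_ : _ - _ - _ = (g x s - g x t) -
  (sumr (fun n => coef (g^~ s) n * eigfun n x) - sumr (fun n => coef (g^~ t) n * eigfun n x))); last by ring.
apply: (le_trans (ler_normB _ _)); rewrite (splitr e); apply: lerD => //; apply: (le_trans h2).
rewrite ltr_pdivlMr// in se; apply: le_trans (ltW se); apply: ler_wpM2l => //.
by rewrite lerDl.
Qed.

(** Extended by zero to all times, so that the sine series [Gam] of [g] is a measurable function on the
    whole plane. *)
Let cf n t : R := ((fun s => coef (g^~ s) n) \_ `]0, T[) t.
Let Gam (z : measurableTypeR R * measurableTypeR R) : R := sumr (fun n => cf n z.2 * eigfun n z.1).
Let hh (j : nat) : R := j.+1%:R^-1.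
Let Del (j : nat) (z : measurableTypeR R * measurableTypeR R) : R :=
  (Gam (z.1, z.2 + hh j) + Gam (z.1, z.2 - hh j) - 2 * Gam z) / hh j ^+ 2.

Let mcf n : measurable_fun setT (cf n).
Proof.
have mT : measurable ([set` `]0, T[] : set R) by exact: measurable_itv.
suff H : measurable_fun ([set` `]0, T[] : set R) (fun s => coef (g^~ s) n) by exact: (measurable_restrictT _ mT).1 H.
apply: meas_oo => t t0T.
have tJ : t \in J by case/andP: t0T => ? ?; rewrite in_itv/= ltW// andbT.
apply: (dv_cont (a := coef (g1^~ t) n)); apply: (@has_din_interior _ J); last exact: coef_derive.
by have := near_oo t0T; apply: filterS => v /andP[v0 vT]; rewrite in_itv/= v0 ltW.
Qed.

Let cf_le n t : `|cf n t| <= a n.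
Proof.
rewrite /cf patchE; case: ifPn => [|_]; last by rewrite normr0.
by rewrite inE/= in_itv/= => /andP[t0 tT]; apply: c0; rewrite in_itv/= t0 ltW.
Qed.

Let mGam : measurable_fun setT Gam.
Proof.
apply: (@measurable_fun_cvg _ _ _ setT (fun N z => series (fun n => cf n z.2 * eigfun n z.1) N)).
  move=> N; rewrite /series/=; apply: measurable_sum => n; apply: measurable_funM.
    exact: (measurableT_comp (mcf n)).
  by apply: (@measurableT_comp _ _ _ _ _ _ (eigfun n)); [exact: eigfun_meas|exact: measurable_fst].
by move=> z _; apply: (sum_bound z.1 ler01 _).1 => n; rewrite mul1r.
Qed.

Let mDel j : measurable_fun setT (Del j).
Proof.
apply: measurable_funM => //; apply: measurable_funB; last first.
  by apply: measurable_funM => //.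
apply: measurable_funD; apply: (measurableT_comp mGam); apply: measurable_fun_pair => //.
  by apply: measurable_funD.
by apply: measurable_funB.
Qed.

(** By [L_eq] this is a measurable representative of [|g2|], and [B] is the set on which the bound of the
    slices of [g2] fails. *)
Let L z : \bar R := limn_esup (fun j => (`|Del j z|)%:E).
Let B : set (measurableTypeR R * measurableTypeR R) :=
  (D `*` [set` `]0, T[]) `&` [set z | ((K * z.2 `^ (- rho))%:E < L z)%E].

Let mB : measurable B.
Proof.
apply: measurableI.
  by apply: measurableX; exact: measurable_itv.
rewrite -[X in measurable X]setTI; apply: measurable_lte => //.
  apply/measurable_EFinP; apply: measurable_funM => //.
  by apply: (measurableT_comp (measurable_powR _)).
apply: measurable_fun_limn_esup => j; apply/measurable_EFinP.
exact: measurableT_comp.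
Qed.

Let L_eq x t : D x -> 0 < t < T ->
  (forall t, t \in J -> g x t = sumr (fun n => coef (g^~ t) n * eigfun n x)) -> L (x, t) = (`|g2 x t|)%:E.
Proof.
move=> Dx t0T gE; have /andP[t0 tT] := t0T.
have GE s : 0 < s < T -> Gam (x, s) = g x s.
  move=> /andP[s0' sT]; rewrite gE ?in_itv/= ?s0' ?(ltW sT)//; congr sumr; apply/funext => n /=.
  by rewrite /cf patchE mem_set// /= in_itv/= s0'.
pose r := Num.min t (T - t).
have r0 : 0 < r by rewrite lt_min t0 subr_gt0.
have [rt rT] : r <= t /\ r <= T - t by split; rewrite ge_min lexx ?orbT.
have inJ s : t - r < s < t + r -> 0 < s < T by move=> /andP[h1 h2]; apply/andP; split; lra.
have intJ s : 0 < s < T -> \forall y \near s, y \in J.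
  by move=> sT; have := near_oo sT; apply: filterS => v /andP[v0 vT]; rewrite in_itv/= v0 ltW.
have inJ' s : 0 < s < T -> s \in J by move=> /andP[v0 vT]; rewrite in_itv/= v0 ltW.
have d1 s : t - r < s < t + r -> is_derive s 1 (g x) (g1 x s).
  by move=> /inJ sT; apply: (has_din_interior (intJ s sT)); apply: dg => //; exact: inJ'.
have d2 : is_derive t 1 (g1 x) (g2 x t).
  by apply: (has_din_interior (intJ t t0T)); apply: dg1 => //; exact: inJ'.
have cv : Del j (x, t) @[j --> \oo] --> g2 x t.
  apply/cvgrPdist_le => e e0; have [r1 r10 Hr] := second_diff_local r0 d1 d2 e0.
  have m0 : 0 < Num.min r r1 by rewrite lt_min r0.
  have := @cvg_harmonic R => /cvgrPdist_lt /(_ _ m0); apply: filterS => j.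
  rewrite sub0r normrN ger0_norm ?invr_ge0// -/(hh j) lt_min => /andP[jr jr1]; have jr' : hh j < r := jr.
  have h0 : 0 < hh j by rewrite invr_gt0.
  rewrite /Del /= !GE//; [|apply: inJ; apply/andP; split; lra..].
  have := Hr (hh j); rewrite h0 jr1 => /(_ isT) H.
  have h2 : 0 < hh j ^+ 2 by rewrite exprn_gt0.
  rewrite distrC -(ler_pM2r h2) -[X in `|_| * X](gtr0_norm h2) -normrM mulrBl divfK ?gt_eqF//.
have cv2 : (`|Del j (x, t)|)%:E @[j --> \oo] --> (`|g2 x t|)%:E.
  by apply: cvg_EFin; [exact: nearW|exact: cvg_norm].
by rewrite /L (cvg_limn_einf_sup cv2).2.
Qed.

(** As for [coef_derive], except that for almost every [x] the bound on [g2] holds at almost every time only, and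
    depends on time; it is used on [[t / 2, T]]. *)
Lemma coef_derive2 t n : t \in J -> has_din J (fun s => coef (g1^~ s) n) t (coef (g2^~ t) n).
Proof.
move=> tJ.
have Bt s : {ae lebesgue_measure, forall x, ~ B (x, s)}.
  have [s0T|s0T] := boolP (0 < s < T); last first.
    apply: (ae_mono (P := fun=> True)); last by exists set0; split => // x /=.
    by move=> x _ [[_ /=]]; rewrite in_itv/= (negbTE s0T).
  have sJ : s \in J by case/andP: s0T => ? ?; rewrite in_itv/= ltW// andbT.
  have := ae_bound (powR_ge0 s (- rho)) (ig2 sJ) (fun n => c2 n sJ).
  move=> /(ae_and ae_series); apply: ae_mono => x [H1 H2] [[/= Dx _]] /=.
  rewrite (L_eq Dx s0T (H1 Dx)) lte_fin ltNge => /negP; apply.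
  by rewrite mulrC; exact: H2.
have aeB := ae_and ae_series (ae_swap mB Bt).
have /andP[t0 tT] : 0 < t <= T by move: tJ; rewrite in_itv.
have t20 : 0 < t / 2 by rewrite divr_gt0.
pose M := K * ((t / 2) `^ (- rho) + T `^ (- rho)).
apply: (@coef_has_din _ g1 (g2^~ t) t (t / 2) M n aeB tJ t20) => //.
- by move=> x Dx; exact: dg1.
- exact: ig2.
move=> x s Dx /contrapT [H1 H2] sJ st.
have M0 : 0 <= M by rewrite mulr_ge0// addr_ge0// powR_ge0.
apply: (has_din_lipschitz (E := [set u | B (x, u)]) _ t20 (fun u uJ => dg1 Dx uJ) M0) => //.
- by apply: negligibleS H2 => u /= Bu nB; exact: nB.
- move=> u /andP[tu uT] nB; have u0T : 0 < u < T by rewrite (lt_le_trans t20).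
  have h : ~~ (K * u `^ (- rho) < `|g2 x u|).
    apply/negP => h; apply: nB; split; first by split => //=; rewrite in_itv.
    by rewrite /= (L_eq Dx u0T (H1 Dx)) lte_fin.
  rewrite -leNgt in h; apply: (le_trans h); apply: ler_wpM2l => //.
  by apply: powR_bound => //; exact: ltW.
- by move: st; rewrite ltr_norml => /andP[h1 h2]; lra.
- lra.
Qed.

End data.

(** * Continuation of the source and the bound for a mode *)

Section derivative_in_more.
Context {R : realType}.
Implicit Types (D : interval R) (f g : R -> R) (x y l : R).


Lemma has_dinM D f g x a b : x \in D -> has_din D f x a -> has_din D g x b ->
  has_din D (fun y => f y * g y) x (a * g x + f x * b).
Proof.
move=> xD hf hg.
have cg : g y @[y --> within [set` D] x^'] --> g x.
  apply/cvgrPdist_le => e e0; have [d d0 Hd] := has_din_cont hg xD e0.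
  by apply/within_dnbhsP; exists d => // y yD _ yd; rewrite distrC; exact: Hd.
have e : diff_quotient (fun y => f y * g y) x = (fun y => diff_quotient f x y * g y + f x * diff_quotient g x y).
  by apply/funext => y; rewrite /diff_quotient; ring.
rewrite /has_din e; apply: cvgD; first exact: cvgM.
by apply: cvgM; [exact: cvg_cst|].
Qed.

Lemma has_dinD D f g x a b : has_din D f x a -> has_din D g x b ->
  has_din D (fun y => f y + g y) x (a + b).
Proof.
move=> hf hg; have e : diff_quotient (fun y => f y + g y) x = (fun y => diff_quotient f x y + diff_quotient g x y).
  by apply/funext => y; rewrite /diff_quotient; ring.
by rewrite /has_din e; apply: cvgD.
Qed.

Lemma has_din_eq D f x a b : has_din D f x a -> a = b -> has_din D f x b.
Proof. by move=> h <-. Qed.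

Lemma dv_exp (lam t : R) : is_derive t 1 (fun s => expR (lam * s)) (lam * expR (lam * t)).
Proof.
have d : is_derive t 1 (fun s : R => lam * s) lam by apply: dv_eq (dvZ lam (dv_id t)) _; rewrite mulr1.
by apply: dv_eq (@dv_comp R expR (fun s => lam * s) t _ _ (is_derive_expR _) d) _; rewrite mulrC.
Qed.

(** The functions [F k] are differentiable in the ordinary sense at the points of [D], so that no one-sided
    derivatives have to be computed. *)
Lemma derive_in_chain D N (f : R -> R) (F : nat -> R -> R) :
  (forall x, x \in D -> limit_point_of D x) -> (forall x, x \in D -> f x = F 0%N x) ->
  (forall k x, (k < N)%N -> x \in D -> is_derive x 1 (F k) (F k.+1 x)) ->
  derivable_in_n D N f /\ forall k x, (k <= N)%N -> x \in D -> derive_in_n D k f x = F k x.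
Proof.
move=> acc fF dF.
have H k : (k <= N)%N -> forall x, x \in D -> derive_in_n D k f x = F k x.
  elim: k => [_ x xD|k IH kN x xD]; first exact: fF.
  apply: has_din_unique; first exact: acc.
  have {}IH y : y \in D -> F k y = derive_in_n D k f y by move=> yD; rewrite IH// ltnW.
  apply: (has_din_ext (f := F k)) => //.
  by apply: is_derive_has_din; exact: dF.
split; last by move=> k x kN; exact: H.
move=> k x kN xD; apply: (has_din_derivable (l := F k.+1 x)).
apply: (has_din_ext (f := F k)) => //; first by move=> y yD; rewrite H// ltnW.
by apply: is_derive_has_din; exact: dF.
Qed.

Lemma glue_dv (f : R -> R) x l : has_din `]-oo, x] f x l -> has_din `[x, +oo[ f x l -> is_derive x 1 f l.
Proof.
move=> /has_dinP h1 /has_dinP h2; apply: local_dv => e e0.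
have [d1 d10 H1] := h1 e e0; have [d2 d20 H2] := h2 e e0.
exists (Num.min d1 d2); first by rewrite lt_min d10.
move=> y yx; rewrite lt_min => /andP[y1 y2].
have [xy|yx'] := ltP x y; first by apply: H2 => //; rewrite in_itv/= andbT ltW.
by apply: H1 => //; rewrite in_itv.
Qed.

(** The convolution formulas need a source defined for all positive times.  Past [T] the function is continued
    by [be T + T be' T (1 - T / t)], which matches value and slope at [T] and for which [t be'] is
    bounded. *)
Lemma continuation (T A : R) (be dbe : R -> R) : 0 < T ->
  (forall t : R, t \in `]0, T] -> has_din `]0, T] be t (dbe t)) ->
  (forall t : R, t \in `]0, T] -> `|be t| <= A) -> (forall t : R, t \in `]0, T] -> `|t * dbe t| <= A) ->
  exists b b1 : R -> R, [/\ causal 1 b, causal 1 b1,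
    forall s : R, 0 < s -> is_derive s 1 b (b1 s / s),
    (forall s, `|b s| <= 2 * A) /\ (forall s, `|b1 s| <= 2 * A) &
    forall t : R, t \in `]0, T] -> b t = be t].
Proof.
move=> T0 dbe_ beA dbeA.
have TJ : T \in `]0, T] by rewrite in_itv/= T0 lexx.
have A0 : 0 <= A by exact: le_trans (beA T TJ).
pose ext t := be T + dbe T * T * (1 - T / t).
pose b (t : R) : R := if t <= 0 then 0 else if t <= T then be t else ext t.
pose b1 (t : R) : R := if t <= 0 then 0 else if t <= T then t * dbe t else dbe T * T * (T / t).
have bE t : t \in `]0, T] -> b t = be t.
  by rewrite in_itv/= /b => /andP[t0 ->]; rewrite leNgt t0.
have b1E t : t \in `]0, T] -> b1 t = t * dbe t.
  by rewrite in_itv/= /b1 => /andP[t0 ->]; rewrite leNgt t0.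
have bX t : T <= t -> b t = ext t.
  move=> Tt; have t0 : 0 < t by exact: lt_le_trans Tt.
  rewrite /b leNgt t0/=; case: ifP => // tT.
  have -> : t = T by apply/eqP; rewrite eq_le tT.
  by rewrite /ext divff ?gt_eqF// subrr mulr0 addr0.
have dext (t : R) : 0 < t -> is_derive t 1 ext (dbe T * T * (T / t) / t).
  move=> t0; have t0' : t != 0 by rewrite gt_eqF.
  have d1 := dv_powR (-1) t0.
  have d2 : is_derive t 1 (fun s : R => s^-1) (- (t^-1 * t^-1)).
    have e : (-1 : R) - 1 = - 2 by ring.
    apply: dv_near (dv_eq d1 _); last by rewrite e powRN powR_mulrn ?ltW// expr2 invfM mulN1r.
    near=> s; have s0 : 0 < s by near: s; exact: near_gt.
    by rewrite powRN powRr1// ltW.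
  apply: dv_eq (dvD (dv_cst (be T) t) (dvZ (dbe T * T) (dvB (dv_cst 1 t) (dvZ T d2)))) _.
  by field.
have db (s : R) : 0 < s -> is_derive s 1 b (b1 s / s).
  move=> s0; have s0' : s != 0 by rewrite gt_eqF.
  have [sT|Ts|sT] := ltgtP s T.
  - have sJ : s \in `]0, T] by rewrite in_itv/= s0 ltW.
    rewrite b1E// mulrAC divff// mul1r.
    apply: (@has_din_interior _ `]0, T]).
      have s0T : 0 < s < T by rewrite s0.
      by have := near_oo s0T; apply: filterS => v /andP[v0 vT]; rewrite in_itv/= v0 ltW.
    by apply: (has_din_ext (f := be)) => //; [move=> y /bE|exact: dbe_].
  - have -> : b1 s = dbe T * T * (T / s) by rewrite /b1 leNgt s0/= leNgt Ts.
    apply: dv_near (dext s s0); near=> y; rewrite bX//; apply: ltW; near: y; exact: near_gt.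
  - rewrite sT b1E// mulrAC divff ?gt_eqF// mul1r; apply: glue_dv.
      apply/has_dinP => e e0; have /has_dinP /(_ e e0)[d d0 Hd] := dbe_ T TJ.
      exists (Num.min d T); first by rewrite lt_min d0.
      move=> y; rewrite in_itv/= => yT yn; rewrite lt_min => /andP[yd yT'].
      have yJ : y \in `]0, T].
        rewrite in_itv/= yT andbT; move: yT'; rewrite ltr_norml => /andP[h _]; lra.
      by rewrite /diff_quotient !bE//; exact: Hd.
    apply: (has_din_ext (f := ext)); [by move=> y; rewrite in_itv/= andbT => /bX|by rewrite in_itv/= lexx|].
    apply: is_derive_has_din; apply: dv_eq (dext T T0) _.
    by field; rewrite gt_eqF.
have Tdb : `|dbe T * T| <= A by rewrite mulrC; exact: dbeA.
have frac t : T <= t -> 0 <= T / t <= 1.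
  move=> Tt; have t0 : 0 < t by exact: lt_le_trans Tt.
  by apply/andP; split; [rewrite divr_ge0// ltW|rewrite ler_pdivrMr// mul1r].
have AA : A <= 2 * A by rewrite -[2]/(1 + 1 : R) mulrDl mul1r lerDl.
have bA s : `|b s| <= 2 * A.
  have [s0|s0] := leP s 0; first by rewrite /b s0 normr0 mulr_ge0.
  have [sT|Ts] := leP s T; first by rewrite bE ?in_itv/= ?s0 ?sT// (le_trans _ AA)// beA// in_itv/= s0.
  rewrite (bX _ (ltW Ts)) /ext (le_trans (ler_normD _ _))// -[2]/(1 + 1 : R) mulrDl mul1r lerD ?beA//.
  rewrite normrM; apply: le_trans Tdb; rewrite ler_piMr//.
  have /andP[h1 h2] := frac s (ltW Ts); rewrite ger0_norm ?subr_ge0//.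
  by rewrite gerBl.
have b1A s : `|b1 s| <= 2 * A.
  have [s0|s0] := leP s 0; first by rewrite /b1 s0 normr0 mulr_ge0.
  have [sT|Ts] := leP s T; first by rewrite b1E ?in_itv/= ?s0 ?sT// (le_trans _ AA)// dbeA// in_itv/= s0.
  have -> : b1 s = dbe T * T * (T / s) by rewrite /b1 !leNgt s0 Ts.
  rewrite (le_trans _ AA)// normrM; apply: le_trans Tdb; rewrite ler_piMr//.
  by have /andP[h1 h2] := frac s (ltW Ts); rewrite ger0_norm.
have b0 t : t <= 0 -> b t = 0 by rewrite /b => ->.
have b10 t : t <= 0 -> b1 t = 0 by rewrite /b1 => ->.
have mb : measurable_fun setT b by apply: meas_causal => // t t0; exact: dv_cont (db t t0).
have loc (u : R -> R) : (forall t, t <= 0 -> u t = 0) -> (forall s, `|u s| <= 2 * A) ->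
    forall S : R, 0 < S -> exists2 B : R, 0 <= B & forall t : R, t <= S -> `|u t| <= B * kp 1 t.
  move=> u0 uA S _; exists (2 * A) => [|t _]; first by rewrite mulr_ge0.
  have [t0|t0] := leP t 0; first by rewrite u0// normr0 mulr_ge0 ?mulr_ge0// kp_ge0.
  by rewrite kpE// subrr powRr0 mulr1.
exists b, b1; split => //.
- by split => //; exact: loc.
- split => //; last exact: loc.
  pose P : set R := [set` `]0, +oo[].
  have mP : measurable P by exact: measurable_itv.
  have -> : b1 = (fun t => t * (b1 t / t)) \_ P.
    apply/funext => t; rewrite patchE; case: ifPn => [|nP].
      by rewrite /P inE/= in_itv/= andbT => t0; field; rewrite gt_eqF.
    by apply: b10; rewrite leNgt; apply: contra nP => t0; rewrite /P inE/= in_itv/= t0.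
  suff H : measurable_fun P (fun t => t * (b1 t / t)) by exact: (measurable_restrictT _ mP).1 H.
  apply: measurable_funM => //.
  (* a derivative is a limit of difference quotients *)
  apply: (@measurable_fun_cvg _ _ _ P (fun n t => (b (t + n.+1%:R^-1) - b t) / n.+1%:R^-1)).
    move=> n; apply: measurable_funTS; apply: measurable_funM => //; apply: measurable_funB => //.
    by apply: (measurableT_comp mb); exact: measurable_funD.
  move=> t; rewrite /P/= in_itv/= andbT => t0.
  have h := @is_derive_has_din R `]-oo, +oo[ _ _ _ (db t t0).
  have pos n : 0 < n.+1%:R^-1 :> R by rewrite invr_gt0.
  have := has_din_seq (s := fun n => t + n.+1%:R^-1) h.
  have e : (fun n => diff_quotient b t (t + n.+1%:R^-1)) = (fun n => (b (t + n.+1%:R^-1) - b t) / n.+1%:R^-1).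
    by apply/funext => n; rewrite /diff_quotient; congr (_ / _); ring.
  rewrite e; apply.
  + by move=> n; rewrite in_itv.
  + by move=> n; rewrite -subr_eq0 (_ : t + _ - t = n.+1%:R^-1) ?gt_eqF//; ring.
  + rewrite -[X in _ --> X]addr0; apply: cvgD; first exact: cvg_cst.
    exact: (@cvg_harmonic R).
Unshelve. all: by end_near. Qed.

Lemma one_sided_lipschitz (u v k K s t : R) : - (t - s) <= u - v - k * (s - t) ->
  k * (t - s) <= K * (t - s) -> v - u <= (K + 1) * (t - s).
Proof. by move=> h1 h2; lra. Qed.

(** A mode is bounded by its initial value and by the maximum of its source divided by [m]: at a
    maximum exceeding this bound the Caputo derivative would be negative. *)
Lemma mode_bound (al Ga m g0 sg M T : R) (b b1 : R -> R) : 0 < al < 1 -> 0 < Ga -> 0 < m ->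
  causal 1 b -> (forall s : R, 0 < s -> is_derive s 1 b (b1 s / s)) -> 0 < T -> `|sg| <= M ->
  (forall t, 0 < t <= T -> `|mode_src g0 b t| <= m * M) ->
  forall t, 0 <= t <= T -> `|mode al Ga m g0 sg b t| <= M.
Proof.
move=> al01 Ga0 m0 cb db T0 sgM srcM.
pose U := mode al Ga m g0 sg b; pose dU := mode_dt al Ga m g0 sg b.
have cU0 s : {for s, continuous U} by exact: (@mode_cont R al Ga m g0 sg b b1 al01 Ga0 m0 cb db s).
have key (e : R) : `|e| = 1 -> forall t, 0 <= t <= T -> e * U t <= M.
  move=> e1 t tT.
  have cU : {within `[0, T], continuous (fun s => e * U s)}.
    by apply: continuous_subspaceT => s; apply: cvgM; [exact: cvg_cst|exact: cU0].
  have [t0 t0T Umax] := EVT_max (ltW T0) cU.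
  have {}Umax s : 0 <= s <= T -> e * U s <= e * U t0 by move=> sT; apply: Umax; rewrite in_itv.
  have {t0T}/andP[t00 t0T] : 0 <= t0 <= T by move: t0T; rewrite in_itv.
  apply: (le_trans (Umax t tT)); rewrite leNgt; apply/negP => big.
  have sgle : e * sg <= M by apply: (le_trans (ler_norm _)); rewrite normrM e1 mul1r.
  have t0p : 0 < t0.
    rewrite lt_neqAle t00 andbT; apply/eqP => z; move: big.
    by rewrite -z /U (mode_le0 g0 sg al01 Ga0 m0 cb db)// ltNge sgle.
  have dUt (s : R) : 0 < s -> is_derive s 1 (fun s => e * U s) (e * dU s).
    by move=> s0; apply: dvZ; exact: (mode_derive g0 sg al01 Ga0 m0 cb db).
  have iU := mode_caputo_intg g0 sg al01 Ga0 m0 cb db t0p.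
  have eU : (fun s => (t0 - s) `^ (- al) * (e * dU s)) = (fun s => e * ((t0 - s) `^ (- al) * dU s)).
    by apply/funext => s; rewrite mulrCA.
  have mI : measurable ([set` `]0, t0[] : set R) by exact: measurable_itv.
  have [r r0 Hr] := dv_local (dUt t0 t0p) (@ltr01 R).
  have L : 0 <= RI `]0, t0[ (fun s => (t0 - s) `^ (- al) * (e * dU s)).
    apply: (@caputo_ge0_at_max R al t0 (`|e * dU t0| + 1) r (fun s => e * U s) (fun s => e * dU s) al01 t0p r0).
    - by move=> s /andP[s0 _]; exact: dUt.
    - move=> s /andP[s0 _]; apply: cvgM; first exact: cvg_cst.
      exact: (@mode_dt_cont R al Ga m g0 sg b b1 al01 Ga0 m0 cb db s).
    - by rewrite eU; exact: intgZ.
    - by move=> s /andP[s0 st]; apply: Umax; rewrite (ltW s0) (le_trans (ltW st)).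
    - move=> s /andP[s1 s2].
      have n1 : `|s - t0| = t0 - s by rewrite distrC gtr0_norm ?subr_gt0.
      have := Hr s; rewrite n1 => /(_ _) H; have {}H := H ltac:(by rewrite ltrBlDr -ltrBlDl).
      rewrite mul1r ler_norml in H; case/andP: H => H _.
      have H2 : e * dU t0 * (t0 - s) <= `|e * dU t0| * (t0 - s).
        by apply: ler_wpM2r; [rewrite subr_ge0 ltW|exact: ler_norm].
      exact: (one_sided_lipschitz H H2).
  rewrite eU RI_Z// (mode_caputo g0 sg al01 Ga0 m0 cb db t0p) mulrCA pmulr_rge0// -/U in L.
  have s1 : e * mode_src g0 b t0 <= m * M.
    by apply: (le_trans (ler_norm _)); rewrite normrM e1 mul1r; apply: srcM; rewrite t0p.
  have s2 : m * M < m * (e * U t0) by rewrite ltr_pM2l.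
  rewrite mulrBr mulrCA in L; lra.
move=> t tT; rewrite ler_norml -/U; apply/andP; split.
  have := key (-1) _ t tT; rewrite normrN1 mulN1r lerNl => H; exact: H.
by have := key 1 _ t tT; rewrite normr1 mul1r => H; exact: H.
Qed.

End derivative_in_more.

(** * All modes at once *)

Section modes.
Context {R : realType}.
Implicit Types (t s : R) (n : nat).

(** With [be] the derivative of [e^(lam t) ga], the bounds on the data give bounds on [be] and [t be'], so that
    [continuation] applies; all constants are independent of [n]. *)
Lemma modes_exist (al lam T Ga q C rho : R) (m a sg : nat -> R) (ga ga1 ga2 : nat -> R -> R) :
  0 < al < 1 -> 0 <= lam -> 0 < T -> 0 < Ga -> 0 < q -> 0 <= C -> rho < 1 ->
  (forall n, q <= m n) -> (forall n, 0 <= a n) ->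
  (forall n t, t \in `]0, T] -> has_din `]0, T] (ga n) t (ga1 n t)) ->
  (forall n t, t \in `]0, T] -> has_din `]0, T] (ga1 n) t (ga2 n t)) ->
  (forall n, `|sg n| * m n ^+ 2 <= C * a n) ->
  (forall n t, t \in `]0, T] -> `|ga n t| * m n ^+ 2 <= C * a n) ->
  (forall n t, t \in `]0, T] -> `|ga1 n t| <= C * a n) ->
  (forall n t, t \in `]0, T] -> `|ga2 n t| <= t `^ (- rho) * (C * a n)) ->
  exists (U dU ddU : nat -> R -> R) (C' : R), [/\ 0 <= C',
    [/\ (forall n t, 0 < t -> is_derive t 1 (U n) (dU n t)),
      (forall n t, 0 < t -> is_derive t 1 (dU n) (ddU n t)),
      (forall n t, {for t, continuous (U n)}) &
      (forall n, U n 0 = sg n)],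
    [/\ (forall n t, 0 <= t <= T -> `|U n t| * m n ^+ 2 <= C' * a n),
      (forall n t, 0 < t <= 2 * T -> `|dU n t| <= C' * t `^ (al - 1) * a n) &
      (forall n t, 0 < t <= 2 * T -> `|ddU n t| <= C' * t `^ (al - 2) * a n)] &
    forall n t, t \in `]0, T] ->
      RI `]0, t[ (fun s => (t - s) `^ (- al) * dU n s) = Ga * (expR (lam * t) * ga n t - m n * U n t)].
Proof.
move=> al01 lam0 T0 Ga0 q0 C0 rho1 qm a0 dga dga1 sgC gaC ga1C ga2C.
have m0 n : 0 < m n by exact: lt_le_trans (qm n).
have TJ : T \in `]0, T] by rewrite in_itv/= T0 lexx.
pose X t := expR (lam * t).
have X0 t : 0 <= X t by exact: expR_ge0.
have XT t : t \in `]0, T] -> X t <= X T.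
  by rewrite in_itv/= => /andP[_ tT]; rewrite ler_expR ler_wpM2l.
have dX t : has_din `]0, T] X t (lam * X t) by apply: is_derive_has_din; exact: dv_exp.
pose G n t := X t * ga n t.
pose be n t := lam * X t * ga n t + X t * ga1 n t.
pose dbe n t := lam * (lam * X t) * ga n t + lam * X t * ga1 n t + (lam * X t * ga1 n t + X t * ga2 n t).
have dG n t : t \in `]0, T] -> has_din `]0, T] (G n) t (be n t).
  by move=> tJ; apply: has_dinM => //; exact: dga.
have dlX t : has_din `]0, T] (fun s => lam * X s) t (lam * (lam * X t)).
  by apply: is_derive_has_din; apply: dvZ; exact: dv_exp.
have dbe_ n t : t \in `]0, T] -> has_din `]0, T] (be n) t (dbe n t).
  by move=> tJ; apply: has_dinD; apply: has_dinM => //; [exact: dga|exact: dga1].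
pose Q := (q ^+ 2)^-1.
have Q0 : 0 <= Q by rewrite invr_ge0 exprn_ge0// ltW.
have q20 : 0 < q ^+ 2 by rewrite exprn_gt0.
have qm2 n : q ^+ 2 <= m n ^+ 2 by apply: lerXn2r => //; rewrite nnegrE ltW.
have ga_le n t : t \in `]0, T] -> `|ga n t| <= Q * (C * a n).
  move=> tJ; rewrite mulrC ler_pdivlMr//; apply: le_trans (gaC n t tJ).
  by apply: ler_wpM2l.
pose Cb := X T * (lam * Q + 1) + (X T * (T * (lam * lam) * Q + 2 * T * lam) + X T * T `^ (1 - rho)).
have P1 : 0 <= X T * (lam * Q + 1) by rewrite mulr_ge0// addr_ge0// mulr_ge0.
have P2 : 0 <= X T * (T * (lam * lam) * Q + 2 * T * lam).
  by rewrite mulr_ge0// addr_ge0// ?mulr_ge0// ltW.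
have P3 : 0 <= X T * T `^ (1 - rho) by rewrite mulr_ge0// powR_ge0.
have CbE : 0 <= Cb by rewrite addr_ge0// addr_ge0.
have ca n : 0 <= C * a n by rewrite mulr_ge0.
have nX t : `|X t| = X t by rewrite ger0_norm.
have nl : `|lam| = lam by rewrite ger0_norm.
have beA n t : t \in `]0, T] -> `|be n t| <= Cb * (C * a n).
  move=> tJ; apply: (@le_trans _ _ (X T * (lam * Q + 1) * (C * a n))); last first.
    by rewrite ler_wpM2r// lerDl addr_ge0.
  rewrite /be (_ : _ + _ = X t * (lam * ga n t + ga1 n t)); last by ring.
  rewrite normrM nX -mulrA; apply: ler_pM => //; first exact: XT.
  rewrite mulrDl mul1r; apply: (le_trans (ler_normD _ _)); apply: lerD; last exact: ga1C.
  by rewrite normrM nl -mulrA ler_wpM2l// ga_le.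
have dbeA n t : t \in `]0, T] -> `|t * dbe n t| <= Cb * (C * a n).
  move=> tJ; have /andP[t0 tT] : 0 < t <= T by move: tJ; rewrite in_itv.
  apply: (@le_trans _ _ ((X T * (T * (lam * lam) * Q + 2 * T * lam) + X T * T `^ (1 - rho)) * (C * a n))); last first.
    by rewrite ler_wpM2r// lerDr.
  rewrite (_ : t * dbe n t = X t * (t * (lam * lam) * ga n t + 2 * t * lam * ga1 n t + t * ga2 n t)); last by rewrite /dbe; ring.
  rewrite normrM nX -[X T * _ + X T * _]mulrDr -[leRHS]mulrA; apply: ler_pM => //; first exact: XT.
  rewrite 2![_ * (C * a n)]mulrDl; apply: (le_trans (ler_normD _ _)); apply: lerD; first apply: (le_trans (ler_normD _ _)); first apply: lerD.
  - rewrite normrM ger0_norm ?mulr_ge0 ?(ltW t0)// -[leRHS]mulrA; apply: ler_pM => //.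
    + by rewrite mulr_ge0 ?mulr_ge0// ltW.
    + by apply: ler_wpM2r => //; rewrite mulr_ge0.
    + exact: ga_le.
  - rewrite normrM ger0_norm ?mulr_ge0 ?(ltW t0)//; apply: ler_pM => //.
    + by rewrite mulr_ge0// mulr_ge0// ltW.
    + by apply: ler_wpM2r => //; apply: ler_wpM2l.
    + exact: ga1C.
  - rewrite normrM gtr0_norm//; apply: (@le_trans _ _ (t * (t `^ (- rho) * (C * a n)))).
      by apply: ler_wpM2l; [exact: ltW|exact: ga2C].
    rewrite mulrA; apply: ler_wpM2r => //.
    have -> : t * t `^ (- rho) = t `^ (1 - rho).
      by rewrite powRD ?(gt_eqF t0) ?implybT// powRr1// ltW.
    by apply: powR_le => //; [rewrite subr_ge0 ltW|exact: ltW].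
have /choice[b Hb] := fun n => continuation T0 (dbe_ n) (beA n) (dbeA n).
have /choice[b1 {}Hb] := Hb.
pose A n := 2 * (Cb * (C * a n)).
have cb n : causal 1 (b n) by case: (Hb n).
have cb1 n : causal 1 (b1 n) by case: (Hb n).
have db n s : 0 < s -> is_derive s 1 (b n) (b1 n s / s) by case: (Hb n) => _ _ + _ _; apply.
have bA n s : `|b n s| <= A n by case: (Hb n) => _ _ _ [+ _] _; apply.
have b1A n s : `|b1 n s| <= A n by case: (Hb n) => _ _ _ [_ +] _; apply.
have bE n t : t \in `]0, T] -> b n t = be n t by case: (Hb n) => _ _ _ _; apply.
have A0 n : 0 <= A n by rewrite mulr_ge0// mulr_ge0.
(* the source [G n] is only given for positive times; [g0 n] is its limit at zero *)
pose g0 n := G n T - conv (kp 1) (b n) T.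
have src n t : t \in `]0, T] -> mode_src (g0 n) (b n) t = G n t.
  rewrite in_itv/= => /andP[t0 tT].
  have cvT : conv (kp 1) (b n) T = conv (kp 1) (b n) T by [].
  pose F s := mode_src (g0 n) (b n) s - G n s.
  have dF s : s \in `]0, T] -> has_din `]0, T] F s 0.
    move=> sJ; have s0 : 0 < s by move: sJ; rewrite in_itv => /andP[].
    have h1 : has_din `]0, T] (mode_src (g0 n) (b n)) s (b n s).
      by apply: is_derive_has_din; exact: (mode_src_derive (g0 n) (cb n) (db n)).
    have h2 : has_din `]0, T] (fun s => -1 * G n s) s (0 * G n s + -1 * be n s).
      by apply: has_dinM => //; [apply: is_derive_has_din; exact: dv_cst|exact: dG].
    apply: (has_din_ext (f := fun s => mode_src (g0 n) (b n) s + -1 * G n s)) => //.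
      by move=> y _; rewrite /F mulN1r.
    by apply: has_din_eq (has_dinD h1 h2) _; rewrite bE//; ring.
  have neg0 : lebesgue_measure.-negligible (set0 : set R) by exact: negligible_set0.
  have L := @has_din_lipschitz R T set0 F (fun=> 0) t 0 neg0 t0 dF (lexx 0).
  have : `|F t - F T| <= 0 * `|t - T|.
    by apply: L => //; [move=> s _ _; rewrite normr0|rewrite in_itv/= t0].
  rewrite mul0r normr_le0 subr_eq0 => /eqP FtT.
  have FT : F T = 0 by rewrite /F /mode_src /g0 subrK subrr.
  by move/eqP: FtT; rewrite FT /F subr_eq0 => /eqP.
pose U n := mode al Ga (m n) (g0 n) (sg n) (b n).
pose dU n := mode_dt al Ga (m n) (g0 n) (sg n) (b n).
pose ddU n := mode_dtt al Ga (m n) (g0 n) (sg n) (b n) (b1 n).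
pose S := q^-1 * X T + 1.
have S0 : 1 <= S by rewrite lerDr mulr_ge0// invr_ge0 ltW.
have Ub n t : 0 <= t <= T -> `|U n t| * m n ^+ 2 <= S * C * a n.
  move=> tT; have m2 : 0 < m n ^+ 2 by rewrite exprn_gt0.
  rewrite -ler_pdivlMr//; apply: (mode_bound al01 Ga0 (m0 n) (cb n) (db n) T0) => //.
    rewrite ler_pdivlMr// -mulrA; apply: (le_trans (sgC n)).
    by rewrite ler_peMl.
  move=> s s0T; rewrite src ?in_itv//.
  have sJ : s \in `]0, T] by rewrite in_itv.
  rewrite mulrA ler_pdivlMr// /G normrM nX.
  have h : X s * (`|ga n s| * m n ^+ 2) <= X T * (C * a n).
    by apply: ler_pM => //; [rewrite mulr_ge0// ltW|exact: XT|exact: gaC].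
  rewrite -(mulrA (X s)); apply: (le_trans h).
  rewrite (_ : m n * (S * C * a n) = m n * S * (C * a n)); last by ring.
  apply: ler_wpM2r => //.
  apply: (@le_trans _ _ (q * S)); last by rewrite ler_wpM2r// (le_trans ler01).
  by rewrite /S mulrDr mulrA divff ?gt_eqF// mul1r mulr1 lerDl ltW.
pose Bc := conv (kp al) (kp 1) 1 : R.
have Bc0 : 0 <= Bc by apply: Rintegral_ge0 => s _; rewrite mulr_ge0 ?kp_ge0.
have mcA n : `|mc (m n) (g0 n) (sg n)| <= (X T * Q + 2 * Cb * T + q^-1) * (C * a n).
  rewrite /mc /g0 2![_ * (C * a n)]mulrDl; apply: (le_trans (ler_normB _ _)); apply: lerD.
    apply: (le_trans (ler_normB _ _)); apply: lerD.
      rewrite /G normrM nX -mulrA; apply: ler_wpM2l => //; exact: ga_le.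
    have [iT ->] := conv1E ltr01 (cb n) T0.
    have mI : measurable ([set` `]0, T]] : set R) by exact: measurable_itv.
    have lT : lebesgue_measure ([set` `]0, T]] : set R) = T%:E.
      by rewrite lebesgue_measure_itv/= lte_fin T0 -EFinB subr0.
    have ic : intg `]0, T] (fun=> A n) by apply: intg_cst => //; rewrite lT ltry.
    apply: (le_trans (RI_norm_le mI (intg_meas mI iT) ic (fun s _ => bA n s))).
    have -> : RI `]0, T] (fun=> A n) = A n * T by rewrite Rintegral_cst// -[RHS]/(A n * fine T%:E) -lT.
    by rewrite /A (_ : 2 * Cb * T * (C * a n) = 2 * (Cb * (C * a n)) * T)//; ring.
  rewrite normrM (gtr0_norm (m0 n)) mulrC ler_pdivlMl// mulrC.
  apply: le_trans (sgC n); rewrite (_ : q * (m n * `|sg n|) = `|sg n| * (q * m n)); last by ring.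
  by apply: ler_wpM2l => //; rewrite expr2; apply: ler_wpM2r => //; exact: ltW.
have kap0 : 0 < kap al Ga by exact: kap_gt0.
pose M := 4 * kap al Ga * ((X T * Q + 2 * Cb * T + q^-1) + 2 * Cb * Bc * (2 * T)) * C.
have M1 n t : 0 < t <= 2 * T ->
    `|mc (m n) (g0 n) (sg n)| + A n * Bc * t <= ((X T * Q + 2 * Cb * T + q^-1) + 2 * Cb * Bc * (2 * T)) * (C * a n).
  move=> /andP[t0 tT]; rewrite mulrDl; apply: lerD; first exact: mcA.
  rewrite /A (_ : 2 * Cb * Bc * (2 * T) * (C * a n) = 2 * (Cb * (C * a n)) * Bc * (2 * T)); last by ring.
  by apply: ler_wpM2l => //; rewrite mulr_ge0//; exact: A0.
have Z0 n t : 0 < t -> 0 <= `|mc (m n) (g0 n) (sg n)| + A n * Bc * t.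
  by move=> t0; rewrite addr_ge0// mulr_ge0 ?mulr_ge0 ?A0// ltW.
have M0 : 0 <= M.
  rewrite /M mulr_ge0// mulr_ge0//; first by rewrite mulr_ge0// ltW.
  by rewrite !addr_ge0 ?mulr_ge0 ?invr_ge0// ltW.
have ME n : M * a n = 4 * kap al Ga * (((X T * Q + 2 * Cb * T + q^-1) + 2 * Cb * Bc * (2 * T)) * (C * a n)).
  by rewrite /M -!mulrA.
exists U, dU, ddU, (S * C + M); split.
- by rewrite addr_ge0// mulr_ge0// (le_trans ler01).
- split.
  + by move=> n t t0; exact: (mode_derive (g0 n) (sg n) al01 Ga0 (m0 n) (cb n) (db n) t0).
  + by move=> n t t0; exact: (mode_dt_derive (g0 n) (sg n) al01 Ga0 (m0 n) (cb n) (cb1 n) (db n) t0).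
  + by move=> n t; exact: (@mode_cont R al Ga (m n) (g0 n) (sg n) (b n) (b1 n) al01 Ga0 (m0 n) (cb n) (db n) t).
  + by move=> n; exact: (mode_le0 (g0 n) (sg n) al01 Ga0 (m0 n) (cb n) (db n) (lexx 0)).
- split.
  + by move=> n t tT; apply: (le_trans (Ub n t tT)); rewrite ler_wpM2r// lerDl.
  + move=> n t tT; have /andP[t0 _] := tT.
    have H := mode_dt_le (g0 n) (sg n) al01 Ga0 (m0 n) (cb n) (bA n) t0; apply: (le_trans H).
    rewrite [_ * t `^ _ * a n]mulrAC; apply: ler_wpM2r; first exact: powR_ge0.
    apply: (@le_trans _ _ (M * a n)); last by apply: ler_wpM2r => //; rewrite lerDr mulr_ge0// (le_trans ler01).
    rewrite ME.
    apply: ler_pM; [exact: ltW|exact: Z0| |exact: M1].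
    by rewrite ler_peMl ?ltW// ltr1n.
  + move=> n t tT; have /andP[t0 _] := tT.
    have H := mode_dtt_le (g0 n) (sg n) al01 Ga0 (m0 n) (cb n) (cb1 n) (bA n) (b1A n) t0; apply: (le_trans H).
    rewrite [_ * t `^ _ * a n]mulrAC; apply: ler_wpM2r; first exact: powR_ge0.
    apply: (@le_trans _ _ (M * a n)); last by apply: ler_wpM2r => //; rewrite lerDr mulr_ge0// (le_trans ler01).
    rewrite ME.
    by apply: ler_wpM2l; [rewrite mulr_ge0// ltW|exact: M1].
- move=> n t tJ; have t0 : 0 < t by move: tJ; rewrite in_itv => /andP[].
  by rewrite (mode_caputo (g0 n) (sg n) al01 Ga0 (m0 n) (cb n) (db n) t0) src.
Qed.

End modes.

(** * The series solution *)

Section solution_series.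
Context {R : realType}.
Variables (sigma q xl xr al T Ga lam C : R).
Hypotheses (hx : xl < xr) (s0 : 0 < sigma) (q0 : 0 < q) (al01 : 0 < al < 1) (T0 : 0 < T) (C0 : 0 <= C).
Variables (a : nat -> R) (U dU ddU ga : nat -> R -> R).
Hypotheses (a0 : forall n, 0 <= a n) (sa : summable a).
Implicit Types (x t s : R) (n p : nat).

Notation freq := (freq xl xr).
Notation eigfun := (eigfun xl xr).
Notation m := (eigval sigma q xl xr).

Hypothesis dU_ : forall n t, 0 < t -> is_derive t 1 (U n) (dU n t).
Hypothesis ddU_ : forall n t, 0 < t -> is_derive t 1 (dU n) (ddU n t).
Hypothesis cU : forall n t, {for t, continuous (U n)}.
Hypothesis U_le : forall n t, 0 <= t <= T -> `|U n t| * m n ^+ 2 <= C * a n.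
Hypothesis dU_le : forall n t, 0 < t <= 2 * T -> `|dU n t| <= C * t `^ (al - 1) * a n.
Hypothesis ddU_le : forall n t, 0 < t <= 2 * T -> `|ddU n t| <= C * t `^ (al - 2) * a n.
Hypothesis ga_le : forall n t, t \in `]0, T] -> `|ga n t| <= C * a n.
Hypothesis caputoU : forall n t, t \in `]0, T] ->
  RI `]0, t[ (fun s => (t - s) `^ (- al) * dU n s) = Ga * (expR (lam * t) * ga n t - m n * U n t).

Let sc : R := Num.sqrt (2 / (xr - xl)).
Let sc0 : 0 <= sc. Proof. exact: sqrtr_ge0. Qed.

(** The [p]-th derivative of [eigfun n]. *)
Definition eigfun_dx p n x : R := Num.sqrt (2 / (xr - xl)) * freq n ^+ p * sin (freq n * (x - xl) + p%:R * (pi / 2)).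

Lemma eigfun_dx0 n x : eigfun_dx 0 n x = eigfun n x.
Proof. by rewrite /eigfun_dx expr0 mulr1 mul0r addr0. Qed.

Lemma eigfun_dx2 n x : eigfun_dx 2 n x = - freq n ^+ 2 * eigfun n x.
Proof.
rewrite /eigfun_dx /eigfun (_ : 2%:R * (pi / 2) = pi); last by field.
by rewrite sinDpi; ring.
Qed.

Lemma eigfun_dx_derive p n x : is_derive x 1 (eigfun_dx p n) (eigfun_dx p.+1 n x).
Proof.
have d : is_derive x 1 (fun y => freq n * (y - xl) + p%:R * (pi / 2)) (freq n).
  by apply: dv_eq (dvD (dv_affine (freq n) xl x) (dv_cst _ x)) _; rewrite addr0.
apply: dv_eq (dvZ (sc * freq n ^+ p) (@dv_comp R sin (fun y => freq n * (y - xl) + p%:R * (pi / 2)) x _ _ (is_derive_sin _) d)) _.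
rewrite -sinDpihalf /eigfun_dx -/sc (_ : freq n * (x - xl) + p.+1%:R * (pi / 2) = freq n * (x - xl) + p%:R * (pi / 2) + pi / 2); last first.
  by rewrite -natr1 mulrDl mul1r addrA.
by rewrite exprS; ring.
Qed.

(** [freq n <= 1 + freq n ^ 2 <= Cm * m n], whence powers up to the fourth cost at most [m n ^ 2]. *)
Let Cm : R := q^-1 + 2 / sigma ^+ 2.
Let K : R := C * (sc * Cm ^+ 2).

Let Cm0 : 0 <= Cm.
Proof. by rewrite addr_ge0 ?invr_ge0 ?divr_ge0 ?exprn_ge0// ltW. Qed.

Lemma freq_pow p n : (p <= 4)%N -> freq n ^+ p <= Cm ^+ 2 * m n ^+ 2.
Proof.
move=> p4; have o0 : 0 < freq n by exact: freq_gt0.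
have h1 : freq n ^+ p <= (1 + freq n ^+ 2) ^+ 2.
  have o2 : 0 <= freq n ^+ 2 by exact: sqr_ge0.
  have [le1|ge1] := leP (freq n) 1.
    apply: (@le_trans _ _ 1); first by apply: exprn_ile1 => //; exact: ltW.
    by apply: exprn_ege1; rewrite lerDl.
  apply: (@le_trans _ _ (freq n ^+ 4)); first by apply: ler_weXn2l => //; exact: ltW.
  rewrite (_ : 4 = 2 * 2)%N// exprM; apply: lerXn2r; rewrite ?nnegrE ?addr_ge0//.
  by rewrite lerDr.
apply: (le_trans h1); rewrite -exprMn; apply: lerXn2r.
- by rewrite nnegrE addr_ge0// sqr_ge0.
- by rewrite nnegrE mulr_ge0// ltW// eigval_gt0.
rewrite /Cm /eigval [leRHS](_ : _ = 1 + freq n ^+ 2 + (q^-1 * (sigma ^+ 2 / 2 * freq n ^+ 2) + 2 / sigma ^+ 2 * q)); last first.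
  by field; rewrite !gt_eqF.
have qp := ltW q0; have s2 : 0 <= sigma ^+ 2 by exact: sqr_ge0.
rewrite lerDl; apply: addr_ge0; last by apply: mulr_ge0 => //; rewrite divr_ge0.
apply: mulr_ge0; first by rewrite invr_ge0.
by apply: mulr_ge0; [rewrite divr_ge0|exact: sqr_ge0].
Qed.

Lemma eigfun_dx_le p n x : `|eigfun_dx p n x| <= sc * freq n ^+ p.
Proof.
rewrite /eigfun_dx normrM ger0_norm; last by rewrite mulr_ge0 ?exprn_ge0// ltW// freq_gt0.
by apply: ler_piMr (sin_max _); rewrite mulr_ge0 ?exprn_ge0// ltW// freq_gt0.
Qed.

Let K0 : 0 <= K. Proof. by rewrite !mulr_ge0// exprn_ge0. Qed.

Lemma term_le p n x t : (p <= 4)%N -> 0 <= t <= T -> `|U n t * eigfun_dx p n x| <= K * a n.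
Proof.
move=> p4 tT; rewrite normrM.
apply: (@le_trans _ _ (`|U n t| * (sc * (Cm ^+ 2 * m n ^+ 2)))).
  by apply: ler_wpM2l => //; apply: (le_trans (eigfun_dx_le p n x)); apply: ler_wpM2l => //; exact: freq_pow.
rewrite (_ : `|U n t| * _ = `|U n t| * m n ^+ 2 * (sc * Cm ^+ 2)); last by ring.
rewrite (_ : K * a n = C * a n * (sc * Cm ^+ 2)) 1?[LHS]mulrAC//; apply: ler_wpM2r; first by rewrite mulr_ge0// exprn_ge0.
exact: U_le.
Qed.

Let sK : summable (fun n => K * a n). Proof. exact: summableZ. Qed.

(** [V p] is the [p]-th derivative in [x] of the series solution, and [Vt], [Vtt] are its time derivatives. *)
Definition V p x t : R := sumr (fun n => U n t * eigfun_dx p n x).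
Definition Vt x t : R := sumr (fun n => dU n t * eigfun n x).
Definition Vtt x t : R := sumr (fun n => ddU n t * eigfun n x).

Lemma V_derive p x t : (p < 4)%N -> 0 <= t <= T -> is_derive x 1 (V p ^~ t) (V p.+1 x t).
Proof.
move=> p4 tT.
apply: (@sumr_is_derive R (fun n y => U n t * eigfun_dx p n y) (fun n y => U n t * eigfun_dx p.+1 n y) (fun n => K * a n) (x - 1) (x + 1)).
- by rewrite ltrBlDr ltrDl ltr01.
- exact: sK.
- by move=> n y _; apply: dvZ; exact: eigfun_dx_derive.
- by move=> n y _; exact: term_le.
- by move=> y _; apply: summable_le sK => n; apply: term_le => //; exact: ltnW.
Qed.

Lemma V_bound p x t : (p <= 4)%N -> 0 <= t <= T -> `|V p x t| <= sumr (fun n => K * a n).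
Proof. by move=> p4 tT; apply: sumr_norm_le => // n; exact: term_le. Qed.

Lemma eigfun_term_le (c : R) (B : R) n x : `|c| <= B * a n -> `|c * eigfun n x| <= B * sc * a n.
Proof.
by move=> cB; rewrite normrM mulrAC; apply: ler_pM => //; exact: eigfun_norm.
Qed.

Let pow2 t s (p : R) : 0 < t -> t / 2 < s < 2 * T -> s `^ p <= (t / 2) `^ p + (2 * T) `^ p.
Proof. by move=> t0 /andP[h1 h2]; apply: powR_bound; [rewrite divr_gt0|exact: ltW..]. Qed.

Lemma Vt_derive x t : 0 < t < 2 * T -> is_derive t 1 (V 0 x) (Vt x t).
Proof.
move=> /andP[t0 tT].
pose P := (t / 2) `^ (al - 1) + (2 * T) `^ (al - 1).
have P0 : 0 <= P by rewrite addr_ge0// powR_ge0.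
have inI s : t / 2 < s < 2 * T -> 0 < s <= 2 * T.
  by move=> /andP[h1 h2]; rewrite (ltW h2) andbT; apply: lt_trans h1; rewrite divr_gt0.
have dle n s : t / 2 < s < 2 * T -> `|dU n s| <= C * P * a n.
  move=> sI; apply: (le_trans (dU_le n (inI s sI))); apply: ler_wpM2r => //.
  by apply: ler_wpM2l => //; exact: pow2.
have sCP (B : R) : summable (fun n => B * a n) by exact: summableZ.
have -> : V 0 x = fun s => sumr (fun n => U n s * eigfun n x).
  by apply/funext => s; congr sumr; apply/funext => n; rewrite eigfun_dx0.
apply: (@sumr_is_derive R (fun n s => U n s * eigfun n x) (fun n s => dU n s * eigfun n x) (fun n => C * P * sc * a n) (t / 2) (2 * T)).
- by rewrite tT andbT ltr_pdivrMr// ltr_pMr// ltr1n.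
- exact: sCP.
- move=> n s /inI /andP[s0' _].
  apply: dv_eq (dvM (dU_ n s0') (dv_cst (eigfun n x) s)) _; by rewrite mulr0 addr0.
- by move=> n s sI; apply: eigfun_term_le; exact: dle.
- move=> s sI; have sI' := inI s sI.
  have [sT|Ts] := leP s T.
    apply: summable_le sK => n; rewrite -eigfun_dx0; apply: term_le => //.
    by case/andP: sI' => /ltW -> _.
  apply: (@summable_le R _ (fun n => K * a n + C * (T `^ (al - 1) + (2 * T) `^ (al - 1)) * T * sc * a n)); last first.
    by apply: summableD => //.
  move=> n; have TT : 0 <= T <= T by rewrite ltW//=.
  rewrite -(subrK (U n T) (U n s)) mulrDl addrC; apply: (le_trans (ler_normD _ _)); apply: lerD.
    by rewrite -eigfun_dx0; exact: term_le.
  apply: eigfun_term_le.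
  have [|c /andP[c1 c2] ->] := @mean_value R (U n) (dU n) T s Ts.
    by move=> u /andP[Tu _]; apply: dU_; exact: lt_le_trans Tu.
  have [s2 sTT] : s <= 2 * T /\ s - T <= T by case/andP: sI => _ /ltW h; split => //; lra.
  rewrite normrM (ger0_norm (x := s - T)) ?subr_ge0 ?(ltW Ts)//.
  have cI : 0 < c <= 2 * T by rewrite (lt_trans T0 c1) (le_trans (ltW c2)).
  rewrite mulrAC; apply: ler_pM => //; first by rewrite subr_ge0 ltW.
  apply: (le_trans (dU_le n cI)); apply: ler_wpM2r => //; apply: ler_wpM2l => //.
  by apply: powR_bound => //; [exact: ltW|exact: le_trans (ltW c2) _].
Qed.

Lemma Vtt_derive x t : 0 < t < 2 * T -> is_derive t 1 (Vt x) (Vtt x t).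
Proof.
move=> /andP[t0 tT].
have inI s : t / 2 < s < 2 * T -> 0 < s <= 2 * T.
  by move=> /andP[h1 h2]; rewrite (ltW h2) andbT; apply: lt_trans h1; rewrite divr_gt0.
pose P (r : R) := (t / 2) `^ r + (2 * T) `^ r.
have sCP (B : R) : summable (fun n => B * a n) by exact: summableZ.
apply: (@sumr_is_derive R (fun n s => dU n s * eigfun n x) (fun n s => ddU n s * eigfun n x) (fun n => C * P (al - 2) * sc * a n) (t / 2) (2 * T)).
- by rewrite tT andbT ltr_pdivrMr// ltr_pMr// ltr1n.
- exact: sCP.
- move=> n s /inI /andP[s0' _].
  apply: dv_eq (dvM (ddU_ n s0') (dv_cst (eigfun n x) s)) _; by rewrite mulr0 addr0.
- move=> n s sI; apply: eigfun_term_le; apply: (le_trans (ddU_le n (inI s sI))); apply: ler_wpM2r => //.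
  by apply: ler_wpM2l => //; exact: pow2.
- move=> s sI; apply: (summable_le (M := fun n => C * P (al - 1) * sc * a n)) => // n.
  apply: eigfun_term_le; apply: (le_trans (dU_le n (inI s sI))); apply: ler_wpM2r => //.
  by apply: ler_wpM2l => //; exact: pow2.
Qed.

Lemma Vt_bound x t : 0 < t <= 2 * T -> `|Vt x t| <= sumr (fun n => C * sc * a n) * t `^ (al - 1).
Proof.
move=> tT; have sS : summable (fun n => C * sc * a n) by exact: summableZ.
rewrite mulrC -sumrZ//; apply: sumr_norm_le; last exact: summableZ.
move=> n; rewrite (_ : _ * (C * sc * a n) = C * t `^ (al - 1) * sc * a n); last by ring.
by apply: eigfun_term_le; exact: dU_le.
Qed.

Lemma Vtt_bound x t : 0 < t <= 2 * T -> `|Vtt x t| <= sumr (fun n => C * sc * a n) * t `^ (al - 2).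
Proof.
move=> tT; have sS : summable (fun n => C * sc * a n) by exact: summableZ.
rewrite mulrC -sumrZ//; apply: sumr_norm_le; last exact: summableZ.
move=> n; rewrite (_ : _ * (C * sc * a n) = C * t `^ (al - 2) * sc * a n); last by ring.
by apply: eigfun_term_le; exact: ddU_le.
Qed.

Lemma V_continuous : {within [set` `[xl, xr]] `*` [set` `[0, T]], continuous (fun z : R * R => V 0 z.1 z.2)}.
Proof.
apply/subspace_continuousP => z Az.
set A := _ `*` _ in Az *.
have PF : ProperFilter (within A (nbhs z)).
  by split; [move=> h; exact: (nbhs_singleton h)|exact: within_filter].
apply: (@tannery R _ (within A (nbhs z)) PF (fun n w => U n w.2 * eigfun_dx 0 n w.1) _ (fun n => K * a n)) => //.
- have : \forall w \near within A (nbhs z), A w by exact: withinT.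
  apply: filterS => w [_ /=]; rewrite in_itv/= => wT n; exact: term_le.
- move=> n; apply: cvg_within_filter; apply: cvgM.
    exact: (continuous_comp (@cvg_snd _ _ (nbhs z.1) (nbhs z.2) _) (@cU n z.2)).
  apply: (continuous_comp (@cvg_fst _ _ (nbhs z.1) (nbhs z.2) _)).
  exact: (dv_cont (eigfun_dx_derive 0 n z.1)).
Qed.

(** The integral and the sum may be interchanged because the terms of [Vt] are bounded by [C a n s^(al-1)]. *)
Lemma V_caputo x t : t \in `]0, T] ->
  intg `]0, t[ (fun s => (t - s) `^ (- al) * Vt x s) /\
  RI `]0, t[ (fun s => (t - s) `^ (- al) * Vt x s) =
    Ga * (expR (lam * t) * sumr (fun n => ga n t * eigfun n x) + sigma ^+ 2 / 2 * V 2 x t - q * V 0 x t).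
Proof.
move=> tJ; have /andP[t0 tT] : 0 < t <= T by move: tJ; rewrite in_itv.
have /andP[al0 al1] := al01; have al10 : 0 < 1 - al by rewrite subr_gt0.
have mI : measurable ([set` `]0, t[] : set R) by exact: measurable_itv.
pose h s : R := kp (1 - al) (t - s) * kp al s.
have ih : intg `]0, t[ h by apply: (intgS measurableT _ _ (intg_conv_kp t al10 al0)).
have t2 s : `]0, t[%classic s -> 0 < s <= 2 * T /\ s < t.
  rewrite /= in_itv/= => /andP[-> st]; split => //=.
  by rewrite (le_trans (ltW st))// (le_trans tT)// ler_peMl ?ltW// ltr1n.
pose f n s := (t - s) `^ (- al) * (dU n s * eigfun n x).
have mf n : measurable_fun `]0, t[ (f n).
  apply: meas_oo => s /andP[s0' st]; apply: cvgM; last first.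
    by apply: cvgM; [exact: (dv_cont (ddU_ n s0'))|exact: cvg_cst].
  apply: (@cont_comp R (fun u => u `^ (- al)) (fun s => t - s)); first by apply: cont_powR; rewrite subr_gt0.
  by apply: cvgB; [exact: cvg_cst|exact: cvg_id].
have fle n s : `]0, t[%classic s -> `|f n s| <= C * sc * a n * h s.
  move=> /t2[s2 st]; have /andP[s0' _] := s2.
  rewrite /f normrM ger0_norm ?powR_ge0// /h !kpE ?subr_gt0//.
  rewrite (_ : 1 - al - 1 = - al); last by ring.
  rewrite (_ : C * sc * a n * _ = (t - s) `^ (- al) * (C * s `^ (al - 1) * sc * a n)); last by ring.
  by apply: ler_wpM2l; [exact: powR_ge0|apply: eigfun_term_le; exact: dU_le].
have sS : summable (fun n => C * sc * a n) by exact: summableZ.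
have [i1 e1] := sumr_integral mI mf fle sS ih.
have fE s : `]0, t[%classic s -> sumr (f^~ s) = (t - s) `^ (- al) * Vt x s.
  move=> /t2[s2 st]; rewrite /Vt -sumrZ//.
  apply: (summable_le (M := fun n => C * s `^ (al - 1) * sc * a n)); last exact: summableZ.
  by move=> n; apply: eigfun_term_le; exact: dU_le.
split; first exact: (intg_ext mI fE i1).
rewrite -(RI_ext fE) e1.
have tT' : 0 <= t <= T by rewrite ltW.
have sV p : (p <= 4)%N -> summable (fun n => U n t * eigfun_dx p n x).
  by move=> p4; apply: summable_le sK => n; exact: term_le.
have sG : summable (fun n => ga n t * eigfun n x).
  apply: (summable_le (M := fun n => C * sc * a n)) => // n; apply: eigfun_term_le; exact: ga_le.
have E n : RI `]0, t[ (f n) =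
    Ga * (expR (lam * t) * (ga n t * eigfun n x) + sigma ^+ 2 / 2 * (U n t * eigfun_dx 2 n x) - q * (U n t * eigfun_dx 0 n x)).
  have -> : RI `]0, t[ (f n) = RI `]0, t[ (fun s => eigfun n x * ((t - s) `^ (- al) * dU n s)).
    by apply: RI_ext => s _; rewrite /f; ring.
  rewrite RI_Z//; last first.
    apply: (intg_le (h := fun s => C * a n * h s)) => //; last exact: intgZ.
      apply: meas_oo => s /andP[s0' st]; apply: cvgM; last exact: (dv_cont (ddU_ n s0')).
      apply: (@cont_comp R (fun u => u `^ (- al)) (fun s => t - s)); first by apply: cont_powR; rewrite subr_gt0.
      by apply: cvgB; [exact: cvg_cst|exact: cvg_id].
    move=> s /t2[s2 st]; have /andP[s0' _] := s2.
    rewrite normrM ger0_norm ?powR_ge0// /h !kpE ?subr_gt0//.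
    rewrite (_ : 1 - al - 1 = - al); last by ring.
    rewrite (_ : C * a n * _ = (t - s) `^ (- al) * (C * s `^ (al - 1) * a n)); last by ring.
    by apply: ler_wpM2l; [exact: powR_ge0|exact: dU_le].
  by rewrite caputoU// eigfun_dx2 eigfun_dx0 /eigval; ring.
have S1 : summable (fun n => expR (lam * t) * (ga n t * eigfun n x)) by exact: summableZ.
have S2 : summable (fun n => sigma ^+ 2 / 2 * (U n t * eigfun_dx 2 n x)) by apply: summableZ; exact: sV.
have S3 : summable (fun n => q * (U n t * eigfun_dx 0 n x)) by apply: summableZ; exact: sV.
rewrite (funext E) sumrZ; last exact: (summableB (summableD S1 S2) S3).
rewrite sumr_sub//; last exact: summableD.
by rewrite sumrD// !sumrZ//; exact: sV.
Qed.

End solution_series.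

(** * The classical solution is the series solution *)

Section continuity_within.
Context {R : realType}.
Implicit Types (x t : R).

Lemma within_cont_oo (f : R -> R) a b : {within [set` `]a, b]], continuous f} ->
  forall s : R, a < s < b -> {for s, continuous f}.
Proof.
move=> cf s sab.
have oI : open ([set` `]a, b[] : set R) by exact: interval_open.
have S : [set` `]a, b[] `<=` ([set` `]a, b]] : set R) by apply: subset_itvl; rewrite bnd_simp.
have := continuous_subspaceW S cf; rewrite continuous_open_subspace// => H.
by apply: H; rewrite inE/= in_itv.
Qed.

Lemma slice_cont (v : R -> R -> R) (xl xr T t : R) : 0 <= t <= T ->
  {within [set` `[xl, xr]] `*` [set` `[0, T]], continuous (fun z : R * R => v z.1 z.2)} ->
  {within `[xl, xr], continuous (v^~ t)}.
Proof.
move=> tT cv; apply/subspace_continuousP => x xI.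
have H : (fun z : R * R => v z.1 z.2) @ within ([set` `[xl, xr]] `*` [set` `[0, T]]) (nbhs (x, t)) --> v x t.
  by move/subspace_continuousP: cv => /(_ (x, t)); apply; split => //=; rewrite in_itv.
apply: (@cvg_comp _ _ _ (fun y : R => (y, t)) (fun z : R * R => v z.1 z.2) _ _ _ _ H).
move=> B; rewrite /within/= => nB.
have /nbhs_ballP[r /= r0 Hr] := nB.
apply/nbhs_ballP; exists r => //= y xy yI; apply: (Hr (y, t)); last by split => //=; rewrite in_itv.
by split => //=; exact: ballxx.
Qed.

(** A nonempty open interval is not contained in a null set. *)
Lemma ae_zero_cont (f : R -> R) (a b : R) : a < b -> {within `[a, b], continuous f} ->
  {ae lebesgue_measure, forall x, [set` `]a, b[] x -> f x = 0} -> forall x, a <= x <= b -> f x = 0.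
Proof.
move=> ab /(continuous_within_itvP _ ab)[ci ca cb] [N [mN N0 fN]].
have int x : a < x < b -> f x = 0.
  move=> xab; apply: contrapT => /eqP fx; have xI : x \in `]a, b[ by rewrite in_itv.
  have near0 : \forall y \near x, (a < y < b) /\ f y != 0.
    near=> y; split; first by near: y; exact: near_oo.
    near: y; have := ci x xI; move=> /cvgrPdist_lt /(_ `|f x|); rewrite normr_gt0 => /(_ fx).
    apply: filterS => y; apply: contraTneq => ->; by rewrite subr0 ltxx.
  have /nbhs_ballP[r /= r0 Hr] := near0.
  pose I : set R := [set` `]x - r, x + r[].
  have BN : I `<=` N.
    move=> y; rewrite /I/=; rewrite in_itv/= => /andP[y1 y2]; apply: fN => /= H.
    have [yab fy] : (a < y < b) /\ f y != 0.
      by apply: Hr; rewrite /ball/= ltr_norml; apply/andP; split; lra.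
    by move/eqP: fy; apply; apply: H; rewrite in_itv.
  have lB : lebesgue_measure I = (2 * r)%:E.
    rewrite /I lebesgue_measure_itv/= lte_fin (_ : x - r < x + r); last by lra.
    by rewrite -EFinB; congr EFin; ring.
  have mB : @measurable _ (measurableTypeR R) I by exact: measurable_itv.
  have : (lebesgue_measure I <= lebesgue_measure N)%E.
    by apply: le_measure => //; rewrite inE.
  by rewrite lB N0 lee_fin leNgt mulr_gt0.
move=> x /andP[ax xb].
have [xa|xa] := eqVneq x a.
  have l0 : f y @[y --> a^'+] --> (0 : R).
    apply: cvg_near_cst.
    by near=> y; rewrite int//; apply/andP; split; near: y; [exact: nbhs_right_gt|exact: nbhs_right_lt].
  by rewrite xa -(cvg_lim (@Rhausdorff R) ca) (cvg_lim (@Rhausdorff R) l0).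
have [xb'|xb'] := eqVneq x b.
  have l0 : f y @[y --> b^'-] --> (0 : R).
    apply: cvg_near_cst.
    by near=> y; rewrite int//; apply/andP; split; near: y; [exact: nbhs_left_gt|exact: nbhs_left_lt].
  by rewrite xb' -(cvg_lim (@Rhausdorff R) cb) (cvg_lim (@Rhausdorff R) l0).
by apply: int; rewrite !lt_neqAle eq_sym xa ax xb' xb.
Unshelve. all: by end_near. Qed.

Lemma sum3_le (u1 u2 u3 c : R) : 0 <= u1 -> 0 <= u2 -> 0 <= u3 -> u1 + u2 + u3 <= c ->
  [/\ u1 <= c, u2 <= c & u3 <= c].
Proof. by move=> *; split; lra. Qed.

Lemma drop_square (u b m q : R) : 0 < q -> q <= m -> 0 <= u -> u * m ^+ 2 <= b -> u <= b * q^-1 ^+ 2.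
Proof.
move=> q0 qm u0 H; rewrite exprVn ler_pdivlMr ?exprn_gt0//; apply: le_trans H.
have m0 := lt_le_trans q0 qm.
by apply: ler_wpM2l => //; apply: lerXn2r; rewrite // nnegrE ltW.
Qed.

Lemma all_multiples_le0 (u : R) : (forall s : R, s * u <= 0) -> u = 0.
Proof.
move=> H; apply/eqP; rewrite eq_le -{1}(mul1r u) H/=.
by have := H (-1); rewrite mulN1r oppr_le0.
Qed.

(** The form of the Lipschitz condition in [max_principle]. *)
Lemma left_lipschitz (f : R -> R) (T r l : R) : 0 < r <= T -> has_din `]0, T] f r l ->
  exists K d : R, 0 < d /\ forall s, r - d < s < r -> `|f r - f s| <= K * (r - s).
Proof.
move=> /andP[r0 rT] /has_dinP /(_ _ ltr01)[d d0 Hd].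
exists (`|l| + 1), (Num.min r d); split; first by rewrite lt_min r0.
move=> s /andP[s1 s2].
have [sr sd] : r - r < s /\ r - d < s.
  have hr : Num.min r d <= r by rewrite ge_min lexx.
  have hd : Num.min r d <= d by rewrite ge_min lexx orbT.
  by split; apply: le_lt_trans s1; rewrite lerB.
rewrite subrr in sr.
have sJ : s \in `]0, T] by rewrite in_itv/= sr (le_trans (ltW s2)).
have sr0 : s - r != 0 by rewrite subr_eq0 lt_eqF.
have rs : `|s - r| = r - s by rewrite distrC ger0_norm// subr_ge0 ltW.
have := Hd s sJ; rewrite lt_eqF// rs => /(_ isT) H.
have {}H : `|diff_quotient f r s - l| <= 1 by apply: H; lra.
have -> : f r - f s = - (diff_quotient f r s * (s - r)) by rewrite /diff_quotient divfK// opprB.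
rewrite normrN normrM rs; apply: ler_wpM2r; first by rewrite subr_ge0 ltW.
rewrite -[diff_quotient f r s](subrK l) addrC; apply: (le_trans (ler_normD _ _)).
by rewrite lerD2l.
Qed.

(** Bounds for [v = e^(- lam t) w] and its time derivatives from those for [w]; the term [2 lam w_t] is
    absorbed in the bound for [w_tt] because [t^(al-1) = t t^(al-2)]. *)
Lemma bound_sum (lam T t B0 B1 u0 u1 u2 X1 X2 E : R) : 0 <= lam -> 0 < t <= T -> 0 <= B0 -> 0 <= B1 ->
  0 <= E <= 1 -> 0 <= X1 -> 0 <= X2 -> X1 = t * X2 ->
  `|u0| <= B0 -> `|u1| <= B1 * X1 -> `|u2| <= B1 * X2 ->
  let C := B0 * (1 + lam + lam ^+ 2) + B1 * (1 + 2 * lam * T) in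
  [/\ B0 <= C, `|E * (u1 - lam * u0)| <= C * (1 + X1) &
   `|E * (u2 - 2 * lam * u1 + lam ^+ 2 * u0)| <= C * (1 + X2)].
Proof.
move=> l0 /andP[t0 tT] B00 B10 /andP[E0 E1] X10 X20 X12 h0 h1 h2 C.
have l2 : 0 <= lam ^+ 2 by exact: sqr_ge0.
have lT : 0 <= 2 * lam * T by rewrite !mulr_ge0// (le_trans (ltW t0)).
have p1 : 0 <= B0 * lam by exact: mulr_ge0.
have p2 : 0 <= B0 * lam ^+ 2 by exact: mulr_ge0.
have p3 : 0 <= B1 * (2 * lam * T) by exact: mulr_ge0.
have CE : C = B0 + B0 * lam + B0 * lam ^+ 2 + B1 + B1 * (2 * lam * T) by rewrite /C; ring.
have C0 : 0 <= C by rewrite CE; lra.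
have EE u : `|E * u| <= `|u| by rewrite normrM (ger0_norm E0) ler_piMl.
split; first by rewrite CE; lra.
- apply: (le_trans (EE _)); apply: (le_trans (ler_normB _ _)); rewrite normrM (ger0_norm l0).
  have q1 : lam * `|u0| <= B0 * lam by rewrite mulrC; exact: ler_wpM2r.
  have q2 : B1 * X1 <= C * X1 by apply: ler_wpM2r => //; rewrite CE; lra.
  have q3 : B0 * lam <= C by rewrite CE; lra.
  by rewrite mulrDr mulr1; lra.
- apply: (le_trans (EE _)); apply: (le_trans (ler_normD _ _)).
  have n1 : `|u2 - 2 * lam * u1| <= `|u2| + 2 * lam * `|u1|.
    apply: (le_trans (ler_normB _ _)); rewrite normrM (ger0_norm (x := 2 * lam))//.
    exact: mulr_ge0.
  have n2 : `|lam ^+ 2 * u0| <= B0 * lam ^+ 2.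
    by rewrite normrM (ger0_norm l2) mulrC; exact: ler_wpM2r.
  have q1 : 2 * lam * `|u1| <= B1 * (2 * lam * T) * X2.
    apply: (@le_trans _ _ (2 * lam * (B1 * (T * X2)))); last by rewrite le_eqVlt; apply/orP; left; apply/eqP; ring.
    apply: ler_wpM2l; first exact: mulr_ge0.
    by apply: (le_trans h1); rewrite X12; apply: ler_wpM2l => //; exact: ler_wpM2r.
  have q2 : (B1 + B1 * (2 * lam * T)) * X2 <= C * X2 by apply: ler_wpM2r => //; rewrite CE; lra.
  have q3 : B0 * lam ^+ 2 <= C by rewrite CE; lra.
  rewrite mulrDl in q2; rewrite mulrDr mulr1.
  rewrite [leRHS]addrC; apply: lerD; last exact: le_trans n2 q3.
  by apply: (le_trans n1); apply: le_trans q2; exact: lerD.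
Qed.

End continuity_within.

Section solution.
Context {R : realType}.
Variables (al lam T sigma q xl xr : R).
Hypotheses (al01 : 0 < al < 1) (lam0 : 0 <= lam) (T0 : 0 < T) (s0 : 0 < sigma) (q0 : 0 < q) (hx : xl < xr).
Variables (varsigma : R -> R) (g v : R -> R -> R).
Hypothesis hv : is_solution al lam T sigma q xl xr varsigma g v.
Implicit Types (x t s : R) (n p : nat).

Let J : interval R := `]0, T].
Let vt x s := derive_in J (v x) s.
Let w x t := expR (lam * t) * v x t.
Let P x s := lam * expR (lam * s) * v x s + expR (lam * s) * vt x s.
Let Ga := Gamma (1 - al).

Let Ga0 : 0 < Ga.
Proof. by have /andP[a0 a1] := al01; apply: Gamma_gt0; rewrite subr_gt0 a1 gerBl ltW. Qed.

Let vt_din x t : xl < x < xr -> t \in J -> has_din J (v x) t (vt x t).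
Proof.
move=> xD tJ; have [[_ _ treg] _ _ _] := hv.
have [|dv _ _] := treg x; first by rewrite in_itv.
exact: (derivable_has_din (dv 0%N t isT tJ)).
Qed.

(** The time derivative [P] of [w], one-sided at [T]. *)
Let w_din x t : xl < x < xr -> t \in J -> has_din J (w x) t (P x t).
Proof.
move=> xD tJ; apply: has_dinM => //; last exact: vt_din.
by apply: is_derive_has_din; exact: dv_exp.
Qed.

Let inJ t : 0 < t < T -> t \in J.
Proof. by move=> /andP[t0 tT]; rewrite in_itv/= t0 ltW. Qed.

Let nearJ t : 0 < t < T -> \forall s \near t, s \in J.
Proof. by move=> tT; have := near_oo tT; apply: filterS => s; exact: inJ. Qed.

Let w_dv x t : xl < x < xr -> 0 < t < T -> is_derive t 1 (w x) (P x t).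
Proof. by move=> xD tT; apply: (has_din_interior (nearJ tT)); apply: w_din => //; exact: inJ. Qed.

Let P_cont x t : xl < x < xr -> 0 < t < T -> {for t, continuous (P x)}.
Proof.
move=> xD tT; have [[_ _ treg] _ _ _] := hv.
have [|_ cv _] := treg x; first by rewrite in_itv.
have cvt := within_cont_oo cv tT.
have cv0 : {for t, continuous (v x)}.
  apply: (dv_cont (a := vt x t)); apply: (has_din_interior (nearJ tT)); apply: vt_din => //; exact: inJ.
have ce := dv_cont (dv_exp lam t).
by apply: cvgD; apply: cvgM => //; apply: cvgM => //; exact: cvg_cst.
Qed.

Let w_cont : {within [set` `[xl, xr]] `*` [set` `[0, T]], continuous (fun z : R * R => w z.1 z.2)}.
Proof.
have [[cv _ _] _ _ _] := hv; move=> z; apply: cvgM; last exact: cv.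
have cE : continuous (fun z : R * R => expR (lam * z.2)).
  move=> u; exact: (continuous_comp (@cvg_snd _ _ (nbhs u.1) (nbhs u.2) _) (dv_cont (dv_exp lam u.2))).
exact: (continuous_subspaceT cE).
Qed.

Lemma v_bounded : exists2 B : R, 0 <= B & forall x t, xl <= x <= xr -> 0 <= t <= T -> `|v x t| <= B.
Proof.
have [[cv _ _] _ _ _] := hv.
pose A : set (R * R) := [set` `[xl, xr]] `*` [set` `[0, T]].
have [|||z zA Hz] := @compact_EVT_max _ R (fun z : R * R => `|v z.1 z.2|) A.
- by exists (xl, 0); split; rewrite /= in_itv/= ?lexx ltW.
- by apply: compact_setX; exact: segment_compact.
- by move=> u; apply: cvg_norm; exact: cv.
exists `|v z.1 z.2| => // x t xI tT; apply: (Hz (x, t)); rewrite inE; split; by rewrite /= in_itv.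
Qed.

(** On [[t / 2, t]] the derivative is bounded and only the kernel is singular; on the first half the
    kernel is bounded and the derivative is integrable. *)
Lemma caputo_intg x t : xl < x < xr -> t \in J -> intg `]0, t[ (fun s => (t - s) `^ (- al) * P x s).
Proof.
move=> xD tJ; have /andP[t0 tT] : 0 < t <= T by move: tJ; rewrite in_itv.
have /andP[al0 al1] := al01; have al10 : 0 < 1 - al by rewrite subr_gt0.
have [[_ _ treg] _ _ _] := hv.
have [|_ cv iv] := treg x; first by rewrite in_itv.
have [B B0 HB] := v_bounded.
have mI : measurable ([set` `]0, t[] : set R) by exact: measurable_itv.
have mT : measurable ([set` `]0, T[] : set R) by exact: measurable_itv.
pose c := t / 2; have c0 : 0 < c by rewrite divr_gt0.
have ct : c <= t by rewrite ler_pdivrMr// ler_pMr// ler1n.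
have sub : [set` `[c, t]] `<=` [set` J].
  by move=> s /=; rewrite !in_itv/= => /andP[cs st]; rewrite (lt_le_trans c0 cs) (le_trans st).
have cvt : {within `[c, t], continuous (fun s => `|vt x s|)}.
  by have := continuous_subspaceW sub cv => H u; apply: cvg_norm; exact: H.
have [s1 _ Hs1] := EVT_max ct cvt.
pose X := expR (lam * T); have X0 : 0 <= X by exact: expR_ge0.
have XT s : s <= T -> expR (lam * s) <= X by move=> sT; rewrite ler_expR ler_wpM2l.
have PB s : 0 < s < t -> `|P x s| <= X * (lam * B + `|vt x s|).
  move=> /andP[s0' st]; have sT := le_trans (ltW st) tT.
  rewrite /P (_ : _ + _ = expR (lam * s) * (lam * v x s + vt x s)); last by ring.
  rewrite normrM (ger0_norm (expR_ge0 _)); apply: ler_pM => //.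
    exact: XT.
  apply: (le_trans (ler_normD _ _)); rewrite lerD2r normrM (ger0_norm lam0).
  apply: ler_wpM2l => //; apply: HB; last by rewrite (ltW s0').
  by case/andP: xD => ? ?; rewrite !ltW.
pose h s := c `^ (- al) * (X * (lam * B + `|vt x s|)) + X * (lam * B + `|vt x s1|) * kp (1 - al) (t - s).
apply: (intg_le (h := h) mI).
- apply: meas_oo => s /andP[s0' st]; apply: cvgM.
    apply: (@cont_comp R (fun u => u `^ (- al)) (fun s => t - s)); first by apply: cont_powR; rewrite subr_gt0.
    by apply: cvgB; [exact: cvg_cst|exact: cvg_id].
  by apply: P_cont => //; rewrite s0' (lt_le_trans st).
- move=> s; rewrite /= in_itv/= => /andP[s0' st].
  have h0 : 0 <= X * (lam * B + `|vt x s|) by rewrite mulr_ge0// addr_ge0// mulr_ge0.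
  have h1 : 0 <= X * (lam * B + `|vt x s1|) by rewrite mulr_ge0// addr_ge0// mulr_ge0.
  rewrite normrM (ger0_norm (powR_ge0 _ _)) /h.
  have [sc|cs] := leP s c.
    apply: ler_wpDr; first by rewrite mulr_ge0// kp_ge0.
    apply: ler_pM => //; [exact: powR_ge0| |by apply: PB; rewrite s0'].
    by apply: powR_anti => //; [exact: ltW|rewrite /c in sc *; lra].
  apply: ler_wpDl; first by rewrite mulr_ge0// powR_ge0.
  rewrite kpE ?subr_gt0// (_ : 1 - al - 1 = - al); last by ring.
  rewrite mulrC; apply: ler_wpM2r; first exact: powR_ge0.
  apply: (le_trans (PB s _)); first by rewrite s0'.
  apply: ler_wpM2l => //; rewrite lerD2l; apply: Hs1; by rewrite in_itv/= !ltW.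
- have ivt : intg `]0, t[ (fun s => `|vt x s|).
    apply: intg_norm => //; apply: (intgS mT mI _ iv).
    by apply: subset_itvl; rewrite bnd_simp.
  have ic : intg `]0, t[ (fun=> lam * B).
    by apply: intg_cst => //; rewrite lebesgue_measure_itv/=; case: ifP => _; rewrite ?ltry.
  apply: intgD => //; first by apply: intgZ => //; apply: intgZ => //; exact: intgD.
  apply: intgZ => //; have := intgS measurableT mI (@subsetT _ _) (intg_kpt_refl t al10).
  by apply: intg_ext => // s sI; rewrite indicE mem_set// mulr1.
Qed.

Lemma caputo_eq x t : xl < x < xr -> t \in J ->
  RI `]0, t[ (fun s => (t - s) `^ (- al) * P x s) =
    Ga * (sigma ^+ 2 / 2 * (expR (lam * t) * derive1n 2 (v^~ t) x) - q * w x t + expR (lam * t) * g x t).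
Proof.
move=> xD tJ; have /andP[t0 tT] : 0 < t <= T by move: tJ; rewrite in_itv.
have [_ eq _ _] := hv.
have := eq x t _ tJ; rewrite in_itv/= => /(_ xD); rewrite /tempered_caputo.
have -> : (\int[lebesgue_measure]_(eta in [set` `]0, t[])
    ((t - eta) `^ (- al) * derive1 (fun s : R => expR (lam * s) * v x s) eta)) =
    RI `]0, t[ (fun s => (t - s) `^ (- al) * P x s).
  apply: RI_ext => s; rewrite /= in_itv/= => /andP[s0' st]; congr (_ * _).
  by apply: dv1; apply: w_dv => //; rewrite s0' (lt_le_trans st).
set I := RI _ _ => e.
have e2 : I = Ga * expR (lam * t) * (expR (- lam * t) / Gamma (1 - al) * I).
  rewrite -/Ga (_ : Ga * _ * _ = (expR (lam * t) * expR (- lam * t)) * (Ga / Ga) * I); last by ring.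
  by rewrite -expRD mulNr subrr expR0 divff ?gt_eqF// !mul1r.
by rewrite e2 e /w; ring.
Qed.

Variables (mu0 : nat -> R) (psi : nat -> R -> R) (eps rho C1 : R).
Hypothesis hSL : SL_eigensystem sigma q xl xr mu0 psi.
Hypothesis heps : 0 < eps.
Hypothesis hvs : in_HL xl xr mu0 psi ((5 + eps) / 2) varsigma.
Hypothesis hgd : forall x : R, x \in `]xl, xr[ -> derivable_in_n `]0, T] 2 (g x).
Hypothesis hg : forall (l : nat) (tau : R), (l <= 2)%N -> tau \in `]0, T] ->
     in_HL xl xr mu0 psi ((5 + eps) / 2) (fun x => derive_in_n `]0, T] l (g x) tau).
Hypothesis hrho : rho < 1.
Hypothesis hbound : forall tau : R, tau \in `]0, T] ->
     norm_HL xl xr mu0 psi ((5 + eps) / 2) (fun x => g x tau)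
     + norm_HL xl xr mu0 psi ((1 + eps) / 2) (fun x => derive_in_n `]0, T] 1 (g x) tau)
     + tau `^ rho * norm_HL xl xr mu0 psi ((1 + eps) / 2) (fun x => derive_in_n `]0, T] 2 (g x) tau) <= C1.

Notation m := (eigval sigma q xl xr).
Notation eigfun := (eigfun xl xr).
Notation coef := (coef xl xr).
Let a n := m n `^ (- ((1 + eps) / 2)).
Let a0 n : 0 <= a n. Proof. exact: powR_ge0. Qed.
Let sa : summable a. Proof. exact: summable_eigval. Qed.
Let m0 n : 0 < m n. Proof. exact: eigval_gt0. Qed.
Let qm n : q <= m n.
Proof. by rewrite /eigval lerDr mulr_ge0 ?sqr_ge0// divr_ge0// sqr_ge0. Qed.
Let D : set R := [set` `]xl, xr[].
Let gl l x t := derive_in_n J l (g x) t.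
Let ga l n t := coef (gl l ^~ t) n.

(** The exponent [(5 + eps) / 2] is [2 + (1 + eps) / 2]: it leaves the summable factor [a n] after the
    division by [m n ^ 2]. *)
Let coef5 u n : in_HL xl xr mu0 psi ((5 + eps) / 2) u ->
  `|coef u n| * m n ^+ 2 <= norm_HL xl xr mu0 psi ((5 + eps) / 2) u * a n.
Proof.
move=> [uL uc]; have m2 : 0 < m n ^+ 2 by rewrite exprn_gt0.
rewrite -ler_pdivlMr//; apply: (le_trans (coef_le hx s0 q0 hSL n uL uc)).
rewrite mulrC -mulrA ler_wpM2l ?sqrtr_ge0//.
rewrite (_ : - ((5 + eps) / 2) = - ((1 + eps) / 2) + - 2%:R); last by field.
by rewrite powRD ?(gt_eqF (m0 n)) ?implybT// (powRN _ 2%:R) powR_mulrn// ltW.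
Qed.

Let coef1 u n : in_HL xl xr mu0 psi ((5 + eps) / 2) u ->
  `|coef u n| <= norm_HL xl xr mu0 psi ((1 + eps) / 2) u * a n.
Proof.
move=> [uL uc]; rewrite mulrC; apply: (coef_le hx s0 q0 hSL n uL).
apply: (HL_weaken hx s0 q0 hSL _ uc).
by apply: ler_wpM2r => //; lra.
Qed.

Let bounds t : t \in J -> [/\ norm_HL xl xr mu0 psi ((5 + eps) / 2) (gl 0 ^~ t) <= C1,
  norm_HL xl xr mu0 psi ((1 + eps) / 2) (gl 1 ^~ t) <= C1 &
  norm_HL xl xr mu0 psi ((1 + eps) / 2) (gl 2 ^~ t) <= t `^ (- rho) * C1].
Proof.
move=> tJ; have /andP[t0 tT] : 0 < t <= T by move: tJ; rewrite in_itv.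
have H := hbound tJ.
have n0 : 0 <= norm_HL xl xr mu0 psi ((5 + eps) / 2) (fun x => g x t) by exact: sqrtr_ge0.
have n1 : 0 <= norm_HL xl xr mu0 psi ((1 + eps) / 2) (fun x => derive_in_n `]0, T] 1 (g x) t) by exact: sqrtr_ge0.
have n2 : 0 <= norm_HL xl xr mu0 psi ((1 + eps) / 2) (fun x => derive_in_n `]0, T] 2 (g x) t) by exact: sqrtr_ge0.
have tr : 0 < t `^ rho by rewrite powR_gt0.
have n3 := mulr_ge0 (ltW tr) n2.
have [h1 h2 h3] := sum3_le n0 n1 n3 H.
split; [exact: h1|exact: h2|by rewrite powRN ler_pdivlMl].
Qed.


Let C : R := norm_HL xl xr mu0 psi ((5 + eps) / 2) varsigma + C1.
Let K : R := C * (1 + q^-1 ^+ 2).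

Let TJ : T \in J. Proof. by rewrite in_itv/= T0 lexx. Qed.

Let C10 : 0 <= C1.
Proof. by have [H _ _] := bounds TJ; apply: le_trans H; exact: sqrtr_ge0. Qed.

Let C0 : 0 <= C. Proof. by rewrite addr_ge0// sqrtr_ge0. Qed.

Let C1C : C1 <= C. Proof. by rewrite lerDr sqrtr_ge0. Qed.

Let Q0 : 0 <= q^-1 ^+ 2. Proof. by rewrite exprn_ge0// invr_ge0 ltW. Qed.

Let K0 : 0 <= K. Proof. by rewrite mulr_ge0// addr_ge0. Qed.

Let CK n : C * a n <= K * a n.
Proof. by apply: ler_wpM2r => //; rewrite /K mulrDr mulr1 lerDl mulr_ge0. Qed.

Let sg_le n : `|coef varsigma n| * m n ^+ 2 <= C * a n.
Proof. by apply: (le_trans (coef5 n hvs)); apply: ler_wpM2r => //; rewrite lerDl. Qed.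

Let ga0_le n t : t \in J -> `|ga 0 n t| * m n ^+ 2 <= C * a n.
Proof.
move=> tJ; have [H _ _] := bounds tJ.
by apply: (le_trans (coef5 n (hg (l := 0) isT tJ))); apply: ler_wpM2r => //; exact: le_trans C1C.
Qed.

Let ga1_le n t : t \in J -> `|ga 1 n t| <= C * a n.
Proof.
move=> tJ; have [_ H _] := bounds tJ.
by apply: (le_trans (coef1 n (hg (l := 1) isT tJ))); apply: ler_wpM2r => //; exact: le_trans C1C.
Qed.

Let ga2_le n t : t \in J -> `|ga 2 n t| <= t `^ (- rho) * (C * a n).
Proof.
move=> tJ; have [_ _ H] := bounds tJ.
apply: (le_trans (coef1 n (hg (l := 2) isT tJ))); rewrite mulrA; apply: ler_wpM2r => //.
by apply: (le_trans H); apply: ler_wpM2l => //; exact: powR_ge0.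
Qed.

Let weaken (u : R) n : `|u| * m n ^+ 2 <= C * a n -> `|u| <= K * a n.
Proof.
move=> H; apply: (le_trans (drop_square q0 (qm n) (normr_ge0 u) H)).
rewrite mulrAC; apply: ler_wpM2r => //; rewrite /K; apply: ler_wpM2l => //.
by rewrite lerDr.
Qed.

Let dgl l x t : (l < 2)%N -> D x -> t \in J -> has_din J (gl l x) t (gl l.+1 x t).
Proof. by move=> l2 Dx tJ; apply: derivable_has_din; exact: (hgd Dx l2 tJ). Qed.

Let igl l t : (l <= 2)%N -> t \in J -> intg D (gl l ^~ t).
Proof. by move=> l2 tJ; have [H _] := hg l2 tJ; exact: L2_intg H. Qed.

Let Ka0 n : 0 <= K * a n. Proof. exact: mulr_ge0. Qed.
Let sKa : summable (fun n => K * a n). Proof. exact: summableZ. Qed.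

Let cg0 t n : t \in J -> `|ga 0 n t| <= K * a n.
Proof. by move=> tJ; apply: weaken; exact: ga0_le. Qed.

Let cg1 t n : t \in J -> `|ga 1 n t| <= K * a n.
Proof. by move=> tJ; apply: (le_trans (ga1_le n tJ)). Qed.

Let cg2 t n : t \in J -> `|ga 2 n t| <= t `^ (- rho) * (K * a n).
Proof. by move=> tJ; apply: (le_trans (ga2_le n tJ)); apply: ler_wpM2l => //; exact: powR_ge0. Qed.

Let dga n t : t \in J -> has_din J (ga 0 n) t (ga 1 n t).
Proof.
move=> tJ; exact: (@coef_derive R xl xr T hx (gl 0) (gl 1) (gl 2) _ (fun x t => @dgl 0 x t isT) (fun x t => @dgl 1 x t isT)
  (fun t => @igl 0 t isT) (fun t => @igl 1 t isT) Ka0 sKa cg1 t n tJ).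
Qed.

Let dga1 n t : t \in J -> has_din J (ga 1 n) t (ga 2 n t).
Proof.
move=> tJ; exact: (@coef_derive2 R xl xr T hx (gl 0) (gl 1) (gl 2) _ _ (fun x t => @dgl 0 x t isT) (fun x t => @dgl 1 x t isT)
  (fun t => @igl 0 t isT) (fun t => @igl 1 t isT) (fun t => @igl 2 t isT) Ka0 sKa cg0 cg1 cg2 t n tJ).
Qed.

Let aeg : {ae lebesgue_measure, forall x, D x -> forall t, t \in J ->
  g x t = sumr (fun n => ga 0 n t * eigfun n x)}.
Proof.
exact: (@ae_series R xl xr T hx (gl 0) (gl 1) (gl 2) _ (fun x t => @dgl 0 x t isT) (fun x t => @dgl 1 x t isT)
  (fun t => @igl 0 t isT) (fun t => @igl 1 t isT) Ka0 sKa cg0 cg1).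
Qed.

(** The difference is compared with zero by [max_principle] after multiplication by an arbitrary real [s], whose
    sign covers both inequalities; [E] is the null set on which the sine series does not represent the source. *)
Lemma representation : exists (U dU ddU : nat -> R -> R) (B : R), [/\ 0 <= B,
  [/\ (forall n t, 0 < t -> is_derive t 1 (U n) (dU n t)) &
      (forall n t, 0 < t -> is_derive t 1 (dU n) (ddU n t))],
  [/\ (forall n t, 0 <= t <= T -> `|U n t| * m n ^+ 2 <= B * a n),
      (forall n t, 0 < t <= 2 * T -> `|dU n t| <= B * t `^ (al - 1) * a n) &
      (forall n t, 0 < t <= 2 * T -> `|ddU n t| <= B * t `^ (al - 2) * a n)] &
  forall x t, xl <= x <= xr -> 0 <= t <= T -> w x t = V xl xr U 0 x t].
Proof.
have [U [dU [ddU [C' [C'0 [U1 U2 cU U0] [hU hdU hddU] UE]]]]] :=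
  modes_exist al01 lam0 T0 Ga0 q0 C0 hrho qm a0 dga dga1 sg_le ga0_le ga1_le ga2_le.
pose B := C' + K; have B0 : 0 <= B by exact: addr_ge0.
have C'B (p : R) n : 0 <= p -> C' * p * a n <= B * p * a n.
  by move=> p0; apply: ler_wpM2r => //; apply: ler_wpM2r => //; rewrite lerDl.
have C'B1 n : C' * a n <= B * a n by apply: ler_wpM2r => //; rewrite lerDl.
have {}hU n t : 0 <= t <= T -> `|U n t| * m n ^+ 2 <= B * a n by move=> /(hU n) h; exact: le_trans h _.
have {}hdU n t : 0 < t <= 2 * T -> `|dU n t| <= B * t `^ (al - 1) * a n.
  by move=> /(hdU n) h; apply: (le_trans h); apply: C'B; exact: powR_ge0.
have {}hddU n t : 0 < t <= 2 * T -> `|ddU n t| <= B * t `^ (al - 2) * a n.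
  by move=> /(hddU n) h; apply: (le_trans h); apply: C'B; exact: powR_ge0.
have gB n t : t \in J -> `|ga 0 n t| <= B * a n.
  move=> tJ; apply: (le_trans (cg0 n tJ)); apply: ler_wpM2r => //; by rewrite lerDr.
exists U, dU, ddU, B; split => //.
pose u x t := V xl xr U 0 x t.
have cu := V_continuous hx s0 q0 sa cU hU.
have T00 : 0 <= (0 : R) <= T by rewrite lexx ltW.
have T2 t : 0 < t <= T -> 0 < t < 2 * T.
  move=> /andP[t0 tT]; rewrite t0 (le_lt_trans tT)//; by rewrite ltr_pMl// ltr1n.
have [[cv xreg _] _ vini vbd] := hv.
have init x : xl <= x <= xr -> v x 0 = u x 0.
  move=> xI; apply/eqP; rewrite -subr_eq0; apply/eqP; move: x xI.
  apply: (ae_zero_cont hx).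
    have c1 := slice_cont T00 cv; have c2 := slice_cont (v := u) T00 cu.
    by move=> y; apply: cvgB; [exact: c1|exact: c2].
  have iv : intg D varsigma by exact: (L2_intg hvs.1).
  have := ae_expansion hx sa K0 iv (fun n => weaken (sg_le n)).
  apply: ae_mono => x e xD; rewrite (vini x xD) (e xD); apply/eqP; rewrite subr_eq0; apply/eqP.
  by congr sumr; apply/funext => n; rewrite U0 eigfun_dx0.
have bd t : u xl t = 0 /\ u xr t = 0.
  have z y : (forall n, eigfun n y = 0) -> u y t = 0.
    move=> ey; rewrite /u /V (_ : (fun n => _) = (fun n => 0 * (0 : R))); last first.
      by apply/funext => n; rewrite eigfun_dx0 ey !mulr0.
    by rewrite sumrZ ?mul0r//; apply: (summable_le (M := fun n => K * a n)) => // n; rewrite normr0.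
  by split; apply: z => n; [exact: eigfun_l|exact: eigfun_r].
pose E : set R := ~` [set x | D x -> forall t, t \in J -> g x t = sumr (fun n => ga 0 n t * eigfun n x)].
have E0 : lebesgue_measure.-negligible E by exact: aeg.
have cmp s x t : xl <= x <= xr -> 0 <= t <= T -> s * (w x t - u x t) <= 0.
  apply: (@max_principle R E al Ga (sigma ^+ 2 / 2) q xl xr T (fun x t => s * (w x t - u x t))
    (fun x t => s * (expR (lam * t) * derive1 (v^~ t) x - V xl xr U 1 x t))
    (fun x t => s * (expR (lam * t) * derive1n 2 (v^~ t) x - V xl xr U 2 x t))
    (fun x t => s * (P x t - Vt xl xr dU x t)) E0 al01 Ga0 _ q0 hx T0).
  - by rewrite divr_gt0// exprn_gt0.
  - by move=> z; apply: cvgM; [exact: cvg_cst|apply: cvgB; [exact: w_cont|exact: cu]].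
  - move=> y r yI rT; have rJ : r \in J by rewrite in_itv.
    have rT' : 0 <= r <= T by case/andP: rT => /ltW -> ->.
    have [|d1 d2] := (xreg r rJ).1 y; first by rewrite in_itv.
    have V1 := @V_derive R sigma q xl xr T B hx s0 q0 a U sa hU 0 y r isT rT'.
    have V2 := @V_derive R sigma q xl xr T B hx s0 q0 a U sa hU 1 y r isT rT'.
    split; first exact: (dvZ s (dvB (dvZ (expR (lam * r)) (dv_derivable d1)) V1)).
    exact: (dvZ s (dvB (dvZ (expR (lam * r)) (dv_derivable d2)) V2)).
  - move=> y r yI rT; have rT2 : 0 < r < 2 * T by apply: T2; case/andP: rT => -> /ltW.
    split; first by apply: dvZ; apply: dvB; [exact: w_dv|exact: (Vt_derive hx s0 q0 T0 B0 a0 sa U1 hU hdU)].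
    apply: cvgM; first exact: cvg_cst.
    apply: cvgB; first exact: P_cont.
    have dd : is_derive r 1 (Vt xl xr dU y) (Vtt xl xr ddU y r).
      exact: (Vtt_derive xl xr B0 a0 sa U2 hdU hddU).
    exact: (@dv_cont R _ _ _ dd).
  - move=> y r yI rT; have rJ : r \in J by rewrite in_itv.
    have [i2 _] := V_caputo hx s0 q0 al01 T0 sa U2 hU hdU gB UE y rJ.
    have mI : measurable ([set` `]0, r[] : set R) by exact: measurable_itv.
    apply: (@intg_ext R _ (fun z => s * ((r - z) `^ (- al) * P y z - (r - z) `^ (- al) * Vt xl xr dU y z))) => //.
      by move=> z _; ring.
    by apply: intgZ => //; apply: intgB => //; exact: caputo_intg.
  - move=> y r yI rT; have rJ : r \in J by rewrite in_itv.
    apply: (left_lipschitz (f := fun z => s * (w y z - u y z)) (l := s * (P y r - Vt xl xr dU y r)) rT).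
      have dz := is_derive_has_din J (dvZ (- s) (Vt_derive hx s0 q0 T0 B0 a0 sa U1 hU hdU y (T2 r rT))).
      have dw := has_dinD (has_dinM rJ (is_derive_has_din J (dv_cst s r)) (w_din yI rJ)) dz.
      apply: (has_din_ext _ rJ (has_din_eq dw _)) => [z _|]; rewrite /u; ring.
  - move=> y r yI /contrapT yE rT; have rJ : r \in J by rewrite in_itv.
    have [i2 e2] := V_caputo hx s0 q0 al01 T0 sa U2 hU hdU gB UE y rJ.
    have mI : measurable ([set` `]0, r[] : set R) by exact: measurable_itv.
    have i1 := caputo_intg yI rJ.
    rewrite (@RI_ext R _ _ (fun z => s * ((r - z) `^ (- al) * P y z - (r - z) `^ (- al) * Vt xl xr dU y z))); last first.
      by move=> z _; ring.
    rewrite RI_Z//; last exact: intgB.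
    have yD : D y by rewrite /D/= in_itv.
    rewrite RI_B// e2 caputo_eq// (yE yD r rJ).
    by rewrite /u; ring.
  - by move=> y yI; rewrite /w mulr0 expR0 mul1r init// subrr mulr0.
  - move=> r rT; have [u1 u2] := bd r.
    have vb : v xl r = 0 /\ v xr r = 0.
      have [r0|r0] := ltP 0 r; first by apply: vbd; rewrite in_itv/= r0; case/andP: rT.
      have -> : r = 0 by apply/eqP; rewrite eq_le r0; case/andP: rT.
      rewrite !init ?lexx ?(ltW hx)//; exact: bd.
    by rewrite /w u1 u2 vb.1 vb.2 !mulr0 subrr !mulr0.
move=> x t xI tT; apply/eqP; rewrite -subr_eq0; apply/eqP; apply: all_multiples_le0 => s; exact: cmp.
Qed.


End solution.

Theorem theoremA2 (R : realType) (alpha lambda T sigma r c q xl xr : R)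
  (halpha : 0 < alpha < 1) (hlambda : 0 <= lambda) (hT : 0 < T)
  (hsigma : 0 < sigma) (hr : 0 < r) (hq : q = c ^+ 2 / (2 * sigma ^+ 2) + r)
  (hx : xl < xr)
  (mu : nat -> R) (psi : nat -> R -> R)
  (hSL : SL_eigensystem sigma q xl xr mu psi)
  (varsigma : R -> R) (g v : R -> R -> R)
  (hv : is_solution alpha lambda T sigma q xl xr varsigma g v)
  (eps : R) (heps : 0 < eps)
  (hvarsigma : in_HL xl xr mu psi ((5 + eps) / 2) varsigma)
  (hgd : forall x : R, x \in `]xl, xr[ -> derivable_in_n `]0, T] 2 (g x))
  (hg : forall (l : nat) (tau : R), (l <= 2)%N -> tau \in `]0, T] ->
     in_HL xl xr mu psi ((5 + eps) / 2)
       (fun x => derive_in_n `]0, T] l (g x) tau))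
  (rho C1 : R) (hrho : rho < 1)
  (hbound : forall tau : R, tau \in `]0, T] ->
     norm_HL xl xr mu psi ((5 + eps) / 2) (fun x => g x tau)
     + norm_HL xl xr mu psi ((1 + eps) / 2)
         (fun x => derive_in_n `]0, T] 1 (g x) tau)
     + tau `^ rho * norm_HL xl xr mu psi ((1 + eps) / 2)
         (fun x => derive_in_n `]0, T] 2 (g x) tau) <= C1) :
  (forall tau : R, tau \in `]0, T] -> derivable_in_n `[xl, xr] 4 (v^~ tau)) /\
  (forall x : R, x \in `[xl, xr] -> derivable_in_n `]0, T] 2 (v x)) /\
  exists C : R, forall x tau : R, x \in `[xl, xr] -> tau \in `]0, T] ->
    (forall p : nat, (p <= 4)%N ->
       `|derive_in_n `[xl, xr] p (v^~ tau) x| <= C) /\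
    (forall l : nat, (l <= 2)%N ->
       `|derive_in_n `]0, T] l (v x) tau| <= C * (1 + tau `^ (alpha - l%:R))).
Proof.
have q0 : 0 < q by rewrite hq ltr_wpDl// divr_ge0 ?sqr_ge0// mulr_ge0// sqr_ge0.
have [U [dU [ddU [B [B0 [U1 U2] [hU hdU hddU] vE]]]]] :=
  representation halpha hlambda hT hsigma q0 hx hv hSL heps hvarsigma hgd hg hrho hbound.
pose a n := eigval sigma q xl xr n `^ (- ((1 + eps) / 2)).
have a0 n : 0 <= a n by exact: powR_ge0.
have sa : summable a by exact: summable_eigval.
pose E t := expR (- lambda * t).
have E0 t : 0 <= E t by exact: expR_ge0.
have vV x t : xl <= x <= xr -> 0 <= t <= T -> v x t = E t * V xl xr U 0 x t.
  by move=> xI tT; rewrite -vE// mulrA -expRD mulNr addNr expR0 mul1r.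
have itT t : t \in `]0, T] -> 0 < t <= T by rewrite in_itv.
have T02 t : 0 < t <= T -> 0 <= t <= T /\ 0 < t < 2 * T.
  move=> /andP[t0 tT]; rewrite (ltW t0) tT t0; split => //=.
  by apply: (le_lt_trans tT); rewrite ltr_pMl// ltr1n.
have sp t : t \in `]0, T] -> derivable_in_n `[xl, xr] 4 (v^~ t) /\
    forall p x, (p <= 4)%N -> x \in `[xl, xr] -> derive_in_n `[xl, xr] p (v^~ t) x = E t * V xl xr U p x t.
  move=> /itT /T02[t0T _]; apply: (@derive_in_chain _ _ _ _ (fun p x => E t * V xl xr U p x t)).
  - by move=> x; rewrite in_itv/=; exact: acc_cc.
  - by move=> x; rewrite in_itv/= => xI; exact: vV.
  - by move=> p x p4 _; apply: dvZ; exact: (V_derive hx hsigma q0 sa hU).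
pose F x (k : nat) s := match k with
  | 0 => E s * V xl xr U 0 x s
  | 1 => E s * (Vt xl xr dU x s - lambda * V xl xr U 0 x s)
  | _ => E s * (Vtt xl xr ddU x s - 2 * lambda * Vt xl xr dU x s + lambda ^+ 2 * V xl xr U 0 x s)
  end.
have tm x : x \in `[xl, xr] -> derivable_in_n `]0, T] 2 (v x) /\
    forall k t, (k <= 2)%N -> t \in `]0, T] -> derive_in_n `]0, T] k (v x) t = F x k t.
  rewrite in_itv/= => xI; apply: derive_in_chain.
  - by move=> t /itT; exact: acc_oc.
  - by move=> t /itT /T02[t0T _]; exact: vV.
  - move=> k t k2 /itT /T02[_ tT].
    have d0 := Vt_derive hx hsigma q0 hT B0 a0 sa U1 hU hdU x tT.
    have d1 := Vtt_derive xl xr B0 a0 sa U2 hdU hddU x tT.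
    have dE := dv_exp (- lambda) t.
    case: k k2 => [|[|//]] _.
      by apply: dv_eq (dvM dE d0) _; rewrite /F /E; ring.
    by apply: dv_eq (dvM dE (dvB d1 (dvZ lambda d0))) _; rewrite /F /E; ring.
split; first by move=> t /sp[].
split; first by move=> x /tm[].
pose K0 : R := sumr (fun n => B * (Num.sqrt (2 / (xr - xl)) * (q^-1 + 2 / sigma ^+ 2) ^+ 2) * a n).
pose K1 : R := sumr (fun n => B * Num.sqrt (2 / (xr - xl)) * a n).
have TT : 0 < T <= T by rewrite hT lexx.
have T2T : 0 < T <= 2 * T by rewrite hT ler_peMl ?ler1n// ltW.
have bV p x t : (p <= 4)%N -> 0 < t <= T -> `|V xl xr U p x t| <= K0.
  by move=> p4 /T02[t0T _]; exact: (V_bound hx hsigma q0 sa hU).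
have bVt x t : 0 < t <= 2 * T -> `|Vt xl xr dU x t| <= K1 * t `^ (alpha - 1).
  exact: (Vt_bound xl xr sa hdU).
have bVtt x t : 0 < t <= 2 * T -> `|Vtt xl xr ddU x t| <= K1 * t `^ (alpha - 2).
  exact: (Vtt_bound xl xr sa hddU).
have K00 : 0 <= K0 by apply: le_trans (bV 0%N xl T isT TT).
have K10 : 0 <= K1.
  by rewrite -(pmulr_lge0 _ (powR_gt0 (alpha - 1) hT)); apply: le_trans (bVt xl T T2T).
exists (K0 * (1 + lambda + lambda ^+ 2) + K1 * (1 + 2 * lambda * T)) => x t xI tJ.
have tT := itT t tJ; have [_ /andP[t0 t2]] := T02 t tT.
have t2T : 0 < t <= 2 * T by rewrite t0 ltW.
have E1 : 0 <= E t <= 1 by rewrite E0 -[1]expR0 ler_expR mulNr oppr_le0 mulr_ge0// ltW.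
have X12 : t `^ (alpha - 1) = t * t `^ (alpha - 2).
  by rewrite -{2}(powRr1 (ltW t0)) -powRD ?(gt_eqF t0) ?implybT//; congr powR; ring.
have [h0 h1 h2] := bound_sum hlambda tT K00 K10 E1 (powR_ge0 _ _) (powR_ge0 _ _) X12
  (bV 0%N x t isT tT) (bVt x t t2T) (bVtt x t t2T).
have b0 p : (p <= 4)%N -> `|E t * V xl xr U p x t| <= K0.
  by move=> p4; rewrite normrM (ger0_norm (E0 t)); case/andP: E1 => _ e1;
    apply: (le_trans _ (bV p x t p4 tT)); rewrite ler_piMl.
split=> [p p4|l l2].
  by rewrite (sp t tJ).2//; exact: le_trans (b0 p p4) h0.
rewrite (tm x xI).2//; case: l l2 => [_|[_|[_|//]]]; rewrite /F//.
apply: (le_trans (b0 0%N isT)); apply: (le_trans h0).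
by rewrite ler_peMr ?lerDl ?powR_ge0//; exact: le_trans K00 h0.
Qed.
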